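(* Let $K$ be a field and let $G$ be a graph (loops allowed, no multiple edges) on the vertex set $[m]=\{1,\dots,m\}$ without isolated vertices, whose vertices are ordered as follows: $1$ is a vertex of highest degree, and for $2\le i\le m$, $i$ is a vertex of highest degree in the subgraph of $G$ induced on the vertex set $\{i,\dots,m\}$ of vertices remaining after $1,\dots,i-1$ have been chosen. Define $$n:=\max\{i\mid \text{there is a vertex } j\ge i \text{ such that } (i,j) \text{ is an edge of } G\},$$ and for $1\le i\le n$ $$\lambda_i:=\max\{j\mid (i,j)\text{ is an edge of }G\}.$$ Assume that $\lambda_1=m$ and $\lambda_1\ge\lambda_2\ge\cdots\ge\lambda_n$, and define for $1\le i\le n$ $$\mu_i:=-1+\min\{j\ge i\mid (i,j)\text{ is an edge of }G\}.$$ Assume furthermore that $\mu_1\le\mu_2\le\cdots\le\mu_n$ and that $(i,j)$ is an edge of $G$ whenever $1\le i\le n$ and $\mu_i<j\le\lambda_i$. Put $\lambda=(\lambda_1,\dots,\lambda_n)$, $\mu=(\mu_1,\dots,\mu_n)$. Then the edge ideal of $G$ is $I_G=\overline{I}_{\lambda-\mu}$ and $\mathcal{F}_{\overline{X}_{\lambda-\mu}}$ is the minimal free cellular $\mathbb{Z}^m$-graded resolution of $I_G$. In particular, $$\operatorname{reg}(I_G)=2,$$ $$\operatorname{ht} I_G=\min\Bigl\{\min_j\{\lambda_j-\mu_j+j-1\},\,n\Bigr\},$$ $$\operatorname{depth} S/I_G=m-\max_j\{\lambda_j-\mu_j+j-1\},$$ where $j$ ranges over $1,\dots,n$, and for every $i\ge1$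 the $i$-th Betti number of $S/I_G$ over $S=K[x_1,\dots,x_m]$ is $$\beta_i(S/I_G)=\binom{\lambda_1-\mu_1}{i}+\binom{\lambda_2-\mu_2+1}{i}+\cdots+\binom{\lambda_n-\mu_n+n-1}{i}-\binom{n}{i+1}.$$
   Context: The edge ideal $I_G\subset S=K[x_1,\dots,x_m]$ is generated by the monomials $x_ix_j$ such that $(i,j)$ is an edge of $G$ (edges are unordered; a loop at $i$ gives $x_i^2$). In the vertex ordering, either convention for how a loop contributes to the degree is permitted, and ties are broken arbitrarily. $\operatorname{reg}$ is Castelnuovo–Mumford regularity, $\operatorname{ht}$ is height, and $\beta_i(S/I_G)$ is the rank of the $i$-th free module in the minimal free resolution of $S/I_G$. **Specialized generalized Ferrers ideals.** For $\lambda=(\lambda_1,\dots,\lambda_n)$ with $m=\lambda_1\ge\cdots\ge\lambda_n\ge1$, $m\ge n$, and $\mu\in\mathbb{Z}^n$ with $0\le\mu_1\le\cdots\le\mu_n<\lambda_n$, the generalized Ferrers ideal is $I_{\lambda-\mu}:=(x_iy_j\mid 1\le i\le n,\ \mu_i<j\le\lambda_i)\subset K[x_1,\dots,x_n,y_1,\dots,y_m]$, and $\overline{I}_{\lambda-\mu}\subset S$ is its image under the substitution $x_i\mapsto x_i$, $y_j\mapsto x_j$, i.e. the ideal generated by the $x_ix_j$ with $1\le i\le n$, $\mu_i<j\le\lambda_i$. **Cellular complexes.** For a polyhedral cell complex $X$ (finite collection of polytopes closed under faces, any two meeting in a common face; the empty face is included) with an incidence function $\varepsilon$ (values $\pm1$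 on pairs of a face and one of its facets, defining the cellular boundary map) and vertices labeled by monomials in $S$, each face $Q$ is labeled by the least common multiple $\mathbf{x}^{\mathbf{a}_Q}$ of its vertex labels (the empty face has label $1$). The cellular complex $\mathcal{F}_X$ is $$0\to S^{F_d(X)}\xrightarrow{\partial_d}\cdots\xrightarrow{\partial_1}S^{F_0(X)}\xrightarrow{\partial_0}S\to0,$$ where $d=\dim X$, $F_k(X)$ is the set of $k$-dimensional faces, $S^{F_k(X)}=\bigoplus_{P\in F_k(X)}S[-\mathbf{a}_P]$ has basis $\{e_P\}$, $\partial_k(e_P)=\sum_{Q\text{ facet of }P}\varepsilon(P,Q)\mathbf{x}^{\mathbf{a}_P-\mathbf{a}_Q}e_Q$, and $e_\emptyset=1$. If it is acyclic (exact except at the last term $S$), it is called a cellular resolution of the ideal $\operatorname{im}\partial_0$ generated by the vertex labels. **The complex $\overline{X}_{\lambda-\mu}$.** Let $X_{n,m}$ be the face complex of $\Delta_{n-1}\times\Delta_{m-1}$ (product of simplices with vertices labeled $x_1,\dots,x_n$ and $y_1,\dots,y_m$ respectively), with vertices labeled $x_iy_j$. $X_{\lambda-\mu}$ is the subcomplex of all faces all of whose vertices have labels in $I_{\lambda-\mu}$; $\overline{X}_{\lambda-\mu}$ is the same cell complex with each vertex label $x_iy_j$ replaced by $x_ix_j$. *)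

(* Defs.v *)
From HB Require Import structures.
From mathcomp Require Import all_boot all_order all_algebra.
From mathcomp Require Import mpoly.
From mathcomp Require boolp.

Set Implicit Arguments.
Unset Strict Implicit.
Unset Printing Implicit Defensive.

Import Order.TTheory GRing.Theory Num.Theory.

Local Open Scope ring_scope.

(* Ideals are Prop-valued predicates on a commutative ring; membership in a   *)
(* generated ideal has no boolean test in general.                            *)

Definition ideal_gen (R : comNzRingType) (G : R -> Prop) (p : R) : Prop :=
  exists (k : nat) (c g : 'I_k -> R),
    (forall i, G (g i)) /\ p = \sum_(i < k) c i * g i.

Definition is_ideal (R : comNzRingType) (I : R -> Prop) : Prop :=
  [/\ I 0, forall p q, I p -> I q -> I (p + q) & forall c p, I p -> I (c * p)].

Definition prime_ideal (R : comNzRingType) (P : R -> Prop) : Prop :=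
  [/\ is_ideal P, ~ P 1 & forall p q, P (p * q) -> P p \/ P q].

Definition subideal (R : comNzRingType) (I J : R -> Prop) : Prop :=
  forall p, I p -> J p.

(* A strict chain c 0 < c 1 < ... < c h = P of prime ideals. *)
Definition prime_chain (R : comNzRingType) (P : R -> Prop) (h : nat) : Prop :=
  exists c : nat -> R -> Prop,
    [/\ forall k, (k <= h)%N -> prime_ideal (c k),
        forall k, (k < h)%N ->
          subideal (c k) (c k.+1) /\ ~ subideal (c k.+1) (c k)
      & forall p, c h p <-> P p].

Definition prime_height (R : comNzRingType) (P : R -> Prop) (h : nat) : Prop :=
  prime_chain P h /\ forall h', prime_chain P h' -> (h' <= h)%N.

Definition ideal_height (R : comNzRingType) (I : R -> Prop) (h : nat) : Prop :=
  (exists P, [/\ prime_ideal P, subideal I P & prime_height P h]) /\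
  (forall P h', prime_ideal P -> subideal I P -> prime_height P h' ->
     (h <= h')%N).

(* s is a regular sequence on the module R / I. *)
Fixpoint quot_regular (R : comNzRingType) (I : R -> Prop) (s : seq R) : Prop :=
  if s is f :: s' then
    (forall p, I (f * p) -> I p) /\
    quot_regular (ideal_gen (fun p => I p \/ p = f)) s'
  else ~ I 1.

Section PolynomialRing.

Variables (K : fieldType) (m : nat).
Implicit Types (P N I : {mpoly K[m]} -> Prop).

Definition irrelevant_ideal : {mpoly K[m]} -> Prop :=
  ideal_gen (fun p => exists i : 'I_m, p = 'X_i).

(* The depth of S / I with respect to the irrelevant ideal. *)
Definition quot_depth I (d : nat) : Prop :=
  (exists s : seq {mpoly K[m]},
     [/\ forall f, f \in s -> irrelevant_ideal f, quot_regular I s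
       & size s = d]) /\
  (forall s : seq {mpoly K[m]},
     (forall f, f \in s -> irrelevant_ideal f) -> quot_regular I s ->
     (size s <= d)%N).

(* Bounded below sequences of finite free modules, graded by a group A: the   *)
(* k-th module is the direct sum over i of S[- gshift k i]. Elements are row  *)
(* vectors, so the map from degree k.+1 to degree k is v |-> v *m gdif k.     *)
Record graded_complex (A : zmodType) := GradedComplex {
  grank : nat -> nat;
  gshift : forall k, 'I_(grank k) -> A;
  gdif : forall k, 'M[{mpoly K[m]}]_(grank k.+1, grank k)
}.

(* F, augmented by v |-> v *m aug, is a graded free resolution of the module  *)
(* P / N, for homogeneous ideals N contained in P; the degree of a monomial t *)
(* is wt t. Thus P = S, N = I gives S / I, and P = I, N = 0 gives I itself.   *)
Definition free_resolution (A : zmodType) (wt : 'X_{1..m} -> A) P N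
    (F : graded_complex A) (aug : 'cV[{mpoly K[m]}]_(grank F 0)) : Prop :=
  [/\ forall k i j t, t \in msupp (gdif F k i j) ->
        wt t + gshift j = gshift i,
      forall i t, t \in msupp (aug i 0) -> wt t = gshift i,
      (forall v : 'rV_(grank F 0), P ((v *m aug) 0 0)) /\
      (forall p, P p -> exists v : 'rV_(grank F 0), N (p - (v *m aug) 0 0)),
      forall v : 'rV_(grank F 0),
        N ((v *m aug) 0 0) <-> exists w, v = w *m gdif F 0
    & forall k (v : 'rV_(grank F k.+1)),
        v *m gdif F k = 0 <-> exists w, v = w *m gdif F k.+1].

Definition minimal_complex (A : zmodType) (F : graded_complex A) : Prop :=
  forall k i j, irrelevant_ideal (gdif F k i j).

Definition minimal_free_resolution (A : zmodType) (wt : 'X_{1..m} -> A) P N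
    (F : graded_complex A) (aug : 'cV[{mpoly K[m]}]_(grank F 0)) : Prop :=
  free_resolution wt P N aug /\ minimal_complex F.

Definition std_grading (t : 'X_{1..m}) : int := (mdeg t)%:Z.

Definition fine_grading (t : 'X_{1..m}) : {ffun 'I_m -> int} :=
  [ffun i => (t i)%:Z].

(* Invariants of "the" minimal resolution: one exists, and all of them have   *)
(* the stated value.                                                          *)
Definition betti_number P N (i : nat) (b : int) : Prop :=
  (exists (F : graded_complex int) (aug : 'cV_(grank F 0)),
     minimal_free_resolution std_grading P N aug) /\
  (forall (F : graded_complex int) (aug : 'cV_(grank F 0)),
     minimal_free_resolution std_grading P N aug -> (grank F i)%:Z = b).

Definition regularity P N (r : int) : Prop :=
  (exists (F : graded_complex int) (aug : 'cV_(grank F 0)),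
     minimal_free_resolution std_grading P N aug) /\
  (forall (F : graded_complex int) (aug : 'cV_(grank F 0)),
     minimal_free_resolution std_grading P N aug ->
     (exists k (i : 'I_(grank F k)), gshift i - k%:Z = r) /\
     (forall k (i : 'I_(grank F k)), gshift i - k%:Z <= r)).

End PolynomialRing.

(* A polyhedral cell complex enters through its face poset: a face is the set *)
(* of its vertices, X is the set of faces (with the empty face), and dim1 Q   *)
(* is 1 + dim Q, so that dim1 set0 = 0.                                       *)
Section CellularComplex.

Variables (K : fieldType) (m : nat) (V : finType).
Variables (X : {set {set V}}) (dim1 : {set V} -> nat).
Variables (eps : {set V} -> {set V} -> int) (label : V -> 'X_{1..m}).

Definition is_facet (Q P : {set V}) : bool :=
  (Q \subset P) && (dim1 P == (dim1 Q).+1).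

(* The last condition says that the cellular boundary squares to zero. *)
Definition incidence_function : Prop :=
  (forall P Q, P \in X -> Q \in X -> is_facet Q P ->
     eps P Q = 1 \/ eps P Q = -1) /\
  (forall P R, P \in X -> R \in X ->
     \sum_(Q in X | is_facet Q P && is_facet R Q) eps P Q * eps Q R = 0).

Definition faces_of_dim1 (k : nat) : {set {set V}} :=
  [set Q in X | dim1 Q == k].

Definition face_label (Q : {set V}) : 'X_{1..m} :=
  \big[@mlcm m/0%MM]_(v in Q) label v.

(* Degree k carries the faces of dimension k - 1, degree 0 the empty face. *)
Definition cellular_complex : graded_complex K m {ffun 'I_m -> int} :=
  @GradedComplex K m _
    (fun k => #|faces_of_dim1 k|)
    (fun k i => fine_grading (face_label (enum_val i)))
    (fun k => \matrix_(i, j)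
       let P := enum_val i in let Q := enum_val j in
       if is_facet Q P
       then (eps P Q)%:~R *: 'X_[K, (face_label P - face_label Q)%MM] else 0).

(* Acyclicity together with im (partial_0) = I, where the free module on the  *)
(* empty face is identified with S by e_emptyset = 1.                         *)
Definition minimal_cellular_resolution (I : {mpoly K[m]} -> Prop) : Prop :=
  @minimal_free_resolution K m _ (@fine_grading m)
    (fun _ => True) I cellular_complex (const_mx 1).

End CellularComplex.

(* Vertices are numbered from 0 ('I_n, 'I_m), while lam and mu keep their     *)
(* 1-based values: mu_i < j <= lam_i reads mu i <= j < lam i.                 *)
Section Ferrers.

Variables (K : fieldType) (n m : nat) (hnm : (n <= m)%N).
Variables (lam mu : 'I_n -> nat).

Definition ferrers_label (v : 'I_n * 'I_m) : 'X_{1..n + m} :=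
  (U_(lshift m v.1) + U_(rshift n v.2))%MM.

Definition ferrers_ideal : {mpoly K[n + m]} -> Prop :=
  ideal_gen (fun p => exists (i : 'I_n) (j : 'I_m),
    (mu i <= j < lam i)%N /\ p = 'X_(lshift m i) * 'X_(rshift n j)).

Definition spec_ferrers_ideal : {mpoly K[m]} -> Prop :=
  ideal_gen (fun p => exists (i : 'I_n) (j : 'I_m),
    (mu i <= j < lam i)%N /\ p = 'X_(widen_ord hnm i) * 'X_j).

(* Faces of the product of two simplices; the empty face is a product with an *)
(* empty factor.                                                              *)
Definition simplex_prod : {set {set 'I_n * 'I_m}} :=
  [set setX A B | A : {set 'I_n}, B : {set 'I_m}].

(* For nonempty A and B, dim (A x B) = (#|A| - 1) + (#|B| - 1). *)
Definition simplex_prod_dim1 (Q : {set 'I_n * 'I_m}) : nat :=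
  (#|[set v.1 | v in Q]| + #|[set v.2 | v in Q]|).-1.

Definition ferrers_complex : {set {set 'I_n * 'I_m}} :=
  [set Q in simplex_prod | boolp.asbool
     (forall v, v \in Q -> ferrers_ideal 'X_[K, ferrers_label v])].

Definition spec_ferrers_label (v : 'I_n * 'I_m) : 'X_{1..m} :=
  (U_(widen_ord hnm v.1) + U_(v.2))%MM.

End Ferrers.

Section Graph.

Variables (m : nat) (e : rel 'I_m).

Definition edge_ideal (K : fieldType) : {mpoly K[m]} -> Prop :=
  ideal_gen (fun p => exists i j : 'I_m, e i j /\ p = 'X_i * 'X_j).

(* Degree of v in the subgraph induced on the vertices w >= i; a loop at v    *)
(* contributes loopdeg.                                                       *)
Definition induced_degree (loopdeg : nat) (i v : 'I_m) : nat :=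
  (#|[set w : 'I_m | [&& (i <= w)%N, w != v & e v w]]| + loopdeg * e v v)%N.

(* The values below are the 1-based ones, hence the successors. *)
Definition graph_n : nat :=
  (\max_(i < m | [exists j : 'I_m, (i <= j)%N && e i j]) i.+1)%N.

Lemma graph_n_le : (graph_n <= m)%N.
Proof. by apply/bigmax_leqP => i _; apply: ltn_ord. Qed.

Definition graph_vertex (i : 'I_graph_n) : 'I_m := widen_ord graph_n_le i.

Definition graph_lam (i : 'I_graph_n) : nat :=
  (\max_(j < m | e (graph_vertex i) j) j.+1)%N.

(* The default value m of the minimum is an upper bound for every j.+1. *)
Definition graph_mu (i : 'I_graph_n) : nat :=
  (\big[minn/m]_(j < m | (graph_vertex i <= j)%N && e (graph_vertex i) j)
     j.+1).-1.

End Graph.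

(* Main.v *)
(** The ideal I_G is generated by the monomials x_i x_j with mu_i <= j < lam_i.
    In each multidegree b the faces of the cell complex with label dividing x^b
    are the products A x B all of whose cells divide x^b. The admissible columns
    of a row decrease with the row, so toggling the smallest admissible row i0 in
    A, and then, for A = {i0}, toggling one admissible column j0 in B, is a
    perfect matching of these faces; eliminating along it shows that the strand
    is exact, whatever the incidence function. The labels of a face of dimension
    k have degree k + 2, so the resolution is minimal and linear; comparing
    minimal resolutions through lifts of the identity gives the Betti numbers and
    the regularity, and counting faces by their last row gives the formula.

    For k < n the colon ideal (I, x_0, ..., x_(k-1)) : x_k is generated by the
    lam_k - mu_k + k variables of the k-th "cover". Every prime over I contains a
    cover or all n row variables, which gives the height. Filtering S/I by these
    colon ideals, a sequence regular modulo every cover is regular modulo I; such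
    a sequence is given by sums of variables over the blocks of a coloring. The
    facet with rows 0..k carries a nonzero Koszul homology class of S/I in degree
    lam_k - mu_k + k, which bounds every regular sequence. *)

Require Import Defs.
From HB Require Import structures.
From mathcomp Require Import all_boot all_order all_algebra.
From mathcomp Require Import mpoly.
From mathcomp Require boolp.
From mathcomp Require Import zify ring.

Set Implicit Arguments.
Unset Strict Implicit.
Unset Printing Implicit Defensive.

Import Order.TTheory GRing.Theory Num.Theory.

Local Open Scope ring_scope.

(** * Ideals and regular sequences *)

(** Two demands shape the resolution part. Exactness is claimed for every incidence function, so it
    may use only that incidences are signs and that the boundary squares to zero. Betti numbers and
    regularity assert that a minimal resolution exists, so one incidence function has to be
    exhibited; the join of the two simplices supplies it.

    Height is defined by chains of arbitrary primes. They are bounded by counting dimensions: a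
    chain of length r forces D^r polynomials of degree O(D), independent modulo its smallest prime,
    while S has only O(D^m) dimensions there.

    For depth, block sums are regular modulo a cover as soon as every block meets the complement of
    that cover. The indices of the covers avoiding a given variable form an interval, because lambda
    and mu are monotone, so one coloring with m - max |cover| colors serves all covers at once. The
    largest cover size is also the degree of a Koszul class, so both bounds meet.

    The degree ordering of G gives each row i < n an edge to some j >= i, whence mu_i < lambda_i. *)

Section Ideals.

Variable R : comNzRingType.
Implicit Types (I J G : R -> Prop) (p q f : R) (s : seq R).

(** Turns equivalent ideals into equal ones, so that they can be rewritten under [quot_regular] and
    [monomial_ideal]. *)
Lemma pred_ext (T : Type) (P Q : T -> Prop) : (forall x, P x <-> Q x) -> P = Q.
Proof.
by move=> PQ; apply: boolp.funext => x; apply: boolp.propext; apply: PQ.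
Qed.

Lemma ideal_gen_ideal G : is_ideal (ideal_gen G).
Proof.
split.
- exists 0%N, (fun _ => 0), (fun _ => 0); split; first by case.
  by rewrite big_ord0.
- move=> _ _ [k [c [g [Gg ->]]]] [k' [c' [g' [Gg' ->]]]].
  exists (k + k')%N.
  exists (fun i => match split i with inl j => c j | inr j => c' j end).
  exists (fun i => match split i with inl j => g j | inr j => g' j end).
  split; first by move=> i; case: split.
  rewrite big_split_ord /=; congr (_ + _); apply: eq_bigr => i _.
    by rewrite -[lshift _ _]/(unsplit (inl i)) unsplitK.
  by rewrite -[rshift _ _]/(unsplit (inr i)) unsplitK.
- move=> c _ [k [d [g [Gg ->]]]]; exists k, (fun i => c * d i), g; split=> //.
  by rewrite mulr_sumr; apply: eq_bigr => i _; rewrite mulrA.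
Qed.

Lemma ideal_gen_mem G p : G p -> ideal_gen G p.
Proof.
move=> Gp; exists 1%N, (fun _ => 1), (fun _ => p).
by split=> //; rewrite big_ord1 mul1r.
Qed.

Lemma ideal_sum I (T : Type) (r : seq T) (P : pred T) (F : T -> R) :
  is_ideal I -> (forall i, P i -> I (F i)) -> I (\sum_(i <- r | P i) F i).
Proof. by case=> I0 ID _ IF; apply: (big_ind I). Qed.

Lemma ideal_sum_in I (T : eqType) (r : seq T) (F : T -> R) :
  is_ideal I -> (forall i, i \in r -> I (F i)) -> I (\sum_(i <- r) F i).
Proof. by case=> I0 ID _ IF; rewrite big_seq; apply: (big_ind I). Qed.

Lemma ideal_opp I p : is_ideal I -> I p -> I (- p).
Proof. by case=> _ _ IM /(IM (-1)); rewrite mulN1r. Qed.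

Lemma ideal_sub I p q : is_ideal I -> I p -> I q -> I (p - q).
Proof. by move=> idI Ip Iq; case: (idI) => _ ID _; apply: ID => //; apply: ideal_opp. Qed.

Lemma ideal_gen_min G I : is_ideal I -> (forall p, G p -> I p) ->
  subideal (ideal_gen G) I.
Proof.
move=> idI GI _ [k [c [g [Gg ->]]]]; apply: ideal_sum => // i _.
by case: idI => _ _; apply; apply: GI.
Qed.

Definition ideal_adjoin I f : R -> Prop := ideal_gen (fun p => I p \/ p = f).

Lemma ideal_adjoin_ideal I f : is_ideal (ideal_adjoin I f).
Proof. exact: ideal_gen_ideal. Qed.

Lemma ideal_adjoinP I f p : is_ideal I ->
  ideal_adjoin I f p <-> exists c, I (p - c * f).
Proof.
move=> idI; case: (idI) => I0 ID IM; split.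
  apply: (@ideal_gen_min _ (fun p => exists c, I (p - c * f))).
    split.
    - by exists 0; rewrite mul0r subr0.
    - move=> x y [c Ic] [d Id]; exists (c + d).
      have -> : x + y - (c + d) * f = (x - c * f) + (y - d * f) by ring.
      exact: ID.
    - by move=> c x [d Id]; exists (c * d); rewrite -mulrA -mulrBr; apply: IM.
  move=> q [Iq|->]; first by exists 0; rewrite mul0r subr0.
  by exists 1; rewrite mul1r subrr.
case=> c Ic; rewrite -(subrK (c * f) p).
case: (ideal_adjoin_ideal I f) => _ JD JM.
apply: JD; first by apply: ideal_gen_mem; left.
by apply: JM; apply: ideal_gen_mem; right.
Qed.

Definition ideal_colon I f : R -> Prop := fun p => I (p * f).

Lemma ideal_colon_ideal I f : is_ideal I -> is_ideal (ideal_colon I f).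
Proof.
rewrite /ideal_colon; case=> I0 ID IM; split; first by rewrite mul0r.
  by move=> p q Ip Iq; rewrite mulrDl; apply: ID.
by move=> c p Ip; rewrite -mulrA; apply: IM.
Qed.

Lemma ideal_adjoinC I f g : is_ideal I ->
  ideal_adjoin (ideal_adjoin I f) g = ideal_adjoin (ideal_adjoin I g) f.
Proof.
move=> idI; apply: pred_ext => p.
split=> /(ideal_adjoinP _ _ (ideal_adjoin_ideal _ _)) [c];
  move=> /(ideal_adjoinP _ _ idI) [d Id];
  apply/(ideal_adjoinP _ _ (ideal_adjoin_ideal _ _)); exists d;
  apply/ideal_adjoinP => //; exists c; by rewrite addrAC.
Qed.

(* The extension 0 -> R/(I : x) -> R/I -> R/(I, x) -> 0. *)
Lemma quot_regular_ext I x s : is_ideal I ->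
  quot_regular (ideal_colon I x) s -> quot_regular (ideal_adjoin I x) s ->
  quot_regular I s.
Proof.
elim: s I => [|f s IHs] I idI /=.
  move=> _ nJ I1; apply: nJ; apply/ideal_adjoinP => //.
  by exists 0; rewrite mul0r subr0.
case=> fC rC [fA rA]; case: (idI) => I0 ID IM.
split=> [p Ifp|].
  (* Regularity of [f] modulo (I, x) gives p = c x modulo I; regularity modulo (I : x) then puts c x
     in I. *)
  have /(ideal_adjoinP _ _ idI) [c Ic] : ideal_adjoin I x p.
    apply: fA; apply/ideal_adjoinP => //.
    by exists 0; rewrite mul0r subr0.
  have Icx : I (c * x).
    apply: fC; rewrite /ideal_colon.
    have -> : f * c * x = f * p - f * (p - c * x) by ring.
    by apply: ideal_sub => //; apply: IM.
  by rewrite -(subrK (c * x) p); apply: ID.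
apply: IHs; first exact: ideal_adjoin_ideal; last first.
  by rewrite -/(ideal_adjoin I f) ideal_adjoinC.
(* Colon and adjunction commute: ((I : x), f) = ((I, f) : x). If p x = c f modulo I, then f c lies
   in (I, x), hence so does c, and c = d x modulo I yields (p - d f) x in I. *)
congr (quot_regular _ s): rC; apply: pred_ext => p.
rewrite -/(ideal_adjoin _ f).
split; first move=> /(ideal_adjoinP _ _ (ideal_colon_ideal x idI)) [c Ic].
  apply/ideal_adjoinP => //; exists (c * x).
  by have -> : p * x - c * x * f = (p - c * f) * x by ring.
move=> /(ideal_adjoinP _ _ idI) [c Ic].
have /(ideal_adjoinP _ _ idI) [d Id] : ideal_adjoin I x c.
  apply: fA; apply/ideal_adjoinP => //; exists p.
  have -> : f * c - p * x = - (p * x - c * f) by ring.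
  exact: ideal_opp.
apply/(ideal_adjoinP _ _ (ideal_colon_ideal x idI)); exists d.
rewrite /ideal_colon.
have -> : (p - d * f) * x = (p * x - c * f) + f * (c - d * x) by ring.
by apply: ID => //; apply: IM.
Qed.

(** An automorphism [a] carries R / I to R / a(I), and a(I) is written as the preimage of I under
    the inverse [b]. *)
Lemma quot_regular_morph (a b : {rmorphism R -> R}) I s : cancel a b ->
  cancel b a ->
  quot_regular I s -> quot_regular (fun p => I (b p)) [seq a f | f <- s].
Proof.
move=> aK bK; elim: s I => [|f s IHs] I /=; first by rewrite rmorph1.
case=> fI rI; split=> [p|]; first by rewrite rmorphM aK; apply: fI.
congr (quot_regular _ _): (IHs _ rI); apply: pred_ext => p; split.
  case=> k [c [g [Ig bp]]]; exists k, (fun i => a (c i)), (fun i => a (g i)).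
  split; last by rewrite -[p]bK bp rmorph_sum; apply: eq_bigr => i _;
    rewrite rmorphM.
  by move=> i; case: (Ig i) => [?|->]; [left; rewrite aK | right].
case=> k [c [g [Ig ->]]]; exists k, (fun i => b (c i)), (fun i => b (g i)).
split; last by rewrite rmorph_sum; apply: eq_bigr => i _; rewrite rmorphM.
by move=> i; case: (Ig i) => [?|->]; [left | right; rewrite aK].
Qed.

End Ideals.

(** * Monomial ideals *)

Section MonomialIdeals.

Variables (K : fieldType) (m : nat).
Notation S := {mpoly K[m]}.
Implicit Types (D : pred 'X_{1..m}) (p q : S) (t u : 'X_{1..m}).
Implicit Types (A : {set 'I_m}).

(** The linear projection onto the span of the monomials in [D]. It serves as homogeneous component
    and as the evaluation that sets some variables to zero. *)
Definition mfilter D p : S := \sum_(t <- msupp p | D t) p@_t *: 'X_[t].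

Lemma mcoeff_mfilter D p t : (mfilter D p)@_t = if D t then p@_t else 0.
Proof.
rewrite /mfilter raddf_sum /=.
under eq_bigr do rewrite mcoeffZ mcoeffX.
case: (boolP (t \in msupp p)) => [tp|tNp].
  rewrite -big_filter; case: ifP => Dt; last first.
    rewrite big_seq big1 // => u; rewrite mem_filter => /andP[Du _].
    by case: eqP => [ut|]; [rewrite -ut Du in Dt | rewrite mulr0].
  rewrite (bigD1_seq t) ?mem_filter ?Dt ?filter_uniq ?msupp_uniq //=.
  by rewrite eqxx mulr1 big1 ?addr0 // => u /negPf ->; rewrite mulr0.
rewrite (memN_msupp_eq0 tNp) if_same big_seq_cond big1 // => u /andP[up _].
by case: eqP => [ut|]; [rewrite ut (negPf tNp) in up | rewrite mulr0].
Qed.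

Lemma mfilter_is_zmod_morphism D : zmod_morphism (mfilter D).
Proof.
move=> p q; apply/mpolyP => t; rewrite mcoeffB !mcoeff_mfilter mcoeffB.
by case: ifP; rewrite ?subr0.
Qed.

HB.instance Definition _ D := GRing.isZmodMorphism.Build S S (mfilter D)
  (@mfilter_is_zmod_morphism D).

Lemma msupp_mfilter D p t : (t \in msupp (mfilter D p)) = D t && (t \in msupp p).
Proof. by rewrite !mcoeff_msupp mcoeff_mfilter; case: (D t); rewrite ?eqxx. Qed.

Lemma mcoeff_mulX p u t :
  (p * 'X_[u])@_t = if (u <= t)%MM then p@_(t - u)%MM else 0.
Proof.
case: ifP => [ut|nut]; first by rewrite -{1}(submK ut) addmC mcoeffMX.
apply/eqP; rewrite mcoeff_eq0 (perm_mem (msuppMX p u)); apply/mapP => -[v _ tE].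
by rewrite tE lem_addr in nut.
Qed.

Definition upclosed D := forall t u, D t -> D (t + u)%MM.

(** Membership is read off the support, so that colons by monomials and adjunctions of monomials
    become operations on the exponent set [D]. *)
Definition monomial_ideal D : S -> Prop := fun p => forall t, t \in msupp p -> D t.

Lemma monomial_ideal_ideal D : upclosed D -> is_ideal (monomial_ideal D).
Proof.
move=> Dup; split.
- by move=> t; rewrite msupp0.
- move=> p q Dp Dq t /msuppD_le; rewrite mem_cat => /orP[]; [exact: Dp|exact: Dq].
- move=> c p Dp t /msuppM_le /allpairsP[[u v] /= [uc vp ->]].
  by rewrite addmC; apply: Dup; apply: Dp.
Qed.

Lemma monomial_idealX D t : monomial_ideal D 'X_[t] <-> D t.
Proof.
split=> [|Dt u]; first by apply; rewrite msuppX inE.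
by rewrite msuppX inE => /eqP ->.
Qed.

Lemma ideal_gen_monomial (G : S -> Prop) D : upclosed D ->
  (forall p, G p -> monomial_ideal D p) ->
  (forall t, D t -> exists2 u, G 'X_[u] & (u <= t)%MM) ->
  ideal_gen G = monomial_ideal D.
Proof.
move=> Dup GD DG; apply: pred_ext => p; split.
  by apply: ideal_gen_min => //; apply: monomial_ideal_ideal.
move=> Dp; rewrite [p]mpolyE; have [_ _ IM] := ideal_gen_ideal G.
apply: ideal_sum_in => [|t /Dp /DG [u Gu ut]]; first exact: ideal_gen_ideal.
rewrite -(submK ut) mpolyXD scalerAl.
by apply: IM; apply: ideal_gen_mem.
Qed.

Lemma monomial_ideal_colon D u :
  ideal_colon (monomial_ideal D) 'X_[u] = monomial_ideal (fun t => D (t + u)%MM).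
Proof.
apply: pred_ext => p; split=> Dp t; rewrite ?(perm_mem (msuppMX p u)).
  by move=> tp; apply: Dp; rewrite (perm_mem (msuppMX p u)) addmC map_f.
by move=> /mapP [v vp ->]; rewrite addmC; apply: Dp.
Qed.

Lemma monomial_ideal_adjoin D u : upclosed D ->
  ideal_adjoin (monomial_ideal D) 'X_[u] =
  monomial_ideal (fun t => D t || (u <= t)%MM).
Proof.
move=> Dup; have Uup : upclosed (fun t => D t || (u <= t)%MM).
  move=> t v /orP[/Dup ->//|ut]; apply/orP; right.
  exact: lepm_trans ut (lem_addr _ _).
apply: ideal_gen_monomial => // [p [Dp t /Dp -> //|->]|t /orP[Dt|ut]].
- by apply/monomial_idealX; rewrite lepm_refl orbT.
- by exists t; [left; apply/monomial_idealX | apply: lepm_refl].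
- by exists u; [right|].
Qed.

Definition hits A t := [exists a in A, t a != 0%N].

Lemma hits_upclosed A : upclosed (hits A).
Proof.
move=> t u /exists_inP [a aA ta]; apply/exists_inP; exists a => //.
by rewrite mnmDE addn_eq0 negb_and ta.
Qed.

Lemma hitsU A i : hits A U_(i) = (i \in A).
Proof.
apply/exists_inP/idP => [[a aA]|iA]; last by exists i; rewrite // mnm1E eqxx.
by rewrite mnm1E eqb0 negbK => /eqP ->.
Qed.

Lemma hitsD A t u : hits A (t + u)%MM = hits A t || hits A u.
Proof.
apply/idP/orP => [/exists_inP [a aA]|[|] h].
- by rewrite mnmDE addn_eq0 negb_and => /orP[] h; [left|right];
    apply/exists_inP; exists a.
- exact: hits_upclosed.
- by rewrite addmC; apply: hits_upclosed.
Qed.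

Definition var_ideal A := monomial_ideal (hits A).

Lemma var_ideal_ideal A : is_ideal (var_ideal A).
Proof. by apply: monomial_ideal_ideal; apply: hits_upclosed. Qed.

Lemma var_idealU A i : var_ideal A 'X_i <-> i \in A.
Proof. by rewrite -hitsU; apply: monomial_idealX. Qed.

Lemma var_ideal_adjoin A i :
  ideal_adjoin (var_ideal A) 'X_i = var_ideal (i |: A).
Proof.
rewrite /var_ideal monomial_ideal_adjoin; last exact: hits_upclosed.
congr monomial_ideal; apply: boolp.funext => t; rewrite lep1mP.
apply/orP/exists_inP => [[/exists_inP [a aA ta]|ti]|[a]].
- by exists a; rewrite // !inE aA orbT.
- by exists i; rewrite // !inE eqxx.
- rewrite !inE => /orP[/eqP ->|aA ta]; first by right.
  by left; apply/exists_inP; exists a.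
Qed.

(* The ideal is the kernel of the evaluation x_a := 0 for a in A. *)
Lemma var_ideal_prime A : prime_ideal (var_ideal A).
Proof.
pose lq := [tuple (if i \in A then 0 else 'X_i : S) | i < m].
have phiX t : 'X_[t] \mPo lq = if hits A t then 0 else 'X_[t] :> S.
  rewrite comp_mpolyX; case: ifP => [/exists_inP [a aA ta]|/negbT].
    by rewrite (bigD1 a) //= tnth_mktuple aA expr0n (negPf ta) mul0r.
  rewrite negb_exists_in => /forall_inP At; rewrite [RHS]mpolyXE_id.
  apply: eq_bigr => i _; rewrite tnth_mktuple; case: ifP => // iA.
  by move: (At _ iA); rewrite negbK => /eqP ->; rewrite !expr0.
have phiE p : p \mPo lq = mfilter (predC (hits A)) p.
  rewrite {1}[p]mpolyE raddf_sum /= /mfilter [RHS]big_mkcond /=.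
  apply: eq_bigr => t _; rewrite comp_mpolyZ phiX /=.
  by case: (hits A t); rewrite ?scaler0.
have AP p : var_ideal A p <-> p \mPo lq = 0.
  rewrite phiE; split=> [Ap|p0 t].
    apply/mpolyP => t; rewrite mcoeff_mfilter mcoeff0 /=; case: ifPn => // nt.
    by apply: memN_msupp_eq0; apply: contra nt; apply: Ap.
  rewrite mcoeff_msupp; apply: contraR => /negbTE nt.
  by move/mpolyP/(_ t): p0; rewrite mcoeff_mfilter mcoeff0 /= nt /= => ->; rewrite eqxx.
split; first exact: var_ideal_ideal.
  rewrite AP comp_mpoly1 => /eqP; by rewrite oner_eq0.
move=> p q; rewrite !AP rmorphM => /eqP; rewrite mulf_eq0.
by case/orP => /eqP; [left|right].
Qed.

Lemma irrelevant_idealE : @irrelevant_ideal K m = var_ideal setT.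
Proof.
apply: ideal_gen_monomial; first exact: hits_upclosed.
  by move=> _ [i ->]; apply/monomial_idealX; rewrite hitsU inE.
move=> t /exists_inP [i _ ti]; exists U_(i)%MM; first by exists i.
by rewrite lep1mP.
Qed.

(** Minimality thus becomes the vanishing of constant terms, and reduction modulo the irrelevant
    ideal is the ring morphism taking constant terms. *)
Lemma irrelevantP p : irrelevant_ideal p <-> p@_0 = 0.
Proof.
rewrite irrelevant_idealE; split=> [Ip|p0 t tp].
  apply: memN_msupp_eq0; apply/negP => /Ip /exists_inP [a _].
  by rewrite mnm0E.
apply/negbNE/negP => nt; move: tp; suff -> : t = 0%MM by rewrite mcoeff_msupp p0 eqxx.
apply/mnmP => i; rewrite mnm0E; apply/eqP; apply: contraNT nt => ti.
by apply/exists_inP; exists i.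
Qed.

End MonomialIdeals.

(** * Comparison of graded resolutions *)

Section Comparison.

Variables (K : fieldType) (m : nat) (A : zmodType) (wt : 'X_{1..m} -> A).
Hypothesis wtD : forall t u, wt (t + u)%MM = wt t + wt u.
Notation S := {mpoly K[m]}.
Implicit Types (p q : S) (t u : 'X_{1..m}) (a b : A).

Lemma mfilter_id (D : pred 'X_{1..m}) p :
  (forall t, t \in msupp p -> D t) -> mfilter D p = p.
Proof.
move=> Dp; apply/mpolyP => t; rewrite mcoeff_mfilter; case: ifPn => // nt.
by apply/esym/memN_msupp_eq0; apply: contra nt; apply: Dp.
Qed.

Lemma mfilter_eq0 (D : pred 'X_{1..m}) p :
  (forall t, t \in msupp p -> ~~ D t) -> mfilter D p = 0.
Proof.
move=> Dp; apply/mpolyP => t; rewrite mcoeff_mfilter mcoeff0; case: ifPn => // Dt.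
by apply: memN_msupp_eq0; apply: contraL Dt; apply: Dp.
Qed.

Definition homog_comp a p := mfilter (fun t => wt t == a) p.

(** Degrees lie in a group, so adding b is injective and the terms of [p] outside degree a
    contribute nothing in degree a + b. *)
Lemma homog_compM a b p q : (forall t, t \in msupp q -> wt t = b) ->
  homog_comp (a + b) (p * q) = homog_comp a p * q.
Proof.
move=> qb; have pE : p = homog_comp a p + mfilter (fun t => wt t != a) p.
  apply/mpolyP => t; rewrite mcoeffD !mcoeff_mfilter.
  by case: eqP; rewrite ?addr0 ?add0r.
rewrite {1}pE mulrDl {1}/homog_comp raddfD /=.
rewrite [X in X + _]mfilter_id; last first.
  move=> t /msuppM_le /allpairsP[[u v] /= [+ /qb vb ->]].
  by rewrite msupp_mfilter wtD vb (inj_eq (addIr b)) => /andP[].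
rewrite [X in _ + X]mfilter_eq0 ?addr0 //.
move=> t /msuppM_le /allpairsP[[u v] /= [+ /qb vb ->]].
by rewrite msupp_mfilter wtD vb (inj_eq (addIr b)) => /andP[].
Qed.

Lemma wt0 : wt 0%MM = 0.
Proof. by apply: (addrI (wt 0%MM)); rewrite -wtD addm0 addr0. Qed.

Definition homog_row n a (s : 'I_n -> A) (v : 'rV[S]_n) : 'rV[S]_n :=
  \row_j homog_comp (a - s j) (v 0 j).

Lemma homog_rowP n a (s : 'I_n -> A) (v : 'rV[S]_n) j t :
  t \in msupp (homog_row a s v 0 j) -> wt t + s j = a.
Proof. by rewrite mxE msupp_mfilter => /andP[/eqP -> _]; rewrite subrK. Qed.

Lemma homog_row_id n a (s : 'I_n -> A) (v : 'rV[S]_n) :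
  (forall j t, t \in msupp (v 0 j) -> wt t + s j = a) -> homog_row a s v = v.
Proof.
move=> va; apply/rowP => j; rewrite mxE /homog_comp mfilter_id // => t /va <-.
by rewrite addrK.
Qed.

Lemma homog_row_mul n k a (s : 'I_n -> A) (s' : 'I_k -> A)
    (M : 'M[S]_(n, k)) (v : 'rV[S]_n) :
  (forall i j t, t \in msupp (M i j) -> wt t + s' j = s i) ->
  homog_row a s' (v *m M) = homog_row a s v *m M.
Proof.
move=> Mh; apply/rowP => j; rewrite !mxE /homog_comp raddf_sum /=.
apply: eq_bigr => i _; rewrite mxE -(@homog_compM _ (s i - s' j)).
  by rewrite /homog_comp addrA subrK.
by move=> t /Mh <-; rewrite addrK.
Qed.

Lemma row_choice n k (Q : 'I_n -> 'rV[S]_k -> Prop) :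
  (forall i, exists w, Q i w) ->
  exists M : 'M[S]_(n, k), forall i, Q i (row i M).
Proof.
move=> /fin_all_exists [w Qw]; exists (\matrix_i w i) => i.
by rewrite rowK.
Qed.

Lemma row_lift n k l (M : 'M[S]_(n, l)) (d : 'M[S]_(k, l)) :
  (forall i, exists w, row i M = w *m d) -> exists X : 'M[S]_(n, k), X *m d = M.
Proof.
move=> /row_choice [X XP]; exists X; apply/row_matrixP => i.
by rewrite row_mul -XP.
Qed.

Definition homog_closed (N : S -> Prop) :=
  forall a p, N p -> N (homog_comp a p).

Lemma resolution_dd (P N : S -> Prop) (F : graded_complex K m A) aug k :
  @free_resolution K m A wt P N F aug -> gdif F k.+1 *m gdif F k = 0.
Proof.
case=> _ _ _ _ ex; apply/row_matrixP => i; rewrite row0 row_mul.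
by apply/ex; exists (delta_mx 0 i); rewrite -rowE.
Qed.

(* Lifting the identity both ways gives chain maps f and g with f g - 1       *)
(* null-homotopic, hence zero modulo the irrelevant ideal by minimality.      *)
Lemma resolution_compare (P N : S -> Prop)
    (F G : graded_complex K m A) augF augG :
  is_ideal N -> homog_closed N ->
  @free_resolution K m A wt P N F augF -> minimal_complex F ->
  @free_resolution K m A wt P N G augG ->
  forall k, exists (f : 'M[S]_(grank F k, grank G k))
                   (g : 'M[S]_(grank G k, grank F k)),
    (forall i j t, t \in msupp (f i j) -> wt t + gshift j = gshift i) /\
    (forall i j, irrelevant_ideal ((f *m g - 1%:M) i j)).
Proof.
move=> idN hN rF minF rG.
have irr_ideal : is_ideal (@irrelevant_ideal K m) by apply: ideal_gen_ideal.
have irrD p q : irrelevant_ideal p -> irrelevant_ideal q ->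
    irrelevant_ideal (p + q) by case: irr_ideal => _ + _; apply.
have irr_mull n k l (X : 'M[S]_(n, k)) (d : 'M[S]_(k, l)) :
    (forall i j, irrelevant_ideal (d i j)) ->
    forall i j, irrelevant_ideal ((X *m d) i j).
  move=> dI i j; rewrite mxE; apply: ideal_sum => // x _.
  by case: irr_ideal => _ _; apply.
have irr_mulr n k l (d : 'M[S]_(n, k)) (X : 'M[S]_(k, l)) :
    (forall i j, irrelevant_ideal (d i j)) ->
    forall i j, irrelevant_ideal ((d *m X) i j).
  move=> dI i j; rewrite mxE; apply: ideal_sum => // x _.
  by rewrite mulrC; case: irr_ideal => _ _; apply.
have ddF k := resolution_dd k rF; have ddG k := resolution_dd k rG.
case: (rF) => homF augFh [augFP augF_surj] exF0 exF.
case: (rG) => homG augGh [augGP augG_surj] exG0 exG.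
case: (idN) => N0 ND NM.
have N_mul n k (X : 'M[S]_(n, k)) (y : 'cV[S]_k) :
    (forall i, N (y i 0)) -> forall i, N ((X *m y) i 0).
  by move=> Ny i; rewrite mxE; apply: ideal_sum => // j _; apply: NM.
have N_opp n (y : 'cV[S]_n) : (forall i, N (y i 0)) ->
    forall i, N ((- y) i 0).
  by move=> Ny i; rewrite mxE; apply: ideal_opp.
have N_add n (y z : 'cV[S]_n) : (forall i, N (y i 0)) ->
    (forall i, N (z i 0)) -> forall i, N ((y + z) i 0).
  by move=> Ny Nz i; rewrite mxE; apply: ND.
have row_aug n k (X : 'M[S]_(n, k)) (y : 'cV[S]_k) i :
    (row i X *m y) 0 0 = (X *m y) i 0.
  by rewrite -row_mul [LHS]mxE.
move=> k.
(* The invariant of the induction: [f] and [g] extend by one degree because their composites with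
   the differentials are boundaries, and the equation with [h] is what makes the next homotopy
   liftable by exactness. *)
suff: exists (f : 'M[S]_(grank F k, grank G k))
             (g : 'M[S]_(grank G k, grank F k))
             (h : 'M[S]_(grank F k, grank F k.+1)),
    [/\ forall i j t, t \in msupp (f i j) -> wt t + gshift j = gshift i,
        forall i, exists w, row i (gdif F k *m f) = w *m gdif G k,
        forall i, exists w, row i (gdif G k *m g) = w *m gdif F k,
        gdif F k *m (f *m g - 1%:M - h *m gdif F k) = 0
      & forall i j, irrelevant_ideal ((f *m g - 1%:M) i j)].
  by case=> f [g [h [fh _ _ _ fg]]]; exists f, g.
elim: k => [|k [f [g [h [fh fim gim dfg fg1]]]]].
  have [f fP] : exists f : 'M[S]_(grank F 0, grank G 0), forall i,
      (forall j t, t \in msupp (row i f 0 j) -> wt t + gshift j = gshift i) /\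
      N (augF i 0 - (row i f *m augG) 0 0).
    apply: (row_choice (Q := fun i w =>
      (forall j t, t \in msupp (w 0 j) -> wt t + gshift j = gshift i) /\
      N (augF i 0 - (w *m augG) 0 0))) => i.
    have /augG_surj [v Nv] : P (augF i 0).
      by have := augFP (delta_mx 0 i); rewrite -rowE mxE.
    (* Keeping only the component in the degree of the generator preserves the congruence: [N] is
       homogeneous and [augF i 0] already has that degree. *)
    exists (homog_row (gshift i) (@gshift _ _ _ G 0) v).
    split=> [j t|]; first exact: homog_rowP.
    move: (hN (gshift i) _ Nv); rewrite /homog_comp raddfB /=.
    rewrite mfilter_id; last by move=> t /augFh ->.
    congr (N (_ - _)).
    rewrite -(@homog_row_mul _ 1 (gshift i) (@gshift _ _ _ G 0) (fun=> 0)).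
      by rewrite [RHS]mxE subr0.
    by move=> x y t; rewrite ord1 addr0; apply: augGh.
  have [g gP] : exists g : 'M[S]_(grank G 0, grank F 0), forall i,
      N (augG i 0 - (row i g *m augF) 0 0).
    apply: (row_choice (Q := fun i w => N (augG i 0 - (w *m augF) 0 0))) => i.
    apply: augF_surj.
    by have := augGP (delta_mx 0 i); rewrite -rowE mxE.
  have fN i : N ((augF - f *m augG) i 0).
    by have [_] := fP i; rewrite row_aug !mxE.
  have gN i : N ((augG - g *m augF) i 0).
    by have := gP i; rewrite row_aug !mxE.
  have dN i : N ((gdif F 0 *m augF) i 0).
    rewrite -row_aug; apply/exF0; exists (delta_mx 0 i).
    by rewrite -rowE.
  have dGN i : N ((gdif G 0 *m augG) i 0).
    rewrite -row_aug; apply/exG0; exists (delta_mx 0 i).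
    by rewrite -rowE.
  have [h hE] : exists h : 'M[S]_(_, _), h *m gdif F 0 = f *m g - 1%:M.
    apply: row_lift => i; apply/exF0; rewrite row_aug.
    have -> : (f *m g - 1%:M) *m augF =
        - (f *m (augG - g *m augF) + (augF - f *m augG)).
      rewrite mulmxBl mul1mx mulmxBr mulmxA.
      by rewrite opprD !opprB addrA subrK.
    by apply: N_opp; apply: N_add => //; apply: N_mul.
  exists f, g, h; split.
  - by move=> i j t tf; have [fh _] := fP i; apply: fh; rewrite mxE.
  - move=> i; apply/exG0; rewrite row_aug -mulmxA.
    have -> : gdif F 0 *m (f *m augG) =
        gdif F 0 *m augF - gdif F 0 *m (augF - f *m augG).
      by rewrite mulmxBr subKr.
    by apply: N_add => //; apply: N_opp; apply: N_mul.
  - move=> i; apply/exF0; rewrite row_aug -mulmxA.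
    have -> : gdif G 0 *m (g *m augF) =
        gdif G 0 *m augG - gdif G 0 *m (augG - g *m augF).
      by rewrite mulmxBr subKr.
    by apply: N_add => //; apply: N_opp; apply: N_mul.
  - by rewrite hE subrr mulmx0.
  - by rewrite -hE; apply: irr_mull => i j; apply: minF.
have [f' f'P] : exists f' : 'M[S]_(grank F k.+1, grank G k.+1), forall i,
    (forall j t, t \in msupp (row i f' 0 j) -> wt t + gshift j = gshift i) /\
    row i (gdif F k *m f) = row i f' *m gdif G k.
  apply: (row_choice (Q := fun i w =>
    (forall j t, t \in msupp (w 0 j) -> wt t + gshift j = gshift i) /\
    row i (gdif F k *m f) = w *m gdif G k)) => i.
  have [w wE] := fim i.
  exists (homog_row (gshift i) (@gshift _ _ _ G k.+1) w).
  split=> [j t|]; first exact: homog_rowP.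
  rewrite -(@homog_row_mul _ _ _ _ (@gshift _ _ _ G k)) -?wE; last exact: homG.
  rewrite homog_row_id // => j t; rewrite !mxE => /msupp_sum_le.
  case/flatten_mapP => x _ /msuppM_le /allpairsP[[u v] /= [uF vf ->]].
  by rewrite wtD -addrA (fh _ _ _ vf) (homF _ _ _ _ uF).
have f'E : f' *m gdif G k = gdif F k *m f.
  by apply/row_matrixP => i; rewrite row_mul; case: (f'P i) => _ ->.
have [g' g'E] := row_lift gim.
have [h' h'E] : exists h' : 'M[S]_(_, _),
    h' *m gdif F k.+1 = f' *m g' - 1%:M - gdif F k *m h.
  apply: row_lift => i; apply/exF; rewrite -row_mul.
  transitivity (row i (0 : 'M[S]_(grank F k.+1, grank F k))); last exact: row0.
  congr (row i _); rewrite -dfg !mulmxBl mul1mx !mulmxBr mulmx1 -!mulmxA g'E.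
  by rewrite !mulmxA f'E.
exists f', g', h'; split.
- by move=> i j t tf; have [fh' _] := f'P i; apply: fh'; rewrite mxE.
- by move=> i; apply/exG; rewrite -row_mul -mulmxA f'E mulmxA ddF mul0mx row0.
- by move=> i; apply/exF; rewrite -row_mul -mulmxA g'E mulmxA ddG mul0mx row0.
- by rewrite h'E opprB addrC subrK mulmxA ddF mul0mx.
- move=> i j.
  have -> : f' *m g' - 1%:M = h' *m gdif F k.+1 + gdif F k *m h.
    by rewrite h'E subrK.
  rewrite mxE; apply: irrD.
    by apply: irr_mull => ? ?; apply: minF.
  by apply: irr_mulr => ? ?; apply: minF.
Qed.

(** Taking constant terms turns f g = 1 modulo the irrelevant ideal into an identity over K, which
    bounds the rank. Each row of [f] then has an entry with nonzero constant term, and homogeneity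
    equates the two shifts. Used in both directions, it makes the ranks of two minimal resolutions
    equal. *)
Lemma minimal_resolution_rank_shift (P N : S -> Prop)
    (F G : graded_complex K m A) augF augG :
  is_ideal N -> homog_closed N ->
  @free_resolution K m A wt P N F augF -> minimal_complex F ->
  @free_resolution K m A wt P N G augG ->
  forall k, (grank F k <= grank G k)%N /\
    forall i : 'I_(grank F k), exists j : 'I_(grank G k), gshift j = gshift i.
Proof.
move=> idN hN rF minF rG k.
have [f [g [fh fg]]] := resolution_compare idN hN rF minF rG k.
pose c0 := mcoeff (R := K) (0%MM : 'X_{1..m}).
have fg1 : map_mx c0 f *m map_mx c0 g = 1%:M.
  rewrite -map_mxM -(subrK 1%:M (f *m g)) map_mxD map_mx1.
  rewrite [X in X + _](_ : _ = 0) ?add0r //; apply/matrixP => i j.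
  by rewrite [LHS]mxE [RHS]mxE; apply/irrelevantP/fg.
split=> [|i]; first exact: mulmx1_min fg1.
suff [j fij] : exists j, c0 (f i j) != 0.
  by exists j; rewrite -(fh i j 0%MM) ?wt0 ?add0r // mcoeff_msupp.
case: (pickP (fun j => c0 (f i j) != 0)) => [j fij|f0]; first by exists j.
move/matrixP/(_ i i): fg1; rewrite !mxE eqxx big1 => [/esym/eqP|j _].
  by rewrite oner_eq0.
by rewrite mxE (eqP (negbFE (f0 j))) mul0r.
Qed.

End Comparison.

(** * Koszul homology *)

Section SimplicialSigns.

Variable N : nat.
Implicit Types (u v : 'I_N) (T : {set 'I_N}).

(** The position of [u] in the increasing list of [T]; its parity is the sign for moving e_u into
    place in e_T. *)
Definition pos u T := #|[set v in T | (v < u)%N]|.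

Lemma pos_setU1 u v T : v \notin T -> pos u (v |: T) = ((v < u)%N + pos u T)%N.
Proof.
move=> vT; rewrite /pos; case: ltnP => vu.
  rewrite (cardsD1 v) !inE eqxx vu /=; congr (_ + #|pred_of_set _|)%N.
  apply/setP => x; rewrite !inE.
  by case: (x =P v) => [->|//]; rewrite (negPf vT).
rewrite add0n; congr #|pred_of_set _|; apply/setP => x; rewrite !inE.
by case: eqP => // ->; rewrite ltnNge vu /= !andbF.
Qed.

(** Exactly one of u < v and v < u holds, so the two insertions raise the total exponent by one. *)
Lemma pos_anticomm (R : pzRingType) u v T : u != v -> u \notin T -> v \notin T ->
  (-1) ^+ pos u (v |: T) * (-1) ^+ pos v (u |: T) =
  - ((-1) ^+ pos u T * (-1) ^+ pos v T) :> R.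
Proof.
move=> uv uT vT; rewrite !pos_setU1 // -!exprD.
have -> : ((v < u) + pos u T + ((u < v) + pos v T) = 1 + (pos u T + pos v T))%N.
  move: uv; rewrite -(inj_eq val_inj) /=; lia.
by rewrite exprD expr1 mulN1r.
Qed.

Lemma sign_cancel (R : comPzRingType) k (x y z : R) :
  (-1) ^+ k * x * ((-1) ^+ k * y * z) = x * y * z.
Proof.
have -> : (-1) ^+ k * x * ((-1) ^+ k * y * z) = ((-1) ^+ k) ^+ 2 * (x * y * z).
  by rewrite expr2; ring.
by rewrite sqrr_sign mul1r.
Qed.

Lemma antisym_sum (V : zmodType) (F : 'I_N -> 'I_N -> V) :
  (forall u, F u u = 0) -> (forall u v, u != v -> F u v = - F v u) ->
  \sum_u \sum_v F u v = 0.
Proof.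
move=> F0 Fa.
have -> : \sum_u \sum_v F u v =
    \sum_(u < N) \sum_(v < N | (u < v)%N) F u v +
    \sum_(u < N) \sum_(v < N | (v < u)%N) F u v.
  rewrite -big_split /=; apply: eq_bigr => u _.
  rewrite (bigD1 u) //= F0 add0r (bigID (fun v : 'I_N => u < v)%N) /=.
  by congr (_ + _); apply: eq_bigl => v; rewrite -(inj_eq val_inj) /=; lia.
rewrite [X in _ + X](exchange_big_dep predT) //= -big_split /= big1 // => u _.
rewrite -big_split /= big1 // => v uv; rewrite (Fa v u) ?addrN //.
by rewrite -(inj_eq val_inj) /=; lia.
Qed.

End SimplicialSigns.

Section Koszul.

Variables (S : comNzRingType) (m : nat).
Implicit Types (x c : 'I_m -> S) (z w : {set 'I_m} -> S) (T : {set 'I_m}).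
Implicit Types (u v : 'I_m).

(* The Koszul complex on the sequence x: z T is the coefficient of e_T. *)
Definition koszul_d x z T : S :=
  \sum_(u | u \notin T) (-1) ^+ pos u T * x u * z (u |: T).

(** Exterior multiplication by the degree-one element sum_u c_u e_u. *)
Definition koszul_wedge (c : 'I_m -> S) z T : S :=
  \sum_(u | u \in T) (-1) ^+ pos u (T :\ u) * c u * z (T :\ u).

Lemma koszul_dd x z T : koszul_d x (koszul_d x z) T = 0.
Proof.
rewrite -[RHS](@antisym_sum m S (fun u v =>
  if [&& u \notin T, v \notin T & u != v] then
    (-1) ^+ pos u T * x u * ((-1) ^+ pos v (u |: T) * x v *
       z (v |: (u |: T))) else 0)).
- rewrite /koszul_d big_mkcond; apply: eq_bigr => u _; case: ifP => uT /=.
    rewrite mulr_sumr big_mkcond; apply: eq_bigr => v _.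
    by rewrite !inE negb_or eq_sym andbC.
  by rewrite big1.
- by move=> u; rewrite eqxx !andbF.
- move=> u v uv; rewrite [v == u]eq_sym; case: ifPn => [/and3P[uT vT _]|].
    rewrite vT uT uv /= !pos_setU1 // setUCA.
    case: (ltngtP u v) => [_|_|/val_inj uE]; last by rewrite uE eqxx in uv.
      by rewrite /= ?add0n ?add1n ?exprS; ring.
    by rewrite /= ?add0n ?add1n ?exprS; ring.
  by case: ifP => [/and3P[-> ->]|]; rewrite ?uv ?oppr0.
Qed.

(** The wedge is a null-homotopy of multiplication by sum_u c_u x_u. The diagonal terms, over u
    outside T in one composite and inside T in the other, add up to the right-hand side; the mixed
    terms cancel by [pos_anticomm]. *)
Lemma koszul_homotopy x c z T :
  koszul_d x (koszul_wedge c z) T + koszul_wedge c (koszul_d x z) T =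
  (\sum_u c u * x u) * z T.
Proof.
have dw : koszul_d x (koszul_wedge c z) T = \sum_(u | u \notin T)
    (c u * x u * z T + \sum_(v in T) (-1) ^+ pos u T * x u *
       ((-1) ^+ pos v (u |: T :\ v) * c v * z (u |: T :\ v))).
  apply: eq_bigr => u uT; rewrite /koszul_wedge (bigD1 u) ?setU11 //=.
  rewrite setU1K // mulrDr; congr (_ + _).
    by rewrite sign_cancel [c u * _]mulrC.
  rewrite mulr_sumr; apply: eq_big => [v|v].
    by rewrite !inE; case: eqP => [->|] /=; rewrite ?(negPf uT) ?andbT.
  rewrite !inE => /andP[_ vu].
  have -> // : (u |: T) :\ v = u |: T :\ v.
  by apply/setP => y; rewrite !inE; case: (y =P u) => [->|//]; rewrite eq_sym vu.
have wd : koszul_wedge c (koszul_d x z) T = \sum_(v in T)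
    (c v * x v * z T + \sum_(u | u \notin T) (-1) ^+ pos v (T :\ v) * c v *
       ((-1) ^+ pos u (T :\ v) * x u * z (u |: T :\ v))).
  apply: eq_bigr => v vT; rewrite /koszul_d (bigD1 v) ?setD11 //=.
  rewrite setD1K // mulrDr; congr (_ + _).
    by rewrite sign_cancel.
  rewrite mulr_sumr; apply: eq_bigl => u.
  by rewrite !inE; case: eqP => [->|] /=; rewrite ?vT ?andbT.
rewrite {}dw {}wd !big_split /= addrACA [X in _ + X](_ : _ = 0) ?addr0.
  rewrite -!mulr_suml -mulrDl addrC; congr (_ * _).
  by rewrite [RHS](bigID (mem T)).
rewrite [X in _ + X]exchange_big /= -big_split big1 // => u uT /=.
rewrite -big_split big1 // => v vT /=.
have uv : u != v by apply: contraNneq uT => ->.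
have uTv : u \notin T :\ v by rewrite inE negb_and uT orbT.
have := @pos_anticomm m S u v (T :\ v) uv uTv (negbT (setD11 _ _)).
rewrite setD1K // => /(congr1 (fun y => y * (c v * x u * z (u |: T :\ v)))) E.
by rewrite -[RHS](subrr (((-1) ^+ pos u T * (-1) ^+ pos v (u |: T :\ v)) *
  (c v * x u * z (u |: T :\ v)))) [X in _ - X]E; ring.
Qed.

End Koszul.

Section KoszulHomology.

Variables (K : fieldType) (m : nat).
Notation S := {mpoly K[m]}.
Notation kd := (koszul_d (fun u : 'I_m => 'X_u : S)).
Implicit Types (z w : {set 'I_m} -> S) (T A B : {set 'I_m}) (u v : 'I_m).

(** Nonvanishing of the p-th Koszul homology of S / I, with chains represented in S. *)
Definition koszul_class (I : S -> Prop) (p : nat) : Prop :=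
  exists z, [/\ forall T, z T != 0 -> #|T| = p,
                forall T, I (kd z T)
              & ~ exists w, forall T, I (z T - kd w T)].

Lemma irrelevant_lin (f : S) : irrelevant_ideal f ->
  exists c : 'I_m -> S, f = \sum_u c u * 'X_u.
Proof.
move: f; apply: ideal_gen_min.
  split.
  - by exists (fun=> 0); rewrite big1 // => u _; rewrite mul0r.
  - move=> _ _ [c ->] [d ->]; exists (fun u => c u + d u).
    by rewrite -big_split; apply: eq_bigr => u _; rewrite mulrDl.
  - move=> a _ [c ->]; exists (fun u => a * c u).
    by rewrite mulr_sumr; apply: eq_bigr => u _; rewrite mulrA.
move=> _ [i ->]; exists (fun u => (u == i)%:R).
rewrite (bigD1 i) //= eqxx mul1r big1 ?addr0 // => u /negPf ->.
by rewrite mul0r.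
Qed.

(* The connecting map of 0 -> S/I -> S/I -> S/(I, f) -> 0 in Koszul homology, *)
(* on which f acts by zero.                                                   *)
Lemma koszul_class_adjoin (I : S -> Prop) f p : is_ideal I ->
  irrelevant_ideal f -> (forall g, I (f * g) -> I g) ->
  koszul_class I p -> koszul_class (ideal_adjoin I f) p.+1.
Proof.
move=> idI /irrelevant_lin [c fE] freg [z [zp dz nz]].
case: (idI) => I0 ID IM.
have I_d y : (forall T, I (y T)) -> forall T, I (kd y T).
  by move=> Iy T; apply: ideal_sum => // u _; apply: IM.
exists (koszul_wedge c z); split.
- move=> T; apply: contraNeq => Tp; rewrite /koszul_wedge big1 // => u uT.
  case: (eqVneq (z (T :\ u)) 0) => [->|/zp zE]; first by rewrite mulr0.
  by rewrite (cardsD1 u) uT zE eqxx in Tp.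
- move=> T; apply/ideal_adjoinP => //; exists (z T).
  have := koszul_homotopy (fun u : 'I_m => 'X_u : S) c z T; rewrite -fE [z T * f]mulrC => <-.
  rewrite opprD addNKr; apply: ideal_opp => //.
  by apply: ideal_sum => // u _; apply: IM.
- case=> w wP; apply: nz.
  (* If c ^ z - d w = y f modulo I, applying d and the homotopy formula gives f z = f (d y) modulo
     I; cancelling f makes z a boundary. *)
  have /boolp.choice [y yP] : forall T, exists y,
      I (koszul_wedge c z T - kd w T - y * f).
    by move=> T; apply/(ideal_adjoinP _ _ idI).
  exists y => T; apply: freg.
  have := I_d _ yP T.
  have -> : kd (fun T => koszul_wedge c z T - kd w T - y T * f) T
      = kd (koszul_wedge c z) T - kd (kd w) T
        - kd y T * f.
    rewrite /koszul_d mulr_suml -!sumrB; apply: eq_bigr => u _.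
    by ring.
  rewrite koszul_dd subr0 => dI.
  have := koszul_homotopy (fun u : 'I_m => 'X_u : S) c z T; rewrite -fE => fz.
  have -> : f * (z T - kd y T) =
      (kd (koszul_wedge c z) T - kd y T * f)
      + koszul_wedge c (kd z) T.
    by rewrite mulrBr -fz; ring.
  by apply: ID => //; apply: ideal_sum => // u _; apply: IM.
Qed.

(** Each regular element raises the degree of a nonzero class by one, and the Koszul complex on m
    variables stops in degree m. *)
Lemma koszul_class_regular (I : S -> Prop) s p : is_ideal I ->
  koszul_class I p -> (forall f, f \in s -> irrelevant_ideal f) ->
  quot_regular I s -> (p + size s <= m)%N.
Proof.
elim: s I p => [|f s IHs] I p idI cI irr /=.
  move=> _; rewrite addn0 leqNgt; apply/negP => mp.
  case: cI => z [zp _]; apply; exists (fun=> 0) => T.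
  have -> : z T = 0.
    apply/eqP; apply: contraTT mp => /zp <-.
    by rewrite -leqNgt -[X in (_ <= X)%N]card_ord max_card.
  rewrite /koszul_d big1 ?subr0; first by case: idI.
  by move=> u _; rewrite mulr0.
case=> freg sreg; rewrite addnS -addSn.
apply: IHs sreg; first exact: ideal_adjoin_ideal.
  by apply: koszul_class_adjoin => //; apply: irr; rewrite mem_head.
by move=> g gs; apply: irr; rewrite inE gs orbT.
Qed.

Lemma mcoeff_mulXU (p : S) u v : (p * 'X_u)@_U_(v) = (u == v)%:R * p@_0.
Proof.
rewrite mcoeff_mulX lep1mP mnm1E; case: (eqVneq u v) => [->|uv].
  by rewrite /= mul1r -{1}[U_(v)%MM]add0m addmK.
by rewrite /= mul0r.
Qed.

Lemma mcoeff_signXU k (p : S) u v :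
  ((-1) ^+ k * 'X_u * p)@_U_(v) = (u == v)%:R * ((-1) ^+ k * p@_0).
Proof.
have -> : (-1) ^+ k * 'X_u * p = (-1) ^+ k *: (p * 'X_u).
  by rewrite -mul_mpolyC rmorphXn rmorphN rmorph1 /=; ring.
by rewrite mcoeffZ mcoeff_mulXU mulrCA.
Qed.

(** Linear coefficients of a boundary see only constant terms of [w]. In an ideal without linear
    terms this suffices to detect that a cycle is not a boundary. *)
Lemma mcoeff_koszul_dU w T u :
  (kd w T)@_U_(u) = if u \in T then 0 else (-1) ^+ pos u T * (w (u |: T))@_0.
Proof.
rewrite /koszul_d raddf_sum /=; case: ifPn => [uT|uT].
  rewrite big1 // => v vT; rewrite mcoeff_signXU.
  by case: eqP => [vu|]; [rewrite vu uT in vT | rewrite mul0r].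
rewrite (bigD1 u) //= mcoeff_signXU eqxx mul1r big1 ?addr0 //.
by move=> v /andP[_ /negPf vu]; rewrite mcoeff_signXU vu mul0r.
Qed.

Section ProductClass.

Variables (D : pred 'X_{1..m}) (A B : {set 'I_m}).
Hypotheses (Dup : upclosed D) (DU : forall u, ~~ D U_(u)%MM).
Hypothesis DAB : forall a b, a \in A -> b \in B -> D (U_(a) + U_(b))%MM.

Let idD : is_ideal (@monomial_ideal K m D).
Proof. exact: monomial_ideal_ideal. Qed.

Let monomial_ideal_XX (p q : S) u v : D (U_(u) + U_(v))%MM ->
  monomial_ideal D (p * 'X_u * (q * 'X_v)).
Proof.
move=> Duv; case: idD => _ _ IM.
by rewrite mulrACA -mpolyXD; apply: IM; apply/monomial_idealX.
Qed.

Let coeffU (p : S) u : monomial_ideal D p -> p@_U_(u) = 0.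
Proof. by move=> Dp; apply: memN_msupp_eq0; apply: contra (DU u); apply: Dp. Qed.

(* In multidegree 1_(A u B) the class is (partial e_A) ^ e_B. *)
Lemma koszul_class_disjoint : [disjoint A & B] -> A != set0 -> B != set0 ->
  koszul_class (@monomial_ideal K m D) (#|A| + #|B|).-1.
Proof.
move=> dAB /set0Pn[a aA] /set0Pn[b bB]; pose E := A :|: B.
have bNA : b \notin A by rewrite (disjointFl dAB bB).
have cardE : #|E| = (#|A| + #|B|)%N.
  by rewrite cardsU (disjoint_setI0 dAB) cards0 subn0.
pose xA u : S := if u \in A then 'X_u else 0.
pose xB u : S := if u \in A then 0 else 'X_u.
pose e T : S := (T == E)%:R.
exists (koszul_d xA e); split.
- move=> T; apply: contraNeq => TE; rewrite /koszul_d big1 // => u uT.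
  rewrite /e; case: eqP => [uTE|]; last by rewrite mulr0.
  by move: TE; rewrite -cardE -uTE cardsU1 uT eqxx.
(* The differential is d_A plus the part outside A, and d_A squares to zero. Every surviving
   coefficient contains a variable of A times one of B. *)
- move=> T; have -> : kd (koszul_d xA e) T = koszul_d xB (koszul_d xA e) T.
    rewrite -[RHS]add0r -(koszul_dd xA e T) /koszul_d -big_split /=.
    apply: eq_bigr => u _; rewrite /xA /xB.
    by case: (u \in A); rewrite !(mulr0, mul0r, addr0, add0r).
  rewrite /koszul_d; apply: ideal_sum => // v vT; rewrite mulr_sumr.
  apply: ideal_sum => // u; rewrite !inE negb_or /xA /xB => /andP[uv uT].
  case: ifP => vA; first by rewrite mulr0 mul0r; case: idD.
  case: ifP => uA; last by rewrite mulr0 mul0r mulr0; case: idD.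
  rewrite /e; case: eqP => [uvE|]; last by rewrite !mulr0; case: idD.
  rewrite mulr1; apply: monomial_ideal_XX; rewrite addmC; apply: DAB => //.
  have : v \in E by rewrite -uvE !inE eqxx orbT.
  by rewrite inE vA.
- case=> w wP.
  have wE u : (koszul_d xA e (E :\ u))@_U_(u) =
      (u \in A)%:R * (-1) ^+ pos u (E :\ u).
    rewrite /koszul_d raddf_sum /= (bigD1 u) ?setD11 //= {1}/xA.
    rewrite big1 ?addr0 => [|v /andP[_ /negPf vu]]; last first.
      rewrite /xA; case: ifP => _; last by rewrite mulr0 mul0r mcoeff0.
      by rewrite mcoeff_signXU vu mul0r.
    case: ifP => uA; last by rewrite mulr0 !mul0r mcoeff0.
    by rewrite mcoeff_signXU eqxx !mul1r /e setD1K ?inE ?uA // eqxx mcoeff1 eqxx mulr1.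
  (* The coefficient of x_u at E minus u forces the constant term of [w E] to be 1 for u in A and 0
     for u in B, which is contradictory. *)
  have w0 u : u \in E -> (w E)@_0 = (u \in A)%:R.
    move=> uE; have := coeffU u (wP (E :\ u)); rewrite mcoeffB wE.
    rewrite mcoeff_koszul_dU setD11 setD1K // [_ * _ ^+ _]mulrC -mulrBr.
    by move=> /eqP; rewrite mulf_eq0 signr_eq0 subr_eq0 => /eqP.
  have := w0 a; rewrite (w0 b) ?inE ?bB ?orbT // aA (negPf bNA) => /(_ isT) /eqP.
  by rewrite eq_sym oner_eq0.
Qed.

(** The class is x_j e_E. Since j lies in both A and B, each x_v x_j with v in E belongs to the
    ideal; since j is in E, no boundary has x_j in its coefficient at E. *)
Lemma koszul_class_overlap j : A :&: B = [set j] ->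
  koszul_class (@monomial_ideal K m D) (#|A| + #|B|).-1.
Proof.
move=> ABj; pose E := A :|: B.
have /andP[jA jB] : (j \in A) && (j \in B) by rewrite -in_setI ABj set11.
have cardE : #|E| = (#|A| + #|B|).-1 by rewrite cardsU ABj cards1 subn1.
exists (fun T => (T == E)%:R * 'X_j); split.
- by move=> T; case: (T =P E) => [->|_]; rewrite ?mul0r ?eqxx.
- move=> T; apply: ideal_sum => // v vT; case: eqP => [vE|_]; last first.
    by rewrite mul0r mulr0; case: idD.
  apply: monomial_ideal_XX; have : v \in E by rewrite -vE setU11.
  by rewrite inE => /orP[vA|vB]; [|rewrite addmC]; apply: DAB.
- case=> w /(_ E) /coeffU => /(_ j); rewrite eqxx mul1r mcoeffB mcoeff_koszul_dU.
  by rewrite inE jA mcoeffXU eqxx subr0 => /eqP; rewrite oner_eq0.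
Qed.

End ProductClass.

End KoszulHomology.

(** * Heights of coordinate primes *)

Section Height.

Variables (K : fieldType) (m : nat).
Notation S := {mpoly K[m]}.
Implicit Types (P Q : S -> Prop) (f : S) (A B : {set 'I_m}).

(* The degree-bounded pieces of S / P grow at least like D ^ r.               *)
Definition growth P (r : nat) : Prop :=
  exists C : nat, forall D : nat, exists (J : finType) (g : J -> S),
    [/\ #|J| = (D ^ r)%N,
        forall j t, t \in msupp (g j) -> (mdeg t <= C * D)%N
      & forall a : J -> K, P (\sum_j a j *: g j) -> forall j, a j = 0].

Lemma growth0 P : is_ideal P -> ~ P 1 -> growth P 0.
Proof.
case=> _ _ PM P1; exists 0%N => D; exists unit, (fun=> 1); split.
- by rewrite card_unit expn0.
- by move=> _ t; rewrite msupp1 inE => /eqP ->; rewrite mdeg0.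
- move=> a; rewrite (big_pred1 tt) => [Pa []|[]] //.
  apply: boolp.contrapT => /eqP a0; apply: P1.
  have -> : 1 = ((a tt)^-1)%:MP * (a tt *: 1) :> S; last exact: PM.
  by rewrite mul_mpolyC scalerA mulVf // scale1r.
Qed.

(** The products g_j f^k with k < D are independent modulo P: modulo Q only the terms with k = 0
    remain, so these vanish, and then f can be cancelled because P is prime. *)
Lemma growthS P Q r f : prime_ideal P -> is_ideal Q -> subideal P Q ->
  Q f -> ~ P f -> growth Q r -> growth P r.+1.
Proof.
move=> [[P0 PD PM] _ Ppr] idQ PQ Qf Pf [C gQ].
exists (C + msize f)%N => D; have [J [g [cJ dg gi]]] := gQ D.
exists (J * 'I_D)%type, (fun x : J * 'I_D => g x.1 * f ^+ x.2); split.
- by rewrite card_prod card_ord cJ expnSr.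
- have df k t : t \in msupp (f ^+ k) -> (mdeg t <= k * msize f)%N.
    elim: k t => [|k IHk] t; first by rewrite expr0 msupp1 inE => /eqP ->; rewrite mdeg0.
    rewrite exprS => /msuppM_le /allpairsP[[u v] /= [uf vf ->]].
    by rewrite mdegD mulSn leq_add // ?IHk // ltnW // msize_mdeg_lt.
  move=> [j k] t /msuppM_le /allpairsP[[u v] /= [/dg ug /df vf ->]].
  rewrite mdegD mulnDl leq_add //; apply: leq_trans vf _.
  by rewrite mulnC leq_mul // ltnW.
- have indep E (a : nat -> J -> K) :
      P (\sum_(k < E) (\sum_j a k j *: g j) * f ^+ k) ->
      forall k, (k < E)%N -> forall j, a k j = 0.
    elim: E a => [//|E IHE] a; rewrite big_ord_recl expr0 mulr1.
    have -> : \sum_(k < E) (\sum_j a (lift ord0 k) j *: g j) * f ^+ lift ord0 k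
        = f * \sum_(k < E) (\sum_j a k.+1 j *: g j) * f ^+ k.
      rewrite mulr_sumr; apply: eq_bigr => k _.
      by rewrite lift0 exprS mulrCA.
    move=> Pa; have a0 : forall j, a 0%N j = 0.
      apply: gi; case: (idQ) => _ QD QM.
      set x := \sum_j _ in Pa *; set y := \sum_(k < E) _ in Pa.
      rewrite -(addrK (f * y) x); apply: ideal_sub => //; first exact: PQ.
      by rewrite mulrC; apply: QM.
    move: Pa; rewrite big1 ?add0r => [/Ppr [//|/(IHE (fun k => a k.+1)) aE]|j _].
      by case=> [|k] kE //; apply: aE.
    by rewrite a0 scale0r.
  move=> a Pa [j k].
  have := indep D (fun k j => if insub k is Some k then a (j, k) else 0).
  move=> /(_ _ k (ltn_ord k) j); rewrite valK; apply.
  congr P: Pa.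
  transitivity (\sum_j \sum_(k < D) a (j, k) *: (g j * f ^+ k)).
    by rewrite pair_bigA; apply: eq_bigr => -[].
  rewrite exchange_big; apply: eq_bigr => l _; rewrite mulr_suml.
  by apply: eq_bigr => i _; rewrite valK scalerAl.
Qed.

Lemma growth_le P r : is_ideal P -> growth P r -> (r <= m)%N.
Proof.
case=> P0 _ _ [C gP]; rewrite leqNgt; apply/negP => mr.
(* With this D, the polynomials of degree at most C D span at most (C D + 1)^m <= (C + 1)^m D^m <
   D^(m + 1) dimensions, too few for the family. *)
pose D := ((C + 1) ^ m).+1; have [J [g [cJ dg gi]]] := gP D.
pose b := (C * D).+1.
have gb j t : t \in msupp (g j) -> (mdeg t < b)%N by move=> /dg; rewrite ltnS.
pose M : 'M[K]_(#|J|, #|{: 'X_{1..m < b}}|) :=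
  \matrix_(i, k) (g (enum_val i))@_(enum_val k : 'X_{1..m < b}).
have : row_free M.
  apply: inj_row_free => v vM; apply/rowP => i; rewrite mxE.
  have := gi (fun j => v 0 (enum_rank j)); rewrite [X in P X](_ : _ = 0).
    by move=> /(_ P0 (enum_val i)); rewrite enum_valK.
  apply/mpolyP => t; rewrite mcoeff0 raddf_sum /=.
  case: (ltnP (mdeg t) b) => tb; last first.
    rewrite big1 // => j _; rewrite mcoeffZ memN_msupp_eq0 ?mulr0 //.
    by apply: contraL tb => /gb; rewrite -ltnNge.
  move/rowP/(_ (enum_rank (BMultinom tb))): vM; rewrite !mxE => vMt.
  rewrite -[RHS]vMt {vMt}.
  rewrite (reindex (enum_val (A := J))) /=; last first.
    by apply: onW_bij; apply: enum_val_bij.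
  by apply: eq_bigr => k _; rewrite mxE mcoeffZ enum_valK enum_rankK.
rewrite /row_free => /eqP rM.
have := rank_leq_col M; rewrite rM cJ.
have : (#|{: 'X_{1..m < b}}| <= b ^ m)%N.
  have tb (t : 'X_{1..m < b}) i : (t i < b)%N.
    apply: leq_trans (bmdeg t); rewrite ltnS mdegE (bigD1 i) //=.
    exact: leq_addr.
  pose h (t : 'X_{1..m < b}) := [ffun i => Ordinal (tb t i)].
  have hI : injective h.
    move=> t u /ffunP htu; apply/val_inj/mnmP => i.
    by have := htu i; rewrite !ffunE => /(congr1 val).
  by have := leq_card h hI; rewrite card_ffun !card_ord.
move=> bm; rewrite leqNgt => /negP; apply.
have mono x y : (x <= y)%N -> (x ^ m <= y ^ m)%N.
  by case: (posnP m) => [->|m0]; rewrite ?expn0 ?leq_exp2r.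
apply: leq_ltn_trans bm _; apply: leq_ltn_trans (_ : ((C + 1) * D) ^ m < _)%N.
  by apply: mono; rewrite /b /D; lia.
apply: leq_trans (_ : D ^ m.+1 <= _)%N; last by rewrite leq_pexp2l.
by rewrite expnMn expnS ltn_pmul2r ?expn_gt0.
Qed.

Lemma not_subideal P Q : ~ subideal P Q -> exists2 f, P f & ~ Q f.
Proof.
move=> nPQ; apply: boolp.contrapT => nf; apply: nPQ => f Pf.
by apply: boolp.contrapT => Qf; apply: nf; exists f.
Qed.

(** Descending from the top of the chain, each strict inclusion raises the growth exponent by
    one. *)
Lemma prime_chain_le P h : prime_chain P h -> (h <= m)%N.
Proof.
case=> c [cpr clt _]; have idc k : (k <= h)%N -> is_ideal (c k).
  by move=> /cpr [].
suff gr i : (i <= h)%N -> growth (c (h - i)%N) i.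
  by apply: growth_le (gr h (leqnn h)); apply: idc; rewrite leq_subr.
elim: i => [_|i IHi ih].
  by rewrite subn0; apply: growth0; [apply: idc|case: (cpr h (leqnn h))].
have hi : ((h - i.+1).+1 = h - i)%N by rewrite subnSK.
have [sub /not_subideal [f Qf Pf]] : subideal (c (h - i.+1)%N) (c (h - i)%N) /\
    ~ subideal (c (h - i)%N) (c (h - i.+1)%N).
  by rewrite -hi; apply: clt; rewrite hi leq_subr.
apply: (growthS _ _ sub Qf Pf (IHi (ltnW ih))).
  by apply: cpr; rewrite leq_subr.
by apply: idc; rewrite leq_subr.
Qed.

(** A flag of subsets of [A] growing by one element at a time, from which chains of coordinate
    primes are made. *)
Definition initial A k : {set 'I_m} := [set x in A | (index x (enum A) < k)%N].

Lemma initial_sub A k : initial A k \subset A.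
Proof. by apply/subsetP => x; rewrite inE => /andP[]. Qed.

Lemma initial_mono A k l : (k <= l)%N -> initial A k \subset initial A l.
Proof.
move=> kl; apply/subsetP => x; rewrite !inE => /andP[-> xk].
exact: leq_trans xk kl.
Qed.

Lemma initial0 A : initial A 0 = set0.
Proof. by apply/setP => x; rewrite !inE andbF. Qed.

Lemma initial_card A : initial A #|A| = A.
Proof.
apply/setP => x; rewrite !inE; case: (boolP (x \in A)) => //= xA.
by rewrite cardE index_mem mem_enum.
Qed.

Lemma initialS A k : (k < #|A|)%N ->
  exists x, [/\ x \in A, x \notin initial A k & x \in initial A k.+1].
Proof.
move=> kA; pose x := enum_val (Ordinal kA); exists x; rewrite !inE enum_valP.
suff -> : index x (enum A) = k by rewrite ltnn ltnS leqnn.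
by rewrite /x /enum_val index_uniq // ?enum_uniq // -cardE.
Qed.

Lemma var_idealS A B : A \subset B -> subideal (@var_ideal K m A) (var_ideal B).
Proof.
move=> /subsetP AB p Ap t /Ap /exists_inP [x /AB xB tx].
by apply/exists_inP; exists x.
Qed.

(** The last coordinate prime of the flag is replaced by [P]; strictness survives because [P]
    contains the one variable of [A] still missing below it. *)
Lemma var_ideal_chain P A : prime_ideal P -> subideal (var_ideal A) P ->
  prime_chain P #|A|.
Proof.
move=> prP AP; exists (fun k => if (k < #|A|)%N then var_ideal (initial A k) else P).
split=> [k _|k kA|p]; last by rewrite ltnn.
  by case: ifP => // _; apply: var_ideal_prime.
rewrite kA; have [x [xA xk xk1]] := initialS kA; case: ifP => kA1; split.
- by apply: var_idealS; apply: initial_mono.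
- by move=> /(_ 'X_x); rewrite !var_idealU => /(_ xk1); apply/negP.
- by move=> p Ap; apply: AP; apply: var_idealS Ap; apply: initial_sub.
- move=> /(_ 'X_x); rewrite var_idealU (negPf xk) => h; apply: notF; apply: h.
  by apply: AP; apply/var_idealU.
Qed.

(* A chain ending in (x_A) extends by m - #|A| further coordinate primes.    *)
Lemma var_ideal_height A : prime_height (@var_ideal K m A) #|A|.
Proof.
split; first by apply: var_ideal_chain => //; apply: var_ideal_prime.
move=> h [c [cpr clt cA]].
have chA : c h = var_ideal A by apply: pred_ext.
suff /prime_chain_le : prime_chain (@var_ideal K m setT) (h + #|~: A|).
  by have := cardsC A; rewrite card_ord; lia.
pose B k := A :|: initial (~: A) (k - h).
exists (fun k => if (k < h)%N then c k else var_ideal (B k)).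
have BE : B h = A by rewrite /B subnn initial0 setU0.
split=> [k _|k kh|p].
- by case: ltnP => [kh|_]; [apply/cpr/ltnW | apply: var_ideal_prime].
- case: (ltnP k h) => [kh1|hk].
    have [s1 s2] := clt _ kh1; case: ltnP => // hk.
    have kE : k.+1 = h by apply/eqP; rewrite eqn_leq kh1 hk.
    by rewrite kE BE -chA -kE.
  rewrite ltnNge (leq_trans hk) //=.
  have kA : (k - h < #|~: A|)%N by rewrite ltn_subLR.
  have [x [xA xk xk1]] := initialS kA; split.
    by apply: var_idealS; apply: setUS; apply: initial_mono; rewrite subSn.
  move=> /(_ 'X_x); rewrite !var_idealU => xB.
  have : x \in B k by apply: xB; rewrite !inE subSn // in xk1 *; rewrite xk1 orbT.
  by rewrite inE (negPf xk) orbF; apply/negP; rewrite -in_setC.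
- rewrite ltnNge leq_addr /= /B addKn initial_card setUCr.
  by split.
Qed.

End Height.

(** * Regular sequences of block sums *)

Section LinearForms.

Variables (K : fieldType) (m : nat).
Notation S := {mpoly K[m]}.
Implicit Types (A : {set 'I_m}) (p : S).

Lemma quot_regular_vars A (s : seq 'I_m) : uniq s ->
  (forall i, i \in s -> i \notin A) ->
  quot_regular (@var_ideal K m A) [seq 'X_i : S | i <- s].
Proof.
elim: s A => [|i s IHs] A /=; first by case: (@var_ideal_prime K m A).
case/andP => iNs us sA; split=> [p|].
  case: (@var_ideal_prime K m A) => _ _ pr /pr [/var_idealU|//].
  by rewrite (negPf (sA i _)) ?mem_head.
rewrite -/(ideal_adjoin _ _) var_ideal_adjoin; apply: IHs => // j js.
rewrite !inE negb_or sA ?inE ?js ?orbT // andbT.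
by apply: contraNneq iNs => <-.
Qed.

Lemma comp_mpolyK (lq lr : m.-tuple S) :
  (forall i, tnth lq i \mPo lr = 'X_i) ->
  forall p, (p \mPo lq) \mPo lr = p.
Proof.
move=> qr p; rewrite (comp_mpolyEX p lq) raddf_sum [RHS]mpolyE /=.
apply: eq_bigr => t _; rewrite comp_mpolyZ comp_mpolyX rmorph_prod.
by rewrite mpolyXE_id; congr (_ *: _); apply: eq_bigr => i _; rewrite rmorphXn /= qr.
Qed.

Lemma var_idealE A :
  @var_ideal K m A = ideal_gen (fun p => exists2 a, a \in A & p = 'X_a).
Proof.
apply/esym/ideal_gen_monomial; first exact: hits_upclosed.
  by move=> _ [a aA ->]; apply/monomial_idealX; rewrite hitsU.
move=> t /exists_inP [a aA ta]; exists U_(a)%MM; first by exists a.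
by rewrite lep1mP.
Qed.

Lemma var_ideal_comp A (lq : m.-tuple S) p :
  (forall a, a \in A -> tnth lq a = 'X_a) ->
  var_ideal A p -> var_ideal A (p \mPo lq).
Proof.
move=> qA; rewrite var_idealE.
move: p; apply: ideal_gen_min.
  have [g0 gD gM] := ideal_gen_ideal (fun p : S => exists2 a, a \in A & p = 'X_a).
  split=> [|p q|c p]; first by rewrite comp_mpoly0.
    by rewrite comp_mpolyD; apply: gD.
  by rewrite rmorphM; apply: gM.
move=> _ [a aA ->]; apply: ideal_gen_mem; exists a => //.
by rewrite comp_mpolyXU -tnth_nth qA.
Qed.

Definition color_sum d (col : 'I_m -> option 'I_d) (k : 'I_d) : S :=
  \sum_(i | col i == Some k) 'X_i.

(* A triangular change of coordinates turns the block sums into variables.   *)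
Lemma quot_regular_color_sum A d (col : 'I_m -> option 'I_d) :
  (forall k, exists2 x, x \notin A & col x = Some k) ->
  quot_regular (@var_ideal K m A) [seq color_sum col k | k <- enum 'I_d].
Proof.
move=> /fin_all_exists2 [piv pivA colp].
have piv_inj : injective piv by move=> k l kl; apply: Some_inj; rewrite -!colp kl.
pose is_piv i := if col i is Some k then i == piv k else false.
pose form i := if col i is Some k then color_sum col k else 'X_i.
pose la : m.-tuple S := [tuple if is_piv i then form i else 'X_i | i < m].
(* The inverse of [la]: at a pivot x, 2x minus the block sum is x minus the other variables of the
   block. *)
pose lb : m.-tuple S := [tuple if is_piv i then 'X_i *+ 2 - form i else 'X_i | i < m].
have pivP k : is_piv (piv k) by rewrite /is_piv colp eqxx.
have nthE (lq : m.-tuple S) i : 'X_i \mPo lq = tnth lq i.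
  by rewrite comp_mpolyXU -tnth_nth.
have sumE (lq : m.-tuple S) k : (forall i, ~~ is_piv i -> tnth lq i = 'X_i) ->
    color_sum col k \mPo lq = tnth lq (piv k) - 'X_(piv k) + color_sum col k.
  move=> lqE; rewrite /color_sum raddf_sum /=.
  rewrite (bigD1 (piv k)) ?colp //= [in RHS](bigD1 (piv k)) ?colp //= nthE.
  rewrite addrA subrK; congr (_ + _); apply: eq_bigr => i /andP[/eqP ci ip].
  by rewrite nthE lqE // /is_piv ci.
have laE i : ~~ is_piv i -> tnth la i = 'X_i by rewrite tnth_mktuple => /negPf ->.
have lbE i : ~~ is_piv i -> tnth lb i = 'X_i by rewrite tnth_mktuple => /negPf ->.
have lap k : tnth la (piv k) = color_sum col k.
  by rewrite tnth_mktuple pivP /form colp.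
have lbp k : tnth lb (piv k) = 'X_(piv k) *+ 2 - color_sum col k.
  by rewrite tnth_mktuple pivP /form colp.
have pivE i : is_piv i -> exists k, i = piv k.
  by rewrite /is_piv; case: (col i) => // k /eqP ->; exists k.
have abK : cancel (comp_mpoly la) (comp_mpoly lb).
  apply: comp_mpolyK => i; case: (boolP (is_piv i)) => [/pivE [k ->]|ip].
    by rewrite lap sumE // lbp; ring.
  by rewrite laE // nthE lbE.
have baK : cancel (comp_mpoly lb) (comp_mpoly la).
  apply: comp_mpolyK => i; case: (boolP (is_piv i)) => [/pivE [k ->]|ip].
    by rewrite lbp raddfB raddfMn /= nthE sumE // lap; ring.
  by rewrite lbE // nthE laE.
(* Pivots avoid [A], so both substitutions fix the variables of [A]. *)
have AE : (fun p => var_ideal A (p \mPo lb)) = @var_ideal K m A.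
  have piA a : a \in A -> ~~ is_piv a.
    by move=> aA; apply/negP => /pivE [k aE]; rewrite aE (negPf (pivA k)) in aA.
  apply: pred_ext => p; split=> [Ab|Ap].
    by rewrite -[p]baK; apply: var_ideal_comp Ab => a /piA /laE.
  by apply: var_ideal_comp Ap => a /piA /lbE.
rewrite -AE.
have -> : [seq color_sum col k | k <- enum 'I_d] =
    [seq f \mPo la | f <- [seq 'X_i : S | i <- [seq piv k | k <- enum 'I_d]]].
  by rewrite -!map_comp; apply: eq_map => k /=; rewrite nthE lap.
apply: (@quot_regular_morph _ (comp_mpoly la) (comp_mpoly lb)) => //.
apply: quot_regular_vars; first by rewrite map_inj_uniq ?enum_uniq.
by move=> i /mapP [k _ ->].
Qed.

End LinearForms.

Section IntervalColoring.

Variables (V : finType) (d : nat).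

Lemma partial_matching (L : {set 'I_d}) (F : {set V}) : (#|L| <= #|F|)%N ->
  exists g : V -> option 'I_d,
    [/\ forall x k, g x = Some k -> x \in F /\ k \in L,
        forall x y k, g x = Some k -> g y = Some k -> x = y
      & forall k, k \in L -> exists x, g x = Some k].
Proof.
move=> LF.
pose g x : option 'I_d := if x \in F then
  nth None [seq Some k | k <- enum L] (index x (enum F)) else None.
have gP x k : g x = Some k ->
    [/\ x \in F, k \in L & index x (enum F) = index k (enum L)].
  rewrite /g; case: ifP => // xF; case: (ltnP (index x (enum F)) #|L|) => xL.
    rewrite (nth_map k) -?cardE // => -[<-].
    by rewrite -mem_enum mem_nth -?cardE // index_uniq ?enum_uniq -?cardE.
  by rewrite nth_default // size_map -cardE.
exists g; split.
- by move=> x k /gP [].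
- move=> x y k /gP [xF _ xk] /gP [yF _ yk].
  rewrite -[x](nth_index x (s := enum F)) ?mem_enum // xk -yk.
  by rewrite nth_index ?mem_enum.
- move=> k kL; have kF : (index k (enum L) < #|F|)%N.
    by apply: leq_trans LF; rewrite cardE index_mem mem_enum.
  pose x := enum_val (Ordinal kF).
  exists x; rewrite /g /x enum_valP /enum_val index_uniq ?enum_uniq -?cardE //=.
  by rewrite (nth_map k) ?index_mem ?mem_enum // nth_index ?mem_enum.
Qed.

(* A d-fold cover of a line by intervals splits into d covers: color greedily *)
(* from left to right, recoloring only when a color is about to be lost.      *)
Lemma interval_coloring (C : nat -> {set V}) :
  (forall j, (d <= #|C j|)%N) ->
  (forall i j k x, (i <= j <= k)%N -> x \in C i -> x \in C k -> x \in C j) ->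
  forall n, exists col : V -> option 'I_d,
    forall j k, (j < n)%N -> exists2 x, x \in C j & col x = Some k.
Proof.
move=> dC convC n.
(* The invariant adds that no color occurs twice in the current set and that colored points have
   appeared earlier. By convexity, a colored point of [C n.+1] then lies in [C n]. *)
suff: exists col : V -> option 'I_d,
    [/\ forall j k, (j < n)%N -> exists2 x, x \in C j & col x = Some k,
        forall x y k, x \in C n -> y \in C n ->
          col x = Some k -> col y = Some k -> x = y
      & forall x k, col x = Some k -> exists2 j, (j < n)%N & x \in C j].
  by case=> col [colP _ _]; exists col.
elim: n => [|n [col [colP colI colC]]]; first by exists (fun=> None).
pose U := [set x in C n | col x != None].
pose L := [set k : 'I_d | [forall x in C n, col x != Some k]].
have UL : (#|U| <= #|~: L|)%N.
  pose c x := if col x is Some k then Some k else None.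
  have -> : #|U| = #|[set col x | x in U]|.
    rewrite card_in_imset // => x y; rewrite !inE => /andP[xC].
    case cx: (col x) => [k|//] _ /andP[yC _] /esym cy.
    exact: colI cx cy.
  rewrite -(card_imset (~: L) (@Some_inj _)); apply: subset_leq_card.
  apply/subsetP => z /imsetP [x xU ->{z}]; move: xU; rewrite inE => /andP[xC].
  case cx: (col x) => [k|//] _; apply: imset_f; rewrite !inE.
  by rewrite negb_forall_in; apply/exists_inP; exists x; rewrite // cx negbK.
(* Colors present in [C n] are distinct, so at most d - |L| of its at least d points are colored;
   enough uncolored points remain for the missing colors [L]. *)
have LF : (#|L| <= #|C n :\: U|)%N.
  have /setIidPr CU : U \subset C n by apply/subsetP => x; rewrite inE => /andP[].
  rewrite cardsD CU; have := cardsC L; have := dC n; rewrite card_ord; lia.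
have [g [gP gI gL]] := partial_matching LF.
have gcol x k : g x = Some k -> x \in C n /\ col x = None.
  move=> /gP []; rewrite !inE => /andP[+ xC] _; rewrite xC /=.
  by case: (col x).
exists (fun x => if g x is Some k then Some k else col x).
have convn x k : x \in C n.+1 -> col x = Some k -> x \in C n.
  by move=> xC /colC [j jn xj]; apply: convC xj xC; rewrite leqnSn ltnW.
have colL x k : x \in C n -> col x = Some k -> k \notin L.
  move=> xC cx; rewrite inE negb_forall_in; apply/exists_inP; exists x => //.
  by rewrite cx negbK.
split.
- move=> j k; rewrite ltnS leq_eqVlt => /orP[/eqP ->|jn].
    case: (boolP (k \in L)) => [/gL [x gx]|].
      by exists x; rewrite ?gx //; case: (gcol _ _ gx).
    rewrite inE negb_forall_in => /exists_inP [x xC]; rewrite negbK => /eqP cx.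
    by exists x => //; case gx: (g x) => [l|//]; have [_] := gcol _ _ gx; rewrite cx.
  have [x xC cx] := colP _ k jn; exists x => //; case gx: (g x) => [l|//].
  by have [_] := gcol _ _ gx; rewrite cx.
- move=> x y k xC yC; case gx: (g x) => [l|]; case gy: (g y) => [l'|].
  + by move=> lk l'k; apply: gI gx _; rewrite gy l'k lk.
  + move=> [lk] cy; have [_] := gP _ _ gx; rewrite lk => kL.
    by have := colL _ _ (convn _ _ yC cy) cy; rewrite kL.
  + move=> cx [lk]; have [_] := gP _ _ gy; rewrite lk => kL.
    by have := colL _ _ (convn _ _ xC cx) cx; rewrite kL.
  + by move=> cx cy; apply: (colI _ _ _ _ _ cx cy); [apply: convn cx|apply: convn cy].
- move=> x k; case gx: (g x) => [l|].
    by move=> _; exists n => //; case: (gcol _ _ gx).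
  by move=> /colC [j jn xj]; exists j => //; apply: ltnW.
Qed.

End IntervalColoring.

(** * Height and depth of specialized Ferrers ideals *)

Section FerrersIdeal.

Variables (K : fieldType) (n m : nat) (hnm : (n <= m)%N).
Variables (lam mu : 'I_n -> nat).
Hypothesis n_gt0 : (0 < n)%N.
Hypothesis mu_ge : forall i : 'I_n, (i <= mu i)%N.
Hypothesis mu_lam : forall i j : 'I_n, (mu i < lam j)%N.
Hypothesis lam_le : forall i : 'I_n, (lam i <= m)%N.
Hypothesis lam_anti : forall i j : 'I_n, (i <= j)%N -> (lam j <= lam i)%N.
Hypothesis mu_mono : forall i j : 'I_n, (i <= j)%N -> (mu i <= mu j)%N.

Notation S := {mpoly K[m]}.
Notation w := (widen_ord hnm).
Notation spec := (spec_ferrers_ideal (K := K) hnm lam mu).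

Definition ferrers_mon (t : 'X_{1..m}) := [exists i : 'I_n, exists x : 'I_m,
  (mu i <= x < lam i)%N && (U_(w i) + U_(x) <= t)%MM].

Lemma ferrers_monP t : reflect (exists (i : 'I_n) (x : 'I_m),
  (mu i <= x < lam i)%N /\ (U_(w i) + U_(x) <= t)%MM) (ferrers_mon t).
Proof.
apply: (iffP existsP) => [[i /existsP [x /andP[xi tx]]]|[i [x [xi tx]]]].
  by exists i, x.
by exists i; apply/existsP; exists x; rewrite xi.
Qed.

Lemma ferrers_mon_upclosed : upclosed ferrers_mon.
Proof.
move=> t u /ferrers_monP [i [x [xi tx]]]; apply/ferrers_monP; exists i, x.
by split=> //; apply: lepm_trans tx (lem_addr _ _).
Qed.

Lemma spec_ferrers_idealE : spec = monomial_ideal ferrers_mon.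
Proof.
apply: ideal_gen_monomial; first exact: ferrers_mon_upclosed.
  move=> _ [i [x [xi ->]]]; rewrite -mpolyXD; apply/monomial_idealX.
  by apply/ferrers_monP; exists i, x; rewrite lepm_refl.
move=> t /ferrers_monP [i [x [xi tx]]]; exists (U_(w i) + U_(x))%MM => //.
by exists i, x; rewrite mpolyXD.
Qed.

Lemma lepm_addU (x y : 'I_m) (t : 'X_{1..m}) :
  (U_(x) + U_(y) <= t)%MM -> (t x != 0%N) && (t y != 0%N).
Proof.
move=> xyt; rewrite -!lep1mP.
by rewrite (lepm_trans _ xyt) ?(lepm_trans _ xyt) ?lem_addr ?lem_addl.
Qed.

Lemma card_interval a b : (b <= m)%N -> #|[set x : 'I_m | a <= x < b]%N| = (b - a)%N.
Proof.
move=> bm; rewrite -sum1_card.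
under eq_bigl do rewrite inE.
rewrite -(big_mkord (fun x => (a <= x < b)%N) (fun=> 1%N)).
rewrite -big_nat_widen // -[RHS]muln1 -sum_nat_const_nat.
case: (leqP a b) => ab; first by rewrite [RHS](big_nat_widenl _ 0).
rewrite [RHS]big_geq ?(ltnW ab) // big_nat_cond big1 // => x.
by case/andP => xb; rewrite leqNgt (leq_trans (_ : x < b)%N (ltnW ab)) //; case/andP: xb.
Qed.

(* For k < n, the k-th cover is the set of generators of the colon ideal      *)
(* (I, x_0, ..., x_(k-1)) : x_k; the last one is the set of all rows.         *)
Definition cover k : {set 'I_m} :=
  if insub k is Some j then [set x : 'I_m | (x < k) || (mu j <= x < lam j)]%N
  else [set x : 'I_m | x < n]%N.

Lemma cover_row (j : 'I_n) :
  cover j = [set x : 'I_m | (x < j) || (mu j <= x < lam j)]%N.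
Proof. by rewrite /cover valK. Qed.

Lemma cover_end k : (n <= k)%N -> cover k = [set x : 'I_m | x < n]%N.
Proof. by move=> nk; rewrite /cover insubF // ltnNge nk. Qed.

Lemma card_cover_row (j : 'I_n) : #|cover j| = (lam j - mu j + j)%N.
Proof.
rewrite cover_row.
have -> : [set x : 'I_m | (x < j) || (mu j <= x < lam j)]%N =
    [set x : 'I_m | 0 <= x < j]%N :|: [set x : 'I_m | mu j <= x < lam j]%N.
  by apply/setP => x; rewrite !inE.
rewrite cardsU !card_interval ?lam_le //; last first.
  exact: leq_trans (ltnW (ltn_ord j)) hnm.
rewrite (_ : _ :&: _ = set0) ?cards0 ?subn0 1?addnC //.
by apply/setP => x; rewrite !inE; have := mu_ge j; lia.
Qed.

Lemma card_cover_end : #|cover n| = n.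
Proof.
by rewrite cover_end // -[RHS]subn0 -card_interval.
Qed.

Lemma ferrers_mon_cover k t : ferrers_mon t -> hits (cover k) t.
Proof.
case/ferrers_monP => i [x [/andP[mx xl] /lepm_addU /andP[ti tx]]].
case: (ltnP k n) => kn; last first.
  by apply/exists_inP; exists (w i); rewrite // cover_end // inE /=.
rewrite (cover_row (Ordinal kn)); apply/exists_inP.
case: (ltnP i k) => ik; first by exists (w i); rewrite // inE /= ik.
exists x; rewrite // inE /=.
have mk := @mu_mono (Ordinal kn) i ik; have lk := @lam_anti (Ordinal kn) i ik.
by rewrite (leq_trans mk mx) (leq_trans xl lk) orbT.
Qed.

Lemma spec_ferrers_sub_cover k : subideal spec (@var_ideal K m (cover k)).
Proof.
by rewrite spec_ferrers_idealE => p Ip t /Ip; apply: ferrers_mon_cover.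
Qed.

(** Let x_k be the first row variable outside P. The generators x_k x_j then force every column
    variable of row k into P, and the earlier row variables are there already. *)
Lemma prime_sub_cover (P : S -> Prop) : prime_ideal P -> subideal spec P ->
  exists2 k, (k <= n)%N & subideal (var_ideal (cover k)) P.
Proof.
case=> idP P1 Ppr IP.
have genP (A : {set 'I_m}) : (forall a, a \in A -> P 'X_a) -> subideal (@var_ideal K m A) P.
  move=> AP; rewrite var_idealE; apply: ideal_gen_min => // _ [a aA ->].
  exact: AP.
suff : forall k, (k <= n)%N ->
    (exists2 j, (j <= n)%N & subideal (var_ideal (cover j)) P) \/
    forall x : 'I_m, (x < k)%N -> P 'X_x.
  move=> /(_ n (leqnn n)) [//|Px]; exists n => //; apply: genP => x.
  by rewrite cover_end // inE; apply: Px.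
elim=> [_|k IHk kn]; first by right.
have [?|Px] := IHk (ltnW kn); first by left.
pose j := Ordinal kn; case: (boolp.EM (P 'X_(w j))) => [Pj|nPj].
  right=> x; rewrite ltnS leq_eqVlt => /orP[/eqP xk|]; last exact: Px.
  by rewrite (_ : x = w j) //; apply: val_inj.
left; exists k; first exact: ltnW.
apply: genP => x; rewrite (cover_row j) inE => /orP[/Px //|xj].
have /Ppr [] // : P ('X_(w j) * 'X_x).
by apply: IP; apply: ideal_gen_mem; exists j, x.
Qed.

Lemma bigminn_le (I : eqType) (r : seq I) (F : I -> nat) b j : j \in r ->
  (\big[minn/b]_(i <- r) F i <= F j)%N.
Proof.
elim: r => // i r IHr; rewrite inE big_cons geq_min => /orP[/eqP ->|/IHr ->].
  by rewrite leqnn.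
by rewrite orbT.
Qed.

Lemma bigminn_le_idx (I : Type) (r : seq I) (F : I -> nat) b :
  (\big[minn/b]_(i <- r) F i <= b)%N.
Proof. by elim/big_rec: _ => // i x _ xb; rewrite geq_min xb orbT. Qed.

Lemma bigminn_attained (I : eqType) (r : seq I) (F : I -> nat) b :
  \big[minn/b]_(i <- r) F i = b \/
  exists2 i, i \in r & \big[minn/b]_(i <- r) F i = F i.
Proof.
elim: r => [|i r IHr]; first by left; rewrite big_nil.
rewrite big_cons; case: (leqP (F i) (\big[minn/b]_(j <- r) F j)) => _.
  by right; exists i; rewrite ?mem_head.
case: IHr => [->|[j jr ->]]; first by left.
by right; exists j; rewrite // inE jr orbT.
Qed.

Lemma spec_ferrers_height :
  ideal_height spec (\big[minn/n]_(j < n) (lam j - mu j + j))%N.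
Proof.
(* The default value [n] of the minimum is the size of the last cover. *)
set h := (\big[minn/n]_(j < n) _)%N; split.
  have [k kh] : exists k, #|cover k| = h.
    case: (bigminn_attained (index_enum 'I_n) (fun j => lam j - mu j + j)%N n).
      by rewrite -/h => ->; exists n; apply: card_cover_end.
    by case=> j _; rewrite -/h => ->; exists j; rewrite card_cover_row.
  exists (var_ideal (cover k)); split; first exact: var_ideal_prime.
    exact: spec_ferrers_sub_cover.
  by rewrite -kh; apply: var_ideal_height.
move=> P h' prP /(prime_sub_cover prP) [k kn kP] [_ Ph].
have /Ph : prime_chain P #|cover k| by apply: var_ideal_chain.
apply: leq_trans; case: (ltnP k n) => nk.
  by rewrite (card_cover_row (Ordinal nk)); apply: bigminn_le; rewrite mem_index_enum.
have -> : k = n by apply/eqP; rewrite eqn_leq kn nk.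
by rewrite card_cover_end bigminn_le_idx.
Qed.

Let p := (\max_(j < n) (lam j - mu j + j))%N.

(** The last cover, of size n, is dominated too: row n - 1 contributes at least 1 + (n - 1). *)
Lemma card_cover_le k : (#|cover k| <= p)%N.
Proof.
case: (ltnP k n) => kn.
  by rewrite (card_cover_row (Ordinal kn)) (leq_bigmax (Ordinal kn)).
rewrite cover_end // -(cover_end (leqnn n)) card_cover_end.
have kn' : (n.-1 < n)%N by rewrite prednK.
apply: leq_trans (leq_bigmax (Ordinal kn')); have := mu_lam (Ordinal kn') (Ordinal kn').
by rewrite /=; lia.
Qed.

(** For j < n, avoiding cover k gives x >= j, and avoiding cover i gives x < mu_i or x >= lam_i.
    Either alternative passes to j by monotonicity. This is the interval condition of
    [interval_coloring] for the complements. *)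
Lemma cover_convex i j k x : (i <= j <= k)%N ->
  x \in ~: cover i -> x \in ~: cover k -> x \in ~: cover j.
Proof.
case/andP => ij jk; rewrite !inE.
case: (ltnP k n) => kn; last first.
  rewrite (cover_end kn) inE -leqNgt => + nx.
  case: (ltnP j n) => jn; last by rewrite (cover_end jn) inE -leqNgt.
  rewrite (cover_row (Ordinal (leq_ltn_trans ij jn))) (cover_row (Ordinal jn)).
  rewrite !inE /= => xi.
  have := @mu_mono (Ordinal (leq_ltn_trans ij jn)) (Ordinal jn) ij.
  have := @lam_anti (Ordinal (leq_ltn_trans ij jn)) (Ordinal jn) ij.
  by move: xi; lia.
have jn := leq_ltn_trans jk kn; have i_n := leq_ltn_trans ij jn.
rewrite (cover_row (Ordinal i_n)) (cover_row (Ordinal jn)) (cover_row (Ordinal kn)).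
rewrite !inE /=.
have := @mu_mono (Ordinal i_n) (Ordinal jn) ij.
have := @lam_anti (Ordinal i_n) (Ordinal jn) ij.
have := @mu_mono (Ordinal jn) (Ordinal kn) jk.
have := @lam_anti (Ordinal jn) (Ordinal kn) jk.
have := mu_lam (Ordinal kn) (Ordinal i_n).
by lia.
Qed.

(** The exponents of (I, x_0, ..., x_(k-1)), the k-th step of the filtration. *)
Definition rows_mon k (t : 'X_{1..m}) :=
  ferrers_mon t || hits [set x : 'I_m | x < k]%N t.

Lemma rows_mon_upclosed k : upclosed (rows_mon k).
Proof.
move=> t u /orP[/ferrers_mon_upclosed|/hits_upclosed] tu.
  by rewrite /rows_mon tu.
by rewrite /rows_mon tu orbT.
Qed.

(** Generators of rows i < k are absorbed by x_i and row k contributes its columns. A column of a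
    row i > k is also one of row k, and it is not k itself because mu_i >= i > k. *)
Lemma rows_colon (k : 'I_n) :
  ideal_colon (@monomial_ideal K m (rows_mon k)) 'X_(w k) = var_ideal (cover k).
Proof.
rewrite monomial_ideal_colon; congr monomial_ideal; apply: boolp.funext => t.
have tx x : x != w k -> ((t + U_(w k))%MM x != 0%N) = (t x != 0%N).
  by move=> xk; rewrite mnmDE mnm1E [w k == x]eq_sym (negPf xk) addn0.
apply/idP/exists_inP; rewrite cover_row.
  case/orP => [/ferrers_monP [i [x [xi tix]]]|/exists_inP [x]]; last first.
    rewrite inE => xk; rewrite tx; first by exists x; rewrite // inE xk.
    by rewrite -(inj_eq val_inj) /= neq_ltn xk.
  case: (ltngtP i k) => [ik|ki|/val_inj ik].
  - exists (w i); first by rewrite inE /= ik.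
    rewrite -tx; last by rewrite -(inj_eq val_inj) /= neq_ltn ik.
    by case/andP: (lepm_addU tix).
  - exists x.
      have := mu_mono (ltnW ki); have := lam_anti (ltnW ki).
      by rewrite inE; lia.
    rewrite -tx; first by case/andP: (lepm_addU tix).
    by rewrite -(inj_eq val_inj) /= neq_ltn; have := mu_ge i; lia.
  - exists x; first by rewrite inE -ik xi orbT.
    rewrite -lep1mP; apply/mnm_lepP => y; have /mnm_lepP/(_ y) := tix.
    by rewrite ik !mnmDE addnC leq_add2r.
case=> x; rewrite inE => /orP[xk|xk] tx0; apply/orP; [right|left].
  by rewrite hitsD; apply/orP; left; apply/exists_inP; exists x; rewrite ?inE.
apply/ferrers_monP; exists k, x; split=> //; apply/mnm_lepP => y.
rewrite !mnmDE addnC leq_add2r.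
by move: tx0; rewrite -lep1mP => /mnm_lepP.
Qed.

Lemma rows_adjoin (k : 'I_n) :
  ideal_adjoin (@monomial_ideal K m (rows_mon k)) 'X_(w k) =
  monomial_ideal (rows_mon k.+1).
Proof.
rewrite monomial_ideal_adjoin; last exact: rows_mon_upclosed.
congr monomial_ideal; apply: boolp.funext => t; rewrite /rows_mon -orbA.
congr orb; rewrite lep1mP; apply/orP/exists_inP.
  case=> [/exists_inP [x xk tx]|tk]; last by exists (w k); rewrite // inE /=.
  by exists x; rewrite // inE ltnS ltnW //; rewrite inE in xk.
case=> x; rewrite inE ltnS leq_eqVlt => /orP[/eqP xk|xk] tx.
  by right; rewrite (_ : w k = x) //; apply: val_inj.
by left; apply/exists_inP; exists x; rewrite ?inE.
Qed.

Lemma rows_end : monomial_ideal (rows_mon n) = @var_ideal K m (cover n).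
Proof.
congr monomial_ideal; apply: boolp.funext => t; rewrite /rows_mon.
apply/orP/idP; rewrite cover_end //; last by right.
by case=> // /(ferrers_mon_cover n); rewrite cover_end.
Qed.

Lemma spec_ferrers_regular (s : seq S) :
  (forall k, quot_regular (var_ideal (cover k)) s) -> quot_regular spec s.
Proof.
move=> sreg.
suff rg i : (i <= n)%N -> quot_regular (monomial_ideal (rows_mon (n - i)%N)) s.
  have := rg n (leqnn n); rewrite subnn spec_ferrers_idealE.
  congr (quot_regular (monomial_ideal _) s); apply: boolp.funext => t.
  rewrite /rows_mon; case: ferrers_mon => //=; apply/negbTE/exists_inP.
  by case=> x; rewrite inE ltn0.
elim: i => [_|i IHi ni]; first by rewrite subn0 rows_end.
have kn : (n - i.+1 < n)%N by rewrite ltn_subrL n_gt0.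
apply: (@quot_regular_ext _ _ 'X_(w (Ordinal kn))).
- by apply: monomial_ideal_ideal; apply: rows_mon_upclosed.
- by rewrite (rows_colon (Ordinal kn)).
- by rewrite (rows_adjoin (Ordinal kn)) /= subnSK //; apply: IHi; apply: ltnW.
Qed.

Lemma color_sum_irrelevant d (col : 'I_m -> option 'I_d) k :
  irrelevant_ideal (color_sum K col k).
Proof.
apply: ideal_sum; first exact: ideal_gen_ideal.
by move=> i _; apply: ideal_gen_mem; exists i.
Qed.

(** All products of the rows A = {0, ..., j} with the columns B of row j lie in the ideal. As mu_j
    >= j, A and B are disjoint or, when mu_j = j, meet exactly in j; both cases give degree |A| +
    |B| - 1. *)
Lemma spec_ferrers_koszul (j : 'I_n) : koszul_class spec (lam j - mu j + j)%N.
Proof.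
rewrite spec_ferrers_idealE.
pose A := [set x : 'I_m | 0 <= x < j.+1]%N.
pose B := [set x : 'I_m | mu j <= x < lam j]%N.
have cA : #|A| = j.+1 by rewrite card_interval ?subn0 // (leq_trans _ hnm).
have cB : #|B| = (lam j - mu j)%N by rewrite card_interval.
have DU u : ~~ ferrers_mon U_(u)%MM.
  apply/ferrers_monP => -[i [x [_ ix]]].
  have : (mdeg (U_(w i) + U_(x)) <= mdeg U_(u))%N.
    by rewrite !mdegE; apply: leq_sum => y _; apply: (mnm_lepP ix).
  by rewrite mdegD !mdeg1.
have DAB a b : a \in A -> b \in B -> ferrers_mon (U_(a) + U_(b))%MM.
  rewrite !inE /= => aj bj; apply/ferrers_monP.
  have an : (a < n)%N by apply: leq_trans aj _; apply: ltn_ord.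
  exists (Ordinal an), b; split; last first.
    by rewrite (_ : w _ = a) ?lepm_refl //; apply: val_inj.
  have := @mu_mono (Ordinal an) j aj; have := @lam_anti (Ordinal an) j aj.
  by lia.
have -> : (lam j - mu j + j)%N = (#|A| + #|B|).-1 by rewrite cA cB; lia.
have mj := mu_lam j j; have gj := mu_ge j.
have ABE x : (x \in A :&: B) = (x == w j) && (mu j == j).
  by rewrite !inE -(inj_eq val_inj) /=; lia.
case: (eqVneq (mu j) j) => [mjE|mjN].
  apply: (@koszul_class_overlap _ _ _ A B _ _ _ (w j)) => //.
    exact: ferrers_mon_upclosed.
  by apply/setP => x; rewrite ABE inE mjE eqxx andbT.
apply: koszul_class_disjoint => //; first exact: ferrers_mon_upclosed.
- rewrite -setI_eq0; apply/eqP/setP => x.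
  by rewrite ABE inE (negPf mjN) andbF.
- by rewrite -card_gt0 cA.
- by rewrite -card_gt0 cB subn_gt0.
Qed.

Lemma spec_ferrers_depth : quot_depth spec (m - p)%N.
Proof.
have idI : is_ideal spec by apply: ideal_gen_ideal.
split.
  have dC k : (m - p <= #|~: cover k|)%N.
    have := cardsC (cover k); have := card_cover_le k; rewrite card_ord; lia.
  (* [n.+1] counts the covers 0, ..., n; all later ones equal the last. *)
  have [col colP] := interval_coloring dC cover_convex n.+1.
  exists [seq color_sum K col k | k <- enum 'I_(m - p)]; split.
  - by move=> _ /mapP [k _ ->]; apply: color_sum_irrelevant.
  - apply: spec_ferrers_regular => k.
    have -> : cover k = cover (minn k n).
      by case: (leqP k n) => // nk; rewrite !cover_end // ltnW.
    apply: quot_regular_color_sum => l.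
    have [|x xC cx] := colP (minn k n) l; first by rewrite ltnS geq_minr.
    by exists x => //; rewrite -in_setC.
  - by rewrite size_map size_enum_ord.
move=> s sirr sreg.
have In : (0 < #|'I_n|)%N by rewrite card_ord.
have [j] := @bigop.eq_bigmax 'I_n (fun j : 'I_n => lam j - mu j + j)%N In.
rewrite -/p => pj.
have := koszul_class_regular idI (spec_ferrers_koszul j) sirr sreg.
by rewrite -pj => ps; rewrite -[size s](addKn p) leq_sub2r.
Qed.

End FerrersIdeal.

(** * Exactness of cellular complexes *)

Section Cellular.

Variables (K : fieldType) (m : nat) (V : finType).
Variables (X : {set {set V}}) (dim1 : {set V} -> nat).
Variables (eps : {set V} -> {set V} -> int) (label : V -> 'X_{1..m}).
Variables (A : zmodType) (wt : 'X_{1..m} -> A).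
Hypothesis wtD : forall t u, wt (t + u)%MM = wt t + wt u.

Notation S := {mpoly K[m]}.
Notation facet := (is_facet dim1).
Notation flabel := (face_label label).
Notation faces := (faces_of_dim1 X dim1).
Implicit Types (P Q R : {set V}) (b t : 'X_{1..m}).

Lemma face_label_sub Q b : (flabel Q <= b)%MM = [forall v in Q, (label v <= b)%MM].
Proof.
apply/idP/forall_inP => [Qb v vQ|Qb].
  apply: lepm_trans Qb; rewrite /face_label.
  elim: (index_enum V) (mem_index_enum v) => // x r IHr.
  rewrite inE big_cons => /predU1P[<-|/IHr vr]; first by rewrite vQ lem_mlcml.
  by case: ifP => // _; apply: lepm_trans vr (lem_mlcmr _ _).
rewrite /face_label; elim/big_ind: _ => // [|x y xb yb].
  by apply/mnm_lepP => i; rewrite mnm0E.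
by rewrite lem_mlcm xb.
Qed.

Lemma face_labelS Q P : Q \subset P -> (flabel Q <= flabel P)%MM.
Proof.
move=> /subsetP QP; rewrite face_label_sub; apply/forall_inP => v /QP vP.
by have := lepm_refl (flabel P); rewrite face_label_sub => /forall_inP; apply.
Qed.

(** [cellular_complex] over an arbitrary grading group: one proof then serves the fine grading of
    the cellular statement and the standard grading of the numerical invariants. *)
Definition graded_cellular_complex : graded_complex K m A :=
  @GradedComplex K m A (fun k => #|faces k|)
    (fun k i => wt (flabel (enum_val i)))
    (fun k => \matrix_(i, j)
       let P := enum_val i in let Q := enum_val j in
       if facet Q P then (eps P Q)%:~R *: 'X_[K, (flabel P - flabel Q)%MM]
       else 0).

(* In multidegree b a chain c stands for the sum of the c P x^(b - label P) e_P. *)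
Definition boundary (c : {set V} -> K) Q : K :=
  \sum_(P in X | facet Q P) (eps P Q)%:~R * c P.

Definition strand_chain b k (c : {set V} -> K) : Prop :=
  forall P, c P != 0 -> [/\ P \in X, dim1 P = k & (flabel P <= b)%MM].

Variable D : pred 'X_{1..m}.
Hypothesis Dup : upclosed D.
Hypothesis Xinc : incidence_function X dim1 eps.
Hypothesis X0 : set0 \in X.
Hypothesis dim0 : dim1 set0 = 0%N.
Hypothesis dim0E : forall Q, Q \in X -> dim1 Q = 0%N -> Q = set0.
Hypothesis D_vertex : forall P, P \in X -> dim1 P = 1%N -> D (flabel P).
Hypothesis facet_label : forall P Q, P \in X -> Q \in X -> facet Q P ->
  flabel P != flabel Q.
(** For k = 0 exactness is required only in multidegrees of the ideal; elsewhere the empty face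
    survives and spans S / I. *)
Hypothesis strand_exact : forall b k c, (0 < k)%N || D b -> strand_chain b k c ->
  (forall Q, Q \in X -> (dim1 Q).+1 = k -> boundary c Q = 0) ->
  exists2 c', strand_chain b k.+1 c' &
    forall Q, Q \in X -> dim1 Q = k -> boundary c' Q = c Q.

Let F := graded_cellular_complex.

Lemma face_enum_val k (i : 'I_#|faces k|) : enum_val i \in X /\ dim1 (enum_val i) = k.
Proof. by have := enum_valP i; rewrite inE => /andP[-> /eqP]. Qed.

Definition chain_of k (v : 'rV[S]_#|faces k|) Q : S :=
  if [pick i | enum_val i == Q] is Some i then v 0 i else 0.

Lemma chain_of_enum_val k (v : 'rV[S]_#|faces k|) i :
  chain_of v (enum_val i) = v 0 i.
Proof.
rewrite /chain_of; case: pickP => [j /eqP /enum_val_inj -> //|/(_ i)].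
by rewrite eqxx.
Qed.

Lemma chain_of_mul k (v : 'rV[S]_#|faces k.+1|) (j : 'I_#|faces k|) :
  (v *m gdif F k) 0 j = \sum_(P in X | facet (enum_val j) P)
    (eps P (enum_val j))%:~R *: (chain_of v P *
       'X_[(flabel P - flabel (enum_val j))%MM]).
Proof.
have [jX dj] := face_enum_val j.
transitivity (\sum_(P in faces k.+1) if facet (enum_val j) P then
   (eps P (enum_val j))%:~R *: (chain_of v P *
       'X_[(flabel P - flabel (enum_val j))%MM]) else 0).
  rewrite big_enum_val mxE; apply: eq_bigr => i _.
  by rewrite mxE chain_of_enum_val /=; case: ifP => _; rewrite ?mulr0 // scalerAr.
rewrite -big_mkcondr; apply: eq_bigl => P; rewrite inE -andbA.
congr andb; rewrite /is_facet dj.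
by case: (dim1 P == k.+1) => //; rewrite andbF.
Qed.

Definition strand k (v : 'rV[S]_#|faces k|) b Q : K :=
  if (Q \in faces k) && (flabel Q <= b)%MM then (chain_of v Q)@_(b - flabel Q)
  else 0.

Lemma strand_chainP k (v : 'rV[S]_#|faces k|) b : strand_chain b k (strand v b).
Proof.
move=> P; rewrite /strand inE; case: ifP => [/andP[/andP[PX /eqP Pk] Pb] _ //|].
by rewrite eqxx.
Qed.

Lemma lepm_sub2 (s t u : 'X_{1..m}) : (s <= t)%MM -> (s <= u)%MM ->
  (t - s <= u - s)%MM = (t <= u)%MM.
Proof.
move=> /mnm_lepP st /mnm_lepP su.
apply/mnm_lepP/mnm_lepP => tu i; have := tu i; rewrite !mnmBE.
  by have := st i; have := su i; lia.
by have := st i; have := su i; lia.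
Qed.

Lemma submm_sub2 (s t u : 'X_{1..m}) : (s <= t)%MM ->
  (u - s - (t - s) = u - t)%MM.
Proof. by move=> st; rewrite submDA addmBA // addmC addmK. Qed.

Lemma strand_mul k (v : 'rV[S]_#|faces k.+1|) b (j : 'I_#|faces k|) :
  (flabel (enum_val j) <= b)%MM ->
  ((v *m gdif F k) 0 j)@_(b - flabel (enum_val j)) =
  boundary (strand v b) (enum_val j).
Proof.
move=> jb; rewrite chain_of_mul raddf_sum /=; apply: eq_bigr => P /andP[PX jP].
have [jX dj] := face_enum_val j; have [jsP /eqP dP] := andP jP.
rewrite mcoeffZ mcoeff_mulX lepm_sub2 ?face_labelS // submm_sub2 ?face_labelS //.
by rewrite /strand inE PX dP dj eqxx.
Qed.

Lemma boundary_strand0 k (v : 'rV[S]_#|faces k.+1|) b Q :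
  v *m gdif F k = 0 -> Q \in X -> dim1 Q = k -> boundary (strand v b) Q = 0.
Proof.
move=> v0 QX Qk; have Qf : Q \in faces k by rewrite inE QX Qk eqxx.
case: (boolP (flabel Q <= b)%MM) => Qb.
  rewrite -(enum_rankK_in Qf Qf) in Qb *.
  by rewrite -strand_mul // v0 mxE mcoeff0.
rewrite /boundary big1 // => P /andP[PX /andP[QP _]].
rewrite /strand ifF ?mulr0 //; apply/negbTE; apply: contra Qb => /andP[_].
exact/lepm_trans/face_labelS.
Qed.

(** Multidegrees are lifted separately and reassembled; the sum runs over [Bs], the finitely many
    multidegrees in which [v] is nonzero. *)
Lemma strand_lift k (v : 'rV[S]_#|faces k|) :
  (forall b, exists2 c', strand_chain b k.+1 c' &
     forall Q, Q \in X -> dim1 Q = k -> boundary c' Q = strand v b Q) ->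
  exists w, v = w *m gdif F k.
Proof.
move=> vb; have /boolp.choice [c cP] : forall b, exists c', strand_chain b k.+1 c' /\
    forall Q, Q \in X -> dim1 Q = k -> boundary c' Q = strand v b Q.
  by move=> b; have [c' ? ?] := vb b; exists c'.
pose Bs := undup (flatten [seq [seq (t + flabel (enum_val j))%MM | t <- msupp (v 0 j)]
  | j <- enum 'I_#|faces k|]).
pose w : 'rV[S]_#|faces k.+1| := \row_i \sum_(b <- Bs)
  c b (enum_val i) *: 'X_[(b - flabel (enum_val i))%MM].
have wE b P : strand w b P = if b \in Bs then c b P else 0.
  rewrite /strand; case: ifPn => [/andP[Pk Pb]|PNb]; last first.
    case: ifP => // _; have [cb _] := cP b; apply/esym/eqP.
    by apply: contraNT PNb => /cb [PX Pk ->]; rewrite inE PX Pk eqxx.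
  rewrite -(enum_rankK_in Pk Pk) chain_of_enum_val mxE raddf_sum /=.
  rewrite enum_rankK_in // -[RHS]/(if b \in Bs then _ else 0).
  have cE b' : (c b' P *: 'X_[(b' - flabel P)])@_(b - flabel P) =
      (b' == b)%:R * c b P.
    rewrite mcoeffZ mcoeffX; case: (eqVneq b' b) => [->|bb].
      by rewrite eqxx mulr1 mul1r.
    case: (eqVneq (c b' P) 0) => [->|]; first by rewrite !mul0r.
    have [cb _] := cP b'; move=> /cb [_ _ Pb']; rewrite mul0r.
    case: eqP => [bbE|_]; last by rewrite mulr0.
    by rewrite -(submK Pb') bbE submK // eqxx in bb.
  under eq_bigr do rewrite cE.
  case: ifP => bB.
    rewrite (bigD1_seq b) ?undup_uniq //= eqxx mul1r big1 ?addr0 //.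
    by move=> b' /negPf ->; rewrite mul0r.
  rewrite big_seq big1 // => b' b'B; case: eqP => [bE|_]; last by rewrite mul0r.
  by rewrite -bE b'B in bB.
exists w; apply/rowP => j; apply/mpolyP => t.
pose b := (t + flabel (enum_val j))%MM.
have -> : t = (b - flabel (enum_val j))%MM by rewrite addmK.
have jb : (flabel (enum_val j) <= b)%MM by apply: lem_addl.
have [jX jk] := face_enum_val j.
rewrite strand_mul //; have [cb bd] := cP b.
case: (boolP (b \in Bs)) => bB.
  transitivity (boundary (c b) (enum_val j)); last first.
    by apply: eq_bigr => P _; rewrite wE bB.
  by rewrite bd // /strand inE jX jk eqxx jb chain_of_enum_val.
rewrite /boundary big1; last by move=> P _; rewrite wE (negPf bB) mulr0.
rewrite /b addmK; apply: memN_msupp_eq0; apply: contra bB => tv.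
rewrite mem_undup; apply/flatten_mapP; exists j; first by rewrite mem_enum.
exact: map_f.
Qed.

Lemma gdif_facet k (i : 'I_#|faces k.+1|) (j : 'I_#|faces k|) t :
  t \in msupp (gdif F k i j) ->
  [/\ facet (enum_val j) (enum_val i),
      (flabel (enum_val j) <= flabel (enum_val i))%MM
    & t = (flabel (enum_val i) - flabel (enum_val j))%MM].
Proof.
rewrite mxE /=; case: ifP => [ij|_]; last by rewrite msupp0.
move=> /msuppZ_le; rewrite msuppX inE => /eqP ->.
by split=> //; apply: face_labelS; case/andP: ij.
Qed.

Lemma gdif_gdif k : gdif F k.+1 *m gdif F k = 0.
Proof.
apply/matrixP => i j; rewrite !mxE.
have [iX ik] := face_enum_val i; have [jX jk] := face_enum_val j.
set P := enum_val i; set R := enum_val j; have [_ dd] := Xinc.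
have := dd P R iX jX => /(congr1 (fun x => x%:~R *: 'X_[K, (flabel P - flabel R)%MM])).
rewrite scale0r => E0; rewrite -[RHS]E0 rmorph_sum scaler_suml /=.
transitivity (\sum_(Q in faces k.+1) if facet Q P && facet R Q then
    (eps P Q * eps Q R)%:~R *: 'X_[K, (flabel P - flabel R)%MM] else 0).
  rewrite [RHS]big_enum_val; apply: eq_bigr => x _; rewrite !mxE /= -/P -/R.
  case: ifP => [xP|_]; last by rewrite mul0r.
  case: ifP => [Rx|_]; last by rewrite mulr0.
  have Px := face_labelS (proj1 (andP xP)); have xR := face_labelS (proj1 (andP Rx)).
  rewrite -scalerAl -scalerAr scalerA -intrM -mpolyXD; congr (_ *: 'X_[_]).
  by rewrite addmBA // submK.
rewrite -big_mkcondr; apply: eq_bigl => Q; rewrite inE -andbA; congr andb.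
rewrite /is_facet jk; case: (dim1 Q =P k.+1) => //= _; last by rewrite !andbF.
Qed.

Lemma graded_cellular_resolution :
  @minimal_free_resolution K m A wt (fun _ => True) (monomial_ideal D) F (const_mx 1).
Proof.
have f0 : faces 0 = [set set0].
  apply/setP => Q; rewrite !inE; apply/andP/eqP => [[QX /eqP /(dim0E QX)] //|->].
  by rewrite dim0 eqxx.
have c0 : #|faces 0| = 1%N by rewrite f0 cards1.
have e0 (i : 'I_(#|faces 0|)) : enum_val i = set0.
  by have := enum_valP i; rewrite {2}f0 inE => /eqP.
have l0 : flabel set0 = 0%MM by rewrite /face_label big_set0.
pose i0 : 'I_#|faces 0| := cast_ord (esym c0) ord0.
have i0E i : i = i0 by apply: enum_val_inj; rewrite !e0.
have augE (v : 'rV[S]_(grank F 0)) : (v *m const_mx 1 : 'M_1) 0 0 = v 0 i0.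
  rewrite mxE (bigD1 i0) //= mxE mulr1 big1 ?addr0 // => i.
  by rewrite [i]i0E eqxx.
split; last first.
  move=> k i j; apply/irrelevantP; apply: memN_msupp_eq0; apply/negP => /gdif_facet.
  have [iX _] := face_enum_val i; have [jX _] := face_enum_val j.
  case=> ij lij tE; have := facet_label iX jX ij.
  by rewrite -(submK lij) -tE add0m eqxx.
split.
- by move=> k i j t /gdif_facet [_ ij ->] /=; rewrite -wtD submK.
- by move=> i t; rewrite mxE msupp1 inE => /eqP ->; rewrite /= e0 l0.
- split=> // p _; exists (const_mx p); rewrite augE mxE subrr.
  by case: (monomial_ideal_ideal K Dup).
- move=> v; rewrite augE; split=> [Dv|[w ->]].
    apply: strand_lift => b; case: (boolP (D b)) => [Db|Db].
      have D0 : (0 < 0)%N || D b by rewrite Db orbT.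
      by have [//|c' c'1 c'2] := strand_exact D0 (@strand_chainP 0 v b); exists c'.
    have s0 Q : strand v b Q = 0.
      rewrite /strand; case: ifP => // /andP[Q0 _].
      rewrite -(enum_rankK_in Q0 Q0) chain_of_enum_val e0 l0 subm0 [enum_rank_in _ _]i0E.
      by apply: memN_msupp_eq0; apply: contra Db; apply: Dv.
    exists (fun=> 0) => [P|Q _ _]; first by rewrite eqxx.
    by rewrite s0 /boundary big1 // => P _; rewrite mulr0.
  rewrite mxE; have idD := monomial_ideal_ideal K Dup.
  apply: ideal_sum => // i _; case: (idD) => _ _; apply=> t /gdif_facet [_ _ ->].
  rewrite e0 l0 subm0; have [iX ik] := face_enum_val i.
  exact: D_vertex.
- move=> k v; split=> [v0|[w ->]]; last by rewrite -mulmxA gdif_gdif mulmx0.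
  apply: strand_lift => b; apply: strand_exact => //; first exact: strand_chainP.
  by move=> Q QX [Qk]; apply: boundary_strand0.
Qed.

End Cellular.

(** * Strands of products of simplices *)

Section SimplexProduct.

Variables (n m : nat).
Notation V := ('I_n * 'I_m)%type.
Notation dim1 := (@simplex_prod_dim1 n m).
Notation facet := (is_facet dim1).
Implicit Types (P Q R : {set V}) (A : {set 'I_n}) (B : {set 'I_m}).

Definition rows P : {set 'I_n} := [set v.1 | v in P].
Definition cols P : {set 'I_m} := [set v.2 | v in P].

Lemma rows_set0 : rows set0 = set0. Proof. exact: imset0. Qed.
Lemma cols_set0 : cols set0 = set0. Proof. exact: imset0. Qed.

Lemma rowsX A B : B != set0 -> rows (setX A B) = A.
Proof.
case/set0Pn => b bB; apply/setP => a; apply/imsetP/idP => [[v]|aA].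
  by rewrite inE => /andP[va _] ->.
by exists (a, b); rewrite // !inE /= aA.
Qed.

Lemma colsX A B : A != set0 -> cols (setX A B) = B.
Proof.
case/set0Pn => a aA; apply/setP => b; apply/imsetP/idP => [[v]|bB].
  by rewrite inE => /andP[_ vb] ->.
by exists (a, b); rewrite // !inE /= aA.
Qed.

Lemma setX_eq0 A B : (setX A B == set0) = (A == set0) || (B == set0).
Proof. by rewrite -!cards_eq0 cardsX muln_eq0. Qed.

Lemma simplex_prodP P : reflect (P = setX (rows P) (cols P)) (P \in simplex_prod n m).
Proof.
apply: (iffP imset2P) => [[A B _ _ ->]|PE]; last by exists (rows P) (cols P).
case: (eqVneq A set0) => [->|A0].
  by rewrite (_ : setX set0 B = set0) ?rows_set0 ?cols_set0;
    apply/eqP; rewrite ?setX_eq0 ?eqxx // eq_sym setX_eq0 eqxx.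
case: (eqVneq B set0) => [->|B0]; last by rewrite rowsX ?colsX.
by rewrite (_ : setX A set0 = set0) ?rows_set0 ?cols_set0;
  apply/eqP; rewrite ?setX_eq0 ?eqxx ?orbT // eq_sym setX_eq0 eqxx.
Qed.

Lemma setX_simplex_prod A B : setX A B \in simplex_prod n m.
Proof. by apply/imset2P; exists A B. Qed.

Lemma rows_eq0 P : (rows P == set0) = (P == set0).
Proof. exact: imset_eq0. Qed.

Lemma cols_eq0 P : (cols P == set0) = (P == set0).
Proof. exact: imset_eq0. Qed.

Lemma rowsS P Q : P \subset Q -> rows P \subset rows Q.
Proof. exact: imsetS. Qed.

Lemma colsS P Q : P \subset Q -> cols P \subset cols Q.
Proof. exact: imsetS. Qed.

Lemma dim1E P : dim1 P = (#|rows P| + #|cols P|).-1.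
Proof. by []. Qed.

Lemma dim1_set0 : dim1 set0 = 0%N.
Proof. by rewrite dim1E rows_set0 cols_set0 !cards0. Qed.

Lemma dim1_eq0 P : P \in simplex_prod n m -> dim1 P = 0%N -> P = set0.
Proof.
move=> _; rewrite dim1E => P0; apply/eqP; apply: contraPT P0 => P0.
have : (0 < #|rows P|)%N by rewrite card_gt0 rows_eq0.
have : (0 < #|cols P|)%N by rewrite card_gt0 cols_eq0.
by lia.
Qed.

Lemma card_face P : P != set0 -> (#|rows P| + #|cols P| = (dim1 P).+1)%N.
Proof.
move=> P0; rewrite dim1E prednK // addn_gt0.
by rewrite card_gt0 rows_eq0 P0.
Qed.

Lemma subset_card2 (T U : finType) (A A' : {set T}) (B B' : {set U}) :
  A \subset A' -> B \subset B' -> (#|A'| + #|B'| <= #|A| + #|B|)%N ->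
  A' = A /\ B' = B.
Proof.
move=> AA BB le; have := subset_leq_card AA; have := subset_leq_card BB => lB lA.
by split; apply/esym/eqP; rewrite eqEcard ?AA ?BB /=; lia.
Qed.

Lemma simplex_prod_inj P Q : P \in simplex_prod n m -> Q \in simplex_prod n m ->
  rows P = rows Q -> cols P = cols Q -> P = Q.
Proof. by move=> /simplex_prodP PE /simplex_prodP QE rE cE; rewrite PE QE rE cE. Qed.

Section Strand.

Variables (K : fieldType) (X : {set {set V}}) (eps : {set V} -> {set V} -> int).
Variables (good : pred V) (i0 : 'I_n) (j0 : 'I_m).
Hypothesis Xprod : {subset X <= simplex_prod n m}.
Hypothesis Xinc : incidence_function X dim1 eps.
Hypothesis Xgood : forall P, P \in simplex_prod n m ->
  (forall v, v \in P -> good v) -> P \in X.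
Hypothesis good_i0 : forall i x, good (i, x) -> good (i0, x).
Hypothesis good_ij0 : good (i0, j0).

Notation bd := (@boundary K V X dim1 eps).
Implicit Types (c w : {set V} -> K).

Let gface P := (P \in simplex_prod n m) && [forall v in P, good v].

Let gface_sub P Q : gface P -> Q \in simplex_prod n m -> Q \subset P -> gface Q.
Proof.
rewrite /gface => /andP[_ /forall_inP gP] -> /subsetP QP.
by apply/forall_inP => v /QP /gP.
Qed.

Let gface_X P : gface P -> P \in X.
Proof. by case/andP => Pp /forall_inP gP; apply: Xgood. Qed.

Let epsK P Q : P \in X -> Q \in X -> facet Q P -> (eps P Q)%:~R != 0 :> K.
Proof.
by case: Xinc => e _ PX QX QP; case: (e P Q PX QX QP) => ->;
  rewrite ?mulrN1z ?oppr_eq0 oner_eq0.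
Qed.

Lemma boundary_boundary c R : R \in X ->
  (forall P, c P != 0 -> P \in X) -> bd (bd c) R = 0.
Proof.
move=> RX cX; rewrite /boundary.
under eq_bigr do rewrite mulr_sumr.
rewrite (exchange_big_dep (mem X)) /=; last by move=> Q P _ /andP[].
rewrite big1 // => P PX; case: Xinc => _ /(_ P R PX RX) dd.
transitivity (((\sum_(Q in X | facet Q P && facet R Q) eps P Q * eps Q R)%:~R) * c P).
  rewrite rmorph_sum mulr_suml /=; apply: eq_big => Q; last first.
    by move=> _; rewrite rmorphM /= mulrA [_%:~R * _]mulrC.
  by case: (Q \in X); rewrite //= PX /= andbC.
by rewrite dd mul0r.
Qed.

(* Faces are matched with the face obtained by adding the row i0, and those   *)
(* having i0 as only row (or empty) by adding the column j0.                  *)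
Let down1 Q := (Q != set0) && (i0 \notin rows Q).
Let up1 Q := setX (i0 |: rows Q) (cols Q).
Let down2 Q := (Q == setX [set i0] (cols Q)) && (j0 \notin cols Q).
Let up2 Q := setX [set i0] (j0 |: cols Q).

Let gface_up1 Q : gface Q -> down1 Q -> gface (up1 Q).
Proof.
move=> /andP[/simplex_prodP QE /forall_inP gQ] /andP[Q0 _].
rewrite /gface setX_simplex_prod; apply/forall_inP => -[i x].
rewrite !inE /= => /andP[/predU1P[->|iQ] xQ]; last by apply: gQ; rewrite QE inE /= iQ.
have /set0Pn [i' i'Q] : rows Q != set0 by rewrite rows_eq0.
by apply: (good_i0 (i := i')); apply: gQ; rewrite QE inE /= i'Q.
Qed.

Let gface_up2 Q : gface Q -> down2 Q -> gface (up2 Q).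
Proof.
move=> /andP[_ /forall_inP gQ] /andP[/eqP QE _].
rewrite /gface setX_simplex_prod; apply/forall_inP => -[i x].
rewrite !inE /= => /andP[/eqP -> /predU1P[->//|xQ]].
by apply: gQ; rewrite QE !inE /= eqxx.
Qed.

Let rows_up1 Q : Q != set0 -> rows (up1 Q) = i0 |: rows Q.
Proof. by move=> Q0; rewrite rowsX // cols_eq0. Qed.

Let setU1_neq0 (T : finType) (x : T) (A : {set T}) : x |: A != set0.
Proof. by apply/set0Pn; exists x; rewrite setU11. Qed.

Let set1_neq0 (T : finType) (x : T) : [set x] != set0.
Proof. by apply/set0Pn; exists x; rewrite set11. Qed.

Let cols_up1 Q : cols (up1 Q) = cols Q.
Proof. by rewrite colsX. Qed.

Let rows_up2 Q : rows (up2 Q) = [set i0].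
Proof. by rewrite rowsX. Qed.

Let cols_up2 Q : cols (up2 Q) = j0 |: cols Q.
Proof. by rewrite colsX. Qed.

Let facet_up1 Q : Q \in simplex_prod n m -> down1 Q -> facet Q (up1 Q).
Proof.
move=> /simplex_prodP QE /andP[Q0 i0Q]; apply/andP; split.
  rewrite {1}QE; apply/subsetP => v; rewrite !inE => /andP[-> ->].
  by rewrite orbT.
have U0 : up1 Q != set0 by rewrite -rows_eq0 rows_up1.
rewrite -eqSS -!card_face // rows_up1 // cols_up1 cardsU1 i0Q.
by rewrite add1n addSn.
Qed.

Let dim1_down2 Q : down2 Q -> dim1 Q = #|cols Q|.
Proof.
move=> /andP[/eqP QE _]; case: (eqVneq (cols Q) set0) => [Q0|Q0].
  have -> : Q = set0 by apply/eqP; rewrite -cols_eq0 Q0.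
  by rewrite dim1_set0 cols_set0 cards0.
by rewrite dim1E {1}QE rowsX // cards1 add1n.
Qed.

Let facet_up2 Q : down2 Q -> facet Q (up2 Q).
Proof.
move=> dQ; have /andP[/eqP QE j0Q] := dQ; apply/andP; split.
  rewrite {1}QE; apply/subsetP => v; rewrite !inE => /andP[-> ->].
  by rewrite orbT.
by rewrite (dim1_down2 dQ) dim1E rows_up2 cols_up2 cards1 cardsU1 j0Q !add1n.
Qed.

Let down1_facet_up1 Q Q' : Q \in simplex_prod n m -> Q' \in simplex_prod n m ->
  down1 Q -> down1 Q' -> facet Q' (up1 Q) -> Q' = Q.
Proof.
move=> Qp Q'p /andP[Q0 i0Q] /andP[Q'0 i0Q'] /andP[Q'U /eqP dU].
have U0 : up1 Q != set0 by rewrite -rows_eq0 rows_up1.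
have cU := card_face U0; rewrite dU -card_face // rows_up1 // cols_up1 in cU.
rewrite cardsU1 i0Q in cU.
have rQ : rows Q' \subset rows Q.
  have := rowsS Q'U; rewrite rows_up1 // => /subsetP s; apply/subsetP => x xQ'.
  by have := s x xQ'; rewrite !inE => /predU1P[xi|//]; rewrite -xi xQ' in i0Q'.
have cQ : cols Q' \subset cols Q by have := colsS Q'U; rewrite cols_up1.
have [|rE cE] := subset_card2 rQ cQ; first by rewrite -ltnS -cU add1n addSn.
exact: simplex_prod_inj.
Qed.

Let down2_facet_up2 Q Q' : down2 Q -> down2 Q' -> facet Q' (up2 Q) -> Q' = Q.
Proof.
move=> dQ dQ' /andP[Q'U /eqP dU].
have /andP[/eqP QE j0Q] := dQ; have /andP[/eqP Q'E j0Q'] := dQ'.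
have := dU; rewrite (dim1_down2 dQ') dim1E rows_up2 cols_up2 cards1 cardsU1 j0Q.
rewrite !add1n /= => -[cE].
suff cQ : cols Q' = cols Q by rewrite Q'E QE cQ.
apply/eqP; rewrite eqEcard cE leqnn andbT; apply/subsetP => x xQ'.
have := colsS Q'U => /subsetP /(_ x xQ'); rewrite cols_up2 !inE.
by case/predU1P => // xj; rewrite -xj xQ' in j0Q'.
Qed.

(** [Q] is the only lower face that is a facet of [up Q], so the equations at lower faces decouple
    and each is solved by dividing by one sign. *)
Let clear (down : pred {set V}) (up : {set V} -> {set V}) k c :
  (forall Q, gface Q -> down Q -> gface (up Q) /\ facet Q (up Q)) ->
  (forall Q Q', gface Q -> gface Q' -> down Q -> down Q' ->
     facet Q' (up Q) -> Q' = Q) ->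
  exists w,
    [/\ forall P, w P != 0 -> [/\ gface P, dim1 P = k.+1 &
          exists Q, [/\ gface Q, down Q & P = up Q]]
      & forall Q, gface Q -> down Q -> dim1 Q = k -> bd w Q = c Q].
Proof.
move=> upP upE.
pose w P : K := \sum_(Q | [&& gface Q, down Q, dim1 Q == k & P == up Q])
  c Q / (eps P Q)%:~R.
have wP P : w P != 0 -> exists Q, [/\ gface Q, down Q, dim1 Q = k & P = up Q].
  case: (pickP (fun Q => [&& gface Q, down Q, dim1 Q == k & P == up Q])).
    by move=> Q /and4P[gQ dQ /eqP Qk /eqP PQ]; exists Q.
  by move=> p0; rewrite /w big_pred0 ?eqxx.
exists w; split.
  move=> P /wP [Q [gQ dQ Qk ->]]; have [gU /andP[_ /eqP]] := upP Q gQ dQ.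
  by rewrite Qk => ->; split=> //; exists Q.
move=> Q gQ dQ Qk; have [gU fU] := upP Q gQ dQ.
rewrite /boundary (bigD1 (up Q)) /=; last by rewrite gface_X.
rewrite big1 ?addr0 => [|P /andP[/andP[PX fP] PQ]].
  rewrite /w (bigD1 Q) /=; last by rewrite gQ dQ Qk !eqxx.
  rewrite big1 ?addr0 => [|Q' /andP[/and4P[gQ' dQ' _ /eqP QQ'] Q'Q]].
    by rewrite mulrC divfK // epsK // gface_X.
  by rewrite QQ' in fU; rewrite (upE _ _ gQ' gQ dQ' dQ fU) eqxx in Q'Q.
case: (eqVneq (w P) 0) => [->|/wP [Q' [gQ' dQ' _ PE]]]; first by rewrite mulr0.
by rewrite PE in fP PQ; rewrite (upE _ _ gQ' gQ dQ' dQ fP) eqxx in PQ.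
Qed.

(** After the boundaries of [w1] and [w2] are subtracted, the cycle [z] lives on upper faces only.
    Its boundary at the lower partner of an upper face P then has z P as sole term, so z
    vanishes. *)
Lemma simplex_prod_strand_exact k c :
  (forall P, c P != 0 -> gface P /\ dim1 P = k) ->
  (forall Q, Q \in X -> (dim1 Q).+1 = k -> bd c Q = 0) ->
  exists2 c', forall P, c' P != 0 -> gface P /\ dim1 P = k.+1 &
    forall Q, Q \in X -> dim1 Q = k -> bd c' Q = c Q.
Proof.
move=> cG cZ.
have [w1 [w1G w1E]] : exists w,
    [/\ forall P, w P != 0 -> [/\ gface P, dim1 P = k.+1 &
          exists Q, [/\ gface Q, down1 Q & P = up1 Q]]
      & forall Q, gface Q -> down1 Q -> dim1 Q = k -> bd w Q = c Q].
  apply: clear => [Q gQ dQ|Q Q' /andP[Qp _] /andP[Q'p _]].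
    by split; [apply: gface_up1 | apply: facet_up1 => //; case/andP: gQ].
  exact: down1_facet_up1.
have [w2 [w2G w2E]] : exists w,
    [/\ forall P, w P != 0 -> [/\ gface P, dim1 P = k.+1 &
          exists Q, [/\ gface Q, down2 Q & P = up2 Q]]
      & forall Q, gface Q -> down2 Q -> dim1 Q = k -> bd w Q = c Q - bd w1 Q].
  apply: clear => [Q gQ dQ|Q Q' _ _]; last exact: down2_facet_up2.
  by split; [apply: gface_up2 | apply: facet_up2].
have bdD a1 a2 Q : bd (fun P => a1 P + a2 P) Q = bd a1 Q + bd a2 Q.
  by rewrite /boundary -big_split; apply: eq_bigr => P _; rewrite mulrDr.
have bdN a Q : bd (fun P => - a P) Q = - bd a Q.
  by rewrite /boundary -sumrN; apply: eq_bigr => P _; rewrite mulrN.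
pose z P := c P + - (bd w1 P + bd w2 P).
have bd_ng w Q : (forall P, w P != 0 -> gface P) -> Q \in X -> ~~ gface Q ->
    bd w Q = 0.
  move=> wG QX Qg; rewrite /boundary big1 // => P /andP[PX /andP[QP _]].
  case: (eqVneq (w P) 0) => [->|/wG gP]; first by rewrite mulr0.
  by rewrite (gface_sub gP (Xprod QX) QP) in Qg.
have w1g P : w1 P != 0 -> gface P by case/w1G.
have w2g P : w2 P != 0 -> gface P by case/w2G.
suff z0 Q : Q \in X -> dim1 Q = k -> z Q = 0.
  exists (fun P => w1 P + w2 P) => [P|Q QX Qk].
    case: (eqVneq (w1 P) 0) => [->|/w1G [gP dP _] _]; last by [].
    by rewrite add0r => /w2G [].
  by rewrite bdD; apply/esym/eqP; rewrite -subr_eq0; apply/eqP/z0.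
move: Q.
have zg Q : Q \in X -> dim1 Q = k -> z Q != 0 ->
    [/\ gface Q, ~~ down1 Q & ~~ down2 Q].
  move=> QX Qk zQ; have gQ : gface Q.
    apply: contraNT zQ => Qg; rewrite /z !bd_ng // addr0 oppr0 addr0.
    by apply: contraNT Qg => /cG [].
  split=> //; apply: contraNN zQ => dQ; rewrite /z.
    (* Faces carrying [w2] have [i0] as only row, hence no nonempty facet without [i0]: the second
       clearing does not disturb the first. *)
    rewrite w1E // (_ : bd w2 Q = 0) ?addr0 ?subrr //.
    rewrite /boundary big1 // => P /andP[_ /andP[QP _]].
    case: (eqVneq (w2 P) 0) => [->|/w2G [_ _ [R [_ _ PR]]]]; first by rewrite mulr0.
    have := rowsS QP; rewrite PR rows_up2 => sQ; case/andP: dQ => Q0.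
    have /set0Pn [x xQ] : rows Q != set0 by rewrite rows_eq0.
    by have /subsetP/(_ x xQ) := sQ; rewrite inE => /eqP <-; rewrite xQ.
  by rewrite (w2E Q gQ dQ Qk) [bd w1 Q + _]addrC subrK subrr.
have bdz Q : Q \in X -> (dim1 Q).+1 = k -> bd z Q = 0.
  move=> QX Qk; rewrite /z bdD bdN bdD cZ // !boundary_boundary ?addr0 ?oppr0 ?addr0 //.
    by move=> P /w2g /gface_X.
  by move=> P /w1g /gface_X.
have single P Q : P \in X -> dim1 P = k -> Q \in X -> facet Q P ->
    (forall P', P' \in X -> dim1 P' = k -> z P' != 0 -> facet Q P' -> P' = P) ->
    z P = 0.
  move=> PX Pk QX QP only.
  have Qk : (dim1 Q).+1 = k by case/andP: QP => _ /eqP <-.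
  have := bdz Q QX Qk; rewrite /boundary (bigD1 P) /= ?PX //.
  rewrite big1 ?addr0 => [/eqP|P' /andP[/andP[P'X QP'] P'P]].
    by rewrite mulf_eq0 (negPf (epsK PX QX QP)) => /eqP.
  case: (eqVneq (z P') 0) => [->|zP']; first by rewrite mulr0.
  rewrite (only P') ?eqxx // in P'P.
  by case/andP: QP' => _ /eqP ->.
have i0z P : P \in X -> dim1 P = k -> z P != 0 -> i0 \in rows P.
  move=> PX Pk zP; have [gP d1 d2] := zg P PX Pk zP.
  case: (eqVneq P set0) => [P0|P0].
    move: d2; rewrite /down2 P0 cols_set0 inE andbT eq_sym setX_eq0 eqxx orbT.
    by [].
  by move: d1; rewrite /down1 P0 negbK.
have z1 P : P \in X -> dim1 P = k -> rows P != [set i0] -> z P = 0.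
  move=> PX Pk Pi0; apply/eqP; apply: contraT => zP.
  have i0P := i0z P PX Pk zP; have [gP _ _] := zg P PX Pk zP.
  have PE : P = setX (rows P) (cols P) by apply/simplex_prodP/Xprod.
  have P0 : P != set0 by rewrite -rows_eq0; apply/set0Pn; exists i0.
  have rP : rows P :\ i0 != set0.
    apply: contra Pi0 => /eqP r0; apply/eqP.
    by rewrite -(setD1K i0P) r0 setU0.
  pose Q := setX (rows P :\ i0) (cols P).
  have rQ : rows Q = rows P :\ i0 by rewrite rowsX // cols_eq0.
  have cQ : cols Q = cols P by rewrite colsX.
  have Q0 : Q != set0 by rewrite -rows_eq0 rQ.
  have QP : Q \subset P.
    by rewrite PE; apply/subsetP => v; rewrite !inE => /andP[/andP[_ ->] ->].
  have gQ : gface Q by apply: gface_sub gP _ QP; apply: setX_simplex_prod.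
  have fQP : facet Q P.
    rewrite /is_facet QP -eqSS -!card_face // rQ cQ -addSn.
    by rewrite (cardsD1 i0 (rows P)) i0P add1n eqxx.
  suff zP0 : z P = 0 by rewrite zP0 eqxx in zP.
  apply: (single P Q) => //; first exact: gface_X.
  move=> P' P'X P'k zP' /andP[QP' /eqP dP'].
  have i0P' := i0z P' P'X P'k zP'.
  have P'0 : P' != set0 by rewrite -rows_eq0; apply/set0Pn; exists i0.
  have rP' : rows P \subset rows P'.
    rewrite -(setD1K i0P) subUset sub1set i0P' -rQ /=.
    exact: rowsS.
  have cP' : cols P \subset cols P' by rewrite -cQ; apply: colsS.
  have [|rE cE] := subset_card2 rP' cP'; first by rewrite !card_face // Pk P'k.
  by apply: simplex_prod_inj => //; apply: Xprod.
(* Only faces with the single row [i0] are left; the argument is repeated with the column [j0] in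
   place of the row [i0]. *)
move=> P PX Pk; apply/eqP; apply: contraT => zP.
have rP : rows P = [set i0] by apply/eqP; apply: contraNT zP => /z1 ->.
have [gP _ d2] := zg P PX Pk zP.
have PE : P = setX [set i0] (cols P) by rewrite -rP; apply/simplex_prodP/Xprod.
have j0P : j0 \in cols P by move: d2; rewrite /down2 -PE eqxx negbK.
have P0 : P != set0 by rewrite -rows_eq0 rP.
pose Q := setX [set i0] (cols P :\ j0).
have cQ : cols Q = cols P :\ j0 by rewrite colsX.
have dQ : down2 Q by rewrite /down2 cQ eqxx setD11.
have QP : Q \subset P.
  by rewrite PE; apply/subsetP => v; rewrite !inE => /andP[-> /andP[_ ->]].
have gQ : gface Q by apply: gface_sub gP _ QP; apply: setX_simplex_prod.
have UE : up2 Q = P by rewrite /up2 cQ setD1K.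
have fQP : facet Q P by rewrite -UE; apply: facet_up2.
suff zP0 : z P = 0 by rewrite zP0 eqxx in zP.
apply: (single P Q) => //; first exact: gface_X.
move=> P' P'X P'k zP' /andP[QP' /eqP dP'].
have rP' : rows P' = [set i0] by apply/eqP; apply: contraNT zP' => /z1 ->.
have [gP' _ d2'] := zg P' P'X P'k zP'.
have P'E : P' = setX [set i0] (cols P') by rewrite -rP'; apply/simplex_prodP/Xprod.
have j0P' : j0 \in cols P' by move: d2'; rewrite /down2 -P'E eqxx negbK.
have P'0 : P' != set0 by rewrite -rows_eq0 rP'.
have cP' : cols P \subset cols P'.
  rewrite -(setD1K j0P) subUset sub1set j0P' -cQ /=.
  exact: colsS.
have [||_ cE] := @subset_card2 _ _ (rows P) (rows P') _ _ _ cP'.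
- by rewrite rP rP'.
- by rewrite !card_face // Pk P'k.
by rewrite P'E cE -PE.
Qed.

End Strand.

End SimplexProduct.

(** * An incidence function *)

Section JoinEncoding.

Variables (n m : nat).
Notation V := ('I_n * 'I_m)%type.
Notation dim1 := (@simplex_prod_dim1 n m).
Notation facet := (is_facet dim1).
Implicit Types (P Q R : {set V}) (U W : {set 'I_(n + m)}).

(* Nonempty faces A x B are encoded by the disjoint union of A and B, a face  *)
(* of the simplex on n + m vertices, which makes the signs simplicial.        *)
Definition join_set (A : {set 'I_n}) (B : {set 'I_m}) : {set 'I_(n + m)} :=
  [set u | match split u with inl i => i \in A | inr x => x \in B end].

Definition join_rows U : {set 'I_n} := [set i | lshift m i \in U].
Definition join_cols U : {set 'I_m} := [set x | rshift n x \in U].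

Definition face_join P := join_set (rows P) (cols P).
Definition join_face U : {set V} := setX (join_rows U) (join_cols U).

Lemma in_join_l (A : {set 'I_n}) (B : {set 'I_m}) i : (lshift m i \in join_set A B) = (i \in A).
Proof. by rewrite inE -[lshift _ _]/(unsplit (inl i)) unsplitK. Qed.

Lemma in_join_r (A : {set 'I_n}) (B : {set 'I_m}) x : (rshift n x \in join_set A B) = (x \in B).
Proof. by rewrite inE -[rshift _ _]/(unsplit (inr x)) unsplitK. Qed.

Lemma join_setK U : join_set (join_rows U) (join_cols U) = U.
Proof. by apply/setP => u; case: (split_ordP u) => i ->;
  rewrite ?in_join_l ?in_join_r inE. Qed.

Lemma card_join (A : {set 'I_n}) (B : {set 'I_m}) : #|join_set A B| = (#|A| + #|B|)%N.
Proof.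
rewrite -!sum1_card big_mkcond big_split_ord /= -!big_mkcond /=.
by congr (_ + _)%N; apply: eq_bigl => i; rewrite (in_join_l, in_join_r).
Qed.

Lemma join_setS (A A' : {set 'I_n}) (B B' : {set 'I_m}) : A \subset A' -> B \subset B' ->
  join_set A B \subset join_set A' B'.
Proof.
move=> /subsetP AA /subsetP BB; apply/subsetP => u.
by case: (split_ordP u) => i ->; rewrite ?in_join_l ?in_join_r; auto.
Qed.

Lemma face_joinK P : P \in simplex_prod n m -> join_face (face_join P) = P.
Proof.
move=> /simplex_prodP PE; rewrite [RHS]PE /join_face; congr setX.
  by apply/setP => i; rewrite inE in_join_l.
by apply/setP => i; rewrite inE in_join_r.
Qed.

Lemma face_joinS P Q : P \subset Q -> face_join P \subset face_join Q.
Proof. by move=> PQ; apply: join_setS; [apply: rowsS|apply: colsS]. Qed.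

Lemma join_faceS U W : U \subset W -> join_face U \subset join_face W.
Proof.
move=> /subsetP UW; apply/subsetP => v; rewrite !inE => /andP[h1 h2].
by rewrite !UW.
Qed.

Lemma card_face_join P : P != set0 -> #|face_join P| = (dim1 P).+1.
Proof. by move=> P0; rewrite card_join card_face. Qed.

Lemma join_faceK U : join_rows U != set0 -> join_cols U != set0 ->
  face_join (join_face U) = U.
Proof.
by move=> r0 c0; rewrite /face_join /join_face rowsX // colsX // join_setK.
Qed.

Lemma join_face_neq0 U : join_rows U != set0 -> join_cols U != set0 ->
  join_face U != set0.
Proof. by move=> r0 c0; rewrite setX_eq0 negb_or r0. Qed.

Lemma join_face_simplex_prod U : join_face U \in simplex_prod n m.
Proof. exact: setX_simplex_prod. Qed.

(** The simplicial sign of the join, except over the empty face: a vertex of the product is encoded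
    by two points, so the empty face has no simplicial incidence with it and 1 is used. *)
Definition join_sign P Q : int :=
  if Q == set0 then 1 else
  if [pick u in face_join P :\: face_join Q] is Some u
  then (-1) ^+ pos u (face_join Q) else 1.

Lemma join_signE P Q u : Q != set0 -> u \notin face_join Q ->
  face_join P = u |: face_join Q -> join_sign P Q = (-1) ^+ pos u (face_join Q).
Proof.
move=> Q0 uQ PE; rewrite /join_sign (negPf Q0) PE.
have -> : (u |: face_join Q) :\: face_join Q = [set u].
  apply/setP => x; rewrite in_setD in_setU1 in_set1.
  by case: (x =P u) => [->|_]; [rewrite uQ | case: (x \in _)].
case: pickP => [x|/(_ u)]; last by rewrite set11.
by rewrite inE => /eqP ->.
Qed.

Variables (X : {set {set V}}) (good : pred V).
Hypothesis XE : forall P,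
  (P \in X) = (P \in simplex_prod n m) && [forall v in P, good v].

Let X_sub P Q : P \in X -> Q \in simplex_prod n m -> Q \subset P -> Q \in X.
Proof.
rewrite !XE => /andP[_ /forall_inP gP] -> /subsetP QP.
by apply/forall_inP => v /QP /gP.
Qed.

(* The faces strictly between P and R correspond to the two ways of inserting *)
(* one of the two missing vertices; for empty R one of the factors of P is a  *)
(* point and U is that point.                                                 *)
Let join_sign_pair P U u v (C : pred {set V}) (f : {set V} -> int) (s : int) :
  P \in X -> u != v -> u \notin U -> v \notin U ->
  face_join P = u |: (v |: U) ->
  (forall Q, Q \in X -> C Q -> [/\ Q \subset P, U \subset face_join Q &
     #|face_join Q| = #|U|.+1]) ->
  (forall x, x \in [set u; v] -> [/\ join_rows (x |: U) != set0,
     join_cols (x |: U) != set0, C (join_face (x |: U)) &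
     f (join_face (x |: U)) = s * (-1) ^+ pos x U]) ->
  \sum_(Q in X | C Q) join_sign P Q * f Q = 0.
Proof.
move=> PX uv uU vU PE CP Cx.
have Pp : P \in simplex_prod n m by move: PX; rewrite XE => /andP[].
have [ru cu Cu fu] := Cx u (set21 u v); have [rv cv Cv fv] := Cx v (set22 u v).
set Qu := join_face (u |: U) in Cu fu *; set Qv := join_face (v |: U) in Cv fv *.
have Tu : face_join Qu = u |: U by apply: join_faceK.
have Tv : face_join Qv = v |: U by apply: join_faceK.
have QuX : Qu \in X.
  apply: (X_sub PX); first exact: join_face_simplex_prod.
  by rewrite -(face_joinK Pp) PE; apply: join_faceS; apply: setUS; apply: subsetUr.
have QvX : Qv \in X.
  apply: (X_sub PX); first exact: join_face_simplex_prod.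
  by rewrite -(face_joinK Pp) PE; apply: join_faceS; apply: subsetUr.
have uvU : u \notin v |: U by rewrite !inE negb_or uv.
have vuU : v \notin u |: U by rewrite !inE negb_or eq_sym uv.
have Quv : Qv != Qu.
  by apply: contraNneq uvU => E; rewrite -Tv E Tu setU11.
rewrite (bigD1 Qu) ?QuX //= (bigD1 Qv) ?QvX ?Cv //= big1 ?addr0; last first.
  move=> Q /andP[/andP[/andP[QX CQ] QQu] QQv].
  have [QP UQ cQ] := CP Q QX CQ.
  have Qp : Q \in simplex_prod n m by move: QX; rewrite XE => /andP[].
  have : #|face_join Q :\: U| == 1%N.
    by rewrite cardsD (setIidPr UQ) cQ subSnn.
  case/cards1P => x xE.
  have QE : face_join Q = x |: U.
    by rewrite -(setID (face_join Q) U) (setIidPr UQ) xE setUC.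
  have : x \in face_join P :\: U.
    have /setDP [xQ xU] : x \in face_join Q :\: U by rewrite xE set11.
    by rewrite inE xU (subsetP (face_joinS QP)).
  rewrite PE !inE andb_orr => /orP[/andP[_ /eqP xu]|].
    by rewrite -(face_joinK Qp) QE xu eqxx in QQu.
  case/andP=> xU /predU1P [xv|]; last by rewrite (negPf xU).
  by rewrite -(face_joinK Qp) QE xv eqxx in QQv.
have Qu0 : Qu != set0 by apply: join_face_neq0.
have Qv0 : Qv != set0 by apply: join_face_neq0.
rewrite (@join_signE P Qu v) ?Tu //; last by rewrite PE setUCA.
rewrite (@join_signE P Qv u) ?Tv //.
rewrite fu fv !pos_setU1 //; case: (ltngtP u v) => [_|_|/val_inj uE].
- by rewrite /= add0n add1n exprS; ring.
- by rewrite /= add0n add1n exprS; ring.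
- by rewrite uE eqxx in uv.
Qed.

Let join_vertex i x : join_face [set lshift m i; rshift n x] = setX [set i] [set x].
Proof.
congr setX; apply/setP => y; rewrite !inE.
  by rewrite eq_lrshift orbF eq_lshift.
by rewrite eq_rlshift eq_rshift.
Qed.

Lemma join_sign_incidence : incidence_function X dim1 join_sign.
Proof.
split.
  move=> P Q _ _ _; rewrite /join_sign; case: ifP => _; first by left.
  case: pickP => [u _|_]; last by left.
  by rewrite -signr_odd; case: odd; [right|left].
move=> P R PX RX.
case: (pickP (fun Q => (Q \in X) && (facet Q P && facet R Q))); last first.
  by move=> C0; rewrite big_pred0.
move=> Q0 /andP[Q0X /andP[/andP[Q0P /eqP dP] /andP[RQ0 /eqP dQ0]]].
have Pp : P \in simplex_prod n m by move: PX; rewrite XE => /andP[].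
have Rp : R \in simplex_prod n m by move: RX; rewrite XE => /andP[].
have Qp Q : Q \in X -> Q \in simplex_prod n m by rewrite XE => /andP[].
have P0 : P != set0 by apply: contra_eqN dP => /eqP ->; rewrite dim1_set0.
have Cn0 Q : facet R Q -> Q != set0.
  by move=> /andP[_ /eqP dQ]; apply: contra_eqN dQ => /eqP ->; rewrite dim1_set0.
case: (eqVneq R set0) => [RE|R0]; last first.
  have RP : face_join R \subset face_join P.
    by apply: face_joinS; apply: subset_trans RQ0 Q0P.
  have : #|face_join P :\: face_join R| == 2.
    rewrite cardsD (setIidPr RP) !card_face_join // dP dQ0.
    by rewrite -addn2 addKn.
  case/cards2P => u [v [uv uvE]].
  have [uU vU] : u \notin face_join R /\ v \notin face_join R.
    have /setDP[_ ->] : u \in face_join P :\: face_join R by rewrite uvE set21.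
    by have /setDP[_ ->] : v \in face_join P :\: face_join R by rewrite uvE set22.
  have PE : face_join P = u |: (v |: face_join R).
    by rewrite -(setID (face_join P) (face_join R)) (setIidPr RP) uvE setUC setUA.
  have rR : rows R != set0 by rewrite rows_eq0.
  have cR : cols R != set0 by rewrite cols_eq0.
  have rU x : join_rows (x |: face_join R) != set0.
    by have /set0Pn[i iR] := rR; apply/set0Pn; exists i; rewrite inE in_setU1 in_join_l iR orbT.
  have cU x : join_cols (x |: face_join R) != set0.
    by have /set0Pn[i iR] := cR; apply/set0Pn; exists i; rewrite inE in_setU1 in_join_r iR orbT.
  apply: (@join_sign_pair P (face_join R) u v _ _ 1) => //.
    move=> Q QX /andP[/andP[QP _] /andP[RQ /eqP dQ]]; split=> //.
      exact: face_joinS.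
    by rewrite !card_face_join // ?dQ //; apply: Cn0; rewrite /is_facet RQ dQ eqxx.
  move=> x xuv; have xU : x \notin face_join R by case/set2P: xuv => ->.
  have Qx0 : join_face (x |: face_join R) != set0 by apply: join_face_neq0.
  have dx : dim1 (join_face (x |: face_join R)) = (dim1 R).+1.
    apply/eqP; rewrite -eqSS -card_face_join // join_faceK //.
    by rewrite cardsU1 xU card_face_join.
  split=> //; last first.
    by rewrite mul1r (@join_signE _ R x) // join_faceK.
  apply/andP; split; apply/andP; split.
  - rewrite -(face_joinK Pp) PE; apply: join_faceS.
    by case/set2P: xuv => ->; [apply: setUS; apply: subsetUr|apply: subsetUr].
  - by rewrite dP dQ0 dx.
  - by rewrite -{1}(face_joinK Rp); apply: join_faceS; apply: subsetUr.
  - by rewrite dx.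
subst R.
have f1 Q : join_sign Q set0 = 1 by rewrite /join_sign eqxx.
have := card_face P0; rewrite dP dQ0 dim1_set0 => c3.
have r1 : (0 < #|rows P|)%N by rewrite card_gt0 rows_eq0.
have c1 : (0 < #|cols P|)%N by rewrite card_gt0 cols_eq0.
have CQ Q : facet Q P && facet set0 Q -> Q \subset P /\ (#|rows Q| = 1 /\ #|cols Q| = 1)%N.
  move=> /andP[/andP[QP _] fQ]; split=> //; have Qn0 := Cn0 Q fQ.
  have := card_face Qn0; case/andP: fQ => _ /eqP ->; rewrite dim1_set0.
  have : (0 < #|rows Q|)%N by rewrite card_gt0 rows_eq0.
  have : (0 < #|cols Q|)%N by rewrite card_gt0 cols_eq0.
  by move: #|rows Q| #|cols Q| => x y; clear; lia.
have CX i x : i \in rows P -> x \in cols P ->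
    facet (setX [set i] [set x]) P && facet set0 (setX [set i] [set x]).
  move=> iP xP; have d1 : dim1 (setX [set i] [set x]) = 1%N.
    by rewrite dim1E rowsX ?colsX -?card_gt0 ?cards1.
  rewrite /is_facet d1 dP dQ0 dim1_set0 sub0set !andbT.
  have /simplex_prodP -> := Pp; apply/subsetP => v.
  by rewrite !inE => /andP[/eqP -> /eqP ->]; rewrite iP.
have n0 k (T : {set 'I_k}) y : y \in T -> T != set0.
  by move=> yT; apply/set0Pn; exists y.
(* Over the empty face P is an edge. Rows precede columns in the join, so the shared point lies
   after or before both moving points; this makes the sign [s] equal to 1 or -1. *)
have [cP|rP] : (#|cols P| == 1%N /\ #|rows P| == 2) \/ (#|rows P| == 1%N /\ #|cols P| == 2).
  by move: c3 r1 c1; move: #|rows P| #|cols P| => x y; clear; lia.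
  have [/cards1P [b bE] /cards2P [a [a' [aa' aE]]]] := cP.
  apply: (@join_sign_pair P [set rshift n b] (lshift m a) (lshift m a') _ _ 1) => //.
  - by rewrite inE eq_lrshift.
  - by rewrite inE eq_lrshift.
  - apply/setP => y; case: (split_ordP y) => z ->.
      by rewrite in_join_l aE !inE !eq_lshift eq_lrshift orbF.
    by rewrite in_join_r bE !inE !eq_rlshift eq_rshift.
  - move=> Q QX /CQ [QP [rQ cQ]]; split=> //; last by rewrite card_join rQ cQ cards1.
    rewrite sub1set in_join_r; have /eqP/cards1P [y yE] := cQ.
    have := colsS QP; rewrite yE bE sub1set inE => /eqP ->.
    by rewrite inE.
  - move=> x xaa; have [i xE iP] : exists2 i, x = lshift m i & i \in rows P.
      by case/set2P: xaa => ->; [exists a|exists a']; rewrite // aE !inE eqxx ?orbT.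
    rewrite xE join_vertex f1 mul1r; split.
    + by apply: (n0 _ _ i); rewrite !inE eqxx.
    + by apply: (n0 _ _ b); rewrite !inE eqxx orbT.
    + by apply: CX; rewrite // bE inE.
    + rewrite (_ : pos _ _ = 0%N) //; apply/eqP; rewrite cards_eq0; apply/eqP.
      apply/setP => y; rewrite !inE; case: eqP => //= ->.
      by rewrite ltnNge /= ltnW // ltn_addr.
have [/cards1P [a aE] /cards2P [b [b' [bb' bE]]]] := rP.
apply: (@join_sign_pair P [set lshift m a] (rshift n b) (rshift n b') _ _ (-1)) => //.
- by rewrite eq_rshift.
- by rewrite inE eq_rlshift.
- by rewrite inE eq_rlshift.
- apply/setP => y; case: (split_ordP y) => z ->.
    by rewrite in_join_l aE !inE !eq_lshift !eq_lrshift.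
  by rewrite in_join_r bE !inE !eq_rlshift !eq_rshift orbF.
- move=> Q QX /CQ [QP [rQ cQ]]; split=> //; last by rewrite card_join rQ cQ cards1.
  rewrite sub1set in_join_l; have /eqP/cards1P [y yE] := rQ.
  have := rowsS QP; rewrite yE aE sub1set inE => /eqP ->.
  by rewrite inE.
- move=> x xbb; have [i xE iP] : exists2 i, x = rshift n i & i \in cols P.
    by case/set2P: xbb => ->; [exists b|exists b']; rewrite // bE !inE eqxx ?orbT.
  rewrite xE setUC join_vertex f1; split.
  + by apply: (n0 _ _ a); rewrite !inE eqxx.
  + by apply: (n0 _ _ i); rewrite !inE eqxx orbT.
  + by apply: CX; rewrite // aE inE.
  + rewrite (_ : pos _ _ = 1%N) //.
    rewrite -(cards1 (lshift m a)); congr #|pred_of_set _|.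
    apply/setP => y; rewrite !inE; case: eqP => //= ->.
    by rewrite /= ltn_addr ?ltn_ord.
Qed.

End JoinEncoding.

(** * Counting faces *)

Section FaceCount.

Variables (n m : nat) (lam mu : 'I_n -> nat).
Hypothesis lam_le : forall i : 'I_n, (lam i <= m)%N.
Hypothesis lam_anti : forall i j : 'I_n, (i <= j)%N -> (lam j <= lam i)%N.
Hypothesis mu_mono : forall i j : 'I_n, (i <= j)%N -> (mu i <= mu j)%N.

Notation V := ('I_n * 'I_m)%type.
Notation dim1 := (@simplex_prod_dim1 n m).
Implicit Types (P : {set V}) (U : {set 'I_(n + m)}).

Definition ferrers_cell (v : V) := (mu v.1 <= v.2 < lam v.1)%N.

Variable X : {set {set V}}.
Hypothesis XE : forall P,
  (P \in X) = (P \in simplex_prod n m) && [forall v in P, ferrers_cell v].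

Definition top_row P (j : 'I_n) := (j \in rows P) && [forall i in rows P, (i <= j)%N].

Lemma top_row_ex P : P != set0 -> exists2 j, top_row P j &
  forall j', top_row P j' -> j' = j.
Proof.
rewrite -rows_eq0 => /set0Pn [i iP].
have [j jP jmax] := arg_maxnP (fun i : 'I_n => i : nat) iP.
exists j; first by apply/andP; split=> //; apply/forall_inP => x /jmax.
move=> j' /andP[j'P /forall_inP j'max]; apply/val_inj/eqP.
by rewrite eqn_leq j'max // andbT; apply: jmax.
Qed.

Let Lj (j : 'I_n) : {set 'I_(n + m)} :=
  join_set [set i : 'I_n | (i < j)%N] (set0 : {set 'I_m}).
Let Wj (j : 'I_n) : {set 'I_(n + m)} :=
  join_set [set i : 'I_n | (i < j)%N] [set x : 'I_m | mu j <= x < lam j]%N.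

Let card_lt (j : 'I_n) : #|[set i : 'I_n | (i < j)%N]| = j.
Proof.
rewrite -[RHS]subn0 -(@card_interval n 0 j (ltnW (ltn_ord j))).
by apply: eq_card => i; rewrite !inE.
Qed.

Let LWj j : Lj j \subset Wj j.
Proof. by apply: join_setS; rewrite ?sub0set. Qed.

Let card_Wj j : #|Wj j| = (lam j - mu j + j)%N.
Proof. by rewrite card_join card_lt card_interval // addnC. Qed.

Let card_Lj j : #|Lj j| = j.
Proof. by rewrite card_join card_lt cards0 addn0. Qed.

Let draws U k := [set W : {set 'I_(n + m)} | W \subset U & #|W| == k].

(** Removing j from the encoding leaves a k-subset of [Wj j], the rows below j and the columns of
    row j. By monotonicity every such subset gives a face, except those without a column, which are
    the k-subsets of [Lj j]. *)
Let card_top k (j : 'I_n) : (0 < k)%N ->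
  (#|[set P in faces_of_dim1 X dim1 k | top_row P j]| + 'C(j, k) =
   'C(lam j - mu j + j, k))%N.
Proof.
move=> k0; pose l := lshift m j.
have lW : l \notin Wj j by rewrite in_join_l inE ltnn.
have nz U : U \in draws (Wj j) k :\: draws (Lj j) k ->
    [/\ join_rows (l |: U) != set0, join_cols (l |: U) != set0, l \notin U,
        U \subset Wj j & #|U| = k].
  rewrite in_setD !inE => /andP[UL /andP[UW /eqP Uk]].
  have lU : l \notin U by apply: contra lW; apply: (subsetP UW).
  have /subsetPn [u uU uL] : ~~ (U \subset Lj j) by rewrite Uk eqxx andbT in UL.
  have [x xE] : exists x, u = rshift n x.
    case: (split_ordP u) uL uU => y ->; last by exists y.
    by rewrite in_join_l => yL /(subsetP UW); rewrite in_join_l (negPf yL).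
  split=> //.
    by apply/set0Pn; exists j; rewrite inE setU11.
  by apply/set0Pn; exists x; rewrite inE in_setU1 -xE uU orbT.
have -> : [set P in faces_of_dim1 X dim1 k | top_row P j] =
    [set join_face (l |: U) | U in draws (Wj j) k :\: draws (Lj j) k].
  apply/setP => P; apply/idP/imsetP => [|[U]].
    rewrite !inE XE => /andP[/andP[/andP[Pp /forall_inP Pg] /eqP Pk] /andP[jP /forall_inP Pj]].
    have P0 : P != set0 by rewrite -rows_eq0; apply/set0Pn; exists j.
    have lP : l \in face_join P by rewrite in_join_l.
    exists (face_join P :\ l); last by rewrite setD1K // face_joinK.
    have cU : #|face_join P :\ l| = k.
      by apply/eqP; rewrite -eqSS -Pk -card_face_join // (cardsD1 l (face_join P)) lP.
    rewrite !inE cU eqxx !andbT; apply/andP; split.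
      have /set0Pn [x xP] : cols P != set0 by rewrite cols_eq0.
      apply/negP => /subsetP /(_ (rshift n x)).
      by rewrite in_setD1 eq_rlshift !in_join_r inE xP => /(_ isT).
    apply/subsetP => u; rewrite in_setD1; case: (split_ordP u) => y ->.
      rewrite eq_lshift !in_join_l inE => /andP[yj yP].
      by rewrite ltn_neqAle Pj // -(inj_eq val_inj) in yj *; rewrite yj.
    rewrite !in_join_r inE => /andP[_ yP].
    apply: (Pg (j, y)); have /simplex_prodP -> := Pp.
    by rewrite !inE /= jP.
  move=> /nz [rU cU lU UW Uk] ->{P}.
  set P := join_face _; have PT : face_join P = l |: U by apply: join_faceK.
  have P0 : P != set0 by apply: join_face_neq0.
  have rP y : (y \in rows P) = (y == j) || (lshift m y \in U).
    by rewrite rowsX // inE in_setU1 eq_lshift.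
  have UWl y : lshift m y \in U -> (y < j)%N.
    by move=> /(subsetP UW); rewrite in_join_l inE.
  rewrite inE [P \in _]inE /top_row rP eqxx /= -andbA; apply/and3P; split.
  - rewrite XE join_face_simplex_prod; apply/forall_inP => -[i y].
    rewrite !inE /= eq_lshift eq_rlshift /= => /andP[iP yP].
    have ij : (i <= j)%N by case/predU1P: iP => [->//|/UWl/ltnW].
    have := subsetP UW _ yP; rewrite in_join_r inE /ferrers_cell /=.
    by have := mu_mono ij; have := lam_anti ij; lia.
  - by rewrite -eqSS -card_face_join // PT cardsU1 lU Uk.
  - apply/forall_inP => y; rewrite rP => /predU1P[->//|/UWl /ltnW //].
rewrite card_in_imset; last first.
  move=> U U' /nz [rU cU lU _ _] /nz [rU' cU' lU' _ _] /(congr1 (@face_join n m)).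
  rewrite !join_faceK // => UU'.
  by rewrite -(setU1K lU) UU' setU1K.
rewrite cardsD (setIidPr _); last first.
  apply/subsetP => U; rewrite !inE => /andP[UL ->]; rewrite andbT.
  exact: subset_trans UL (LWj j).
rewrite !cards_draws card_Wj card_Lj subnK //.
by rewrite leq_bin2l // leq_addl.
Qed.

Lemma hockey_stick k : (\sum_(j < n) 'C(j, k) = 'C(n, k.+1))%N.
Proof.
elim: (n) => [|l IHl]; first by rewrite big_ord0.
by rewrite big_ord_recr /= IHl binS addnC.
Qed.

(** The excluded subsets of all rows add up, by the hockey-stick identity, to the subtracted
    binomial. *)
Lemma card_ferrers_faces k : (0 < k)%N ->
  (#|faces_of_dim1 X dim1 k|)%:Z =
  (\sum_(j < n) 'C(lam j - mu j + j, k))%:Z - 'C(n, k.+1)%:Z.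
Proof.
move=> k0; apply/eqP; rewrite eq_sym subr_eq -PoszD eqz_nat; apply/eqP.
rewrite -hockey_stick -(eq_bigr _ (fun j _ => card_top j k0)) big_split /=.
congr (_ + _)%N; rewrite -[RHS]sum1_card.
transitivity (\sum_(j < n) \sum_(P in faces_of_dim1 X dim1 k | top_row P j) 1)%N.
  by apply: eq_bigr => j _; rewrite -sum1_card; apply: eq_bigl => P; rewrite inE.
rewrite (exchange_big_dep (mem (faces_of_dim1 X dim1 k))) /=; last first.
  by move=> j P _ /andP[].
apply: eq_bigr => P Pf.
have P0 : P != set0.
  apply: contraTneq Pf => ->; rewrite inE dim1_set0 eq_sym.
  by rewrite eqn0Ngt k0 andbF.
have [j tj ju] := top_row_ex P0; rewrite (big_pred1 j) // => i.
by rewrite Pf /=; apply/idP/eqP => [/ju|->].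
Qed.

End FaceCount.

(** * Resolutions of specialized Ferrers ideals *)

Section ShiftedResolution.

Variables (K : fieldType) (m : nat) (A : zmodType) (wt : 'X_{1..m} -> A).
Notation S := {mpoly K[m]}.

Definition shift_complex (F : graded_complex K m A) : graded_complex K m A :=
  @GradedComplex K m A (fun k => grank F k.+1) (fun k i => gshift i)
    (fun k => gdif F k.+1).

(** Regularity concerns I while the cellular complex resolves S / I: the free module of rank one in
    degree 0 is dropped, and the first differential becomes the augmentation. *)
Lemma shift_resolution (I : S -> Prop) (F : graded_complex K m A) :
  grank F 0 = 1%N -> (forall i : 'I_(grank F 0), gshift i = 0) ->
  @minimal_free_resolution K m A wt (fun _ => True) I F (const_mx 1) ->
  @minimal_free_resolution K m A wt I (fun p => p = 0) (shift_complex F)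
    (gdif F 0 *m const_mx 1).
Proof.
move=> r1 s0 [[homF augh [_ surj] ex0 ex] minF]; split; last by move=> k; apply: minF.
have augE (v : 'rV[S]_(grank F 0)) i : (v *m const_mx 1 : 'M_1) 0 0 = v 0 i.
  rewrite mxE (bigD1 i) //= mxE mulr1 big1 ?addr0 // => j /negP[].
  by move: i j; rewrite r1 => i j; rewrite [i]ord1 [j]ord1.
have i0 : 'I_(grank F 0) by rewrite r1; exact: ord0.
split.
- by move=> k; apply: homF.
- move=> i t; rewrite mxE => /msupp_sum_le /flatten_mapP [j _].
  by rewrite mxE mulr1 => /homF; rewrite s0 addr0.
- split=> [v|p Ip].
    by rewrite mulmxA; case: (ex0 (v *m gdif F 0)) => _; apply; exists v.
  have [w wE] : exists w : 'rV_(grank F 1), const_mx p = w *m gdif F 0.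
    have [h _] := ex0 (const_mx p); apply: h.
    by rewrite (augE _ i0) mxE.
  by exists w; rewrite mulmxA -wE (augE _ i0) mxE subrr.
- move=> v; rewrite mulmxA (augE _ i0) -ex; split=> [v0|->]; last by rewrite mxE.
  apply/rowP => j; rewrite -(augE _ j) (augE _ i0) v0.
  by rewrite mxE.
- by move=> k v; apply: ex.
Qed.

End ShiftedResolution.

Section FerrersResolution.

Variables (K : fieldType) (n m : nat) (hnm : (n <= m)%N).
Variables (lam mu : 'I_n -> nat).
Hypothesis n_gt0 : (0 < n)%N.
Hypothesis mu_ge : forall i : 'I_n, (i <= mu i)%N.
Hypothesis mu_lam : forall i j : 'I_n, (mu i < lam j)%N.
Hypothesis lam_le : forall i : 'I_n, (lam i <= m)%N.
Hypothesis lam_anti : forall i j : 'I_n, (i <= j)%N -> (lam j <= lam i)%N.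
Hypothesis mu_mono : forall i j : 'I_n, (i <= j)%N -> (mu i <= mu j)%N.

Notation S := {mpoly K[m]}.
Notation V := ('I_n * 'I_m)%type.
Notation w := (widen_ord hnm).
Notation X := (ferrers_complex K m lam mu).
Notation dim1 := (@simplex_prod_dim1 n m).
Notation label := (@spec_ferrers_label n m hnm).
Notation flabel := (face_label label).
Notation spec := (spec_ferrers_ideal (K := K) hnm lam mu).
Notation cell := (ferrers_cell lam mu).
Notation D := (ferrers_mon hnm lam mu).
Implicit Types (P Q : {set V}).

(** Replaces the propositional membership that defines [ferrers_complex] by a boolean test; a
    generator dividing a label of the same degree equals it. *)
Lemma ferrers_idealX (v : V) :
  ferrers_ideal lam mu ('X_[K, ferrers_label v]) <-> cell v.
Proof.
pose L i x : 'X_{1..n + m} := (U_(lshift m i) + U_(rshift n x))%MM.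
pose E (t : 'X_{1..n + m}) := [exists v : V, cell v && (L v.1 v.2 <= t)%MM].
have Eup : upclosed E.
  move=> t u /existsP [x /andP[cx xt]]; apply/existsP; exists x.
  by rewrite cx (lepm_trans xt) ?lem_addr.
have -> : @ferrers_ideal K n m lam mu = monomial_ideal E.
  apply: ideal_gen_monomial => // [_ [i [x [ix ->]]]|t /existsP [[i x] /andP[cx xt]]].
    rewrite -mpolyXD; apply/monomial_idealX/existsP; exists (i, x).
    by rewrite /ferrers_cell ix lepm_refl.
  by exists (L i x) => //; exists i, x; rewrite mpolyXD.
rewrite -[X in _ <-> X]/(is_true _); split.
  move=> /monomial_idealX /existsP [[i x] /andP[cx /mnm_lepP le]].
  case: v le => i' x' le.
  have := le (lshift m i); have := le (rshift n x); rewrite !mnmDE !mnm1E /=.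
  rewrite !eqxx !eq_lrshift !eq_rlshift !eq_lshift !eq_rshift.
  by case: (eqVneq i' i) => [->|]; case: (eqVneq x' x) => [->|].
by move=> cv; apply/monomial_idealX/existsP; exists v; rewrite cv lepm_refl.
Qed.

Lemma ferrers_complexE P :
  (P \in X) = (P \in simplex_prod n m) && [forall v in P, cell v].
Proof.
rewrite inE; congr andb; apply/boolp.asboolP/forall_inP => h v /h.
  by move/ferrers_idealX.
by move=> cv; apply/ferrers_idealX.
Qed.

(** Specialization does not lower degrees: if k is both a row and a column of P, then (k, k) is a
    vertex of P and its label x_k^2 supplies the exponent two. *)
Lemma mdeg_face_label P : P \in simplex_prod n m -> P != set0 ->
  mdeg (flabel P) = (#|rows P| + #|cols P|)%N.
Proof.
move=> Pp P0; have /simplex_prodP PE := Pp.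
pose t : 'X_{1..m} := (\sum_(i in rows P) U_(w i) + \sum_(x in cols P) U_(x))%MM.
have -> : flabel P = t.
  have r k : (\sum_(i in rows P) U_(w i))%MM k = (k \in [set w i | i in rows P]) :> nat.
    rewrite mnm_sumE; case: imsetP => [[i iP ->]|nk].
      rewrite (bigD1 i) //= mnm1E eqxx big1 // => j /andP[_ ji].
      rewrite mnm1E; case: eqP => // /(congr1 val) /= /val_inj jE.
      by rewrite jE eqxx in ji.
    rewrite big1 // => i iP; rewrite mnm1E; case: eqP => // ik.
    by case: nk; exists i.
  have c k : (\sum_(x in cols P) U_(x))%MM k = (k \in cols P) :> nat.
    rewrite mnm_sumE; case: (boolP (k \in cols P)) => kP.
      rewrite (bigD1 k) //= mnm1E eqxx big1 // => j /andP[_ jk].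
      by rewrite mnm1E (negPf jk).
    rewrite big1 // => j jP; rewrite mnm1E; case: eqP => // jk.
    by rewrite -jk jP in kP.
  have tP k : t k = ((k \in [set w i | i in rows P]) + (k \in cols P))%N.
    by rewrite mnmDE r c.
  have lab v : v \in P -> (label v <= t)%MM.
    rewrite {1}PE inE => /andP[v1 v2]; apply/mnm_lepP => k.
    rewrite tP mnmDE !mnm1E leq_add //.
      by case: eqP => // <-; rewrite imset_f.
    by case: eqP => // <-; rewrite v2.
  have le1 : (flabel P <= t)%MM by rewrite face_label_sub; apply/forall_inP.
  have le2 : (t <= flabel P)%MM.
    apply/mnm_lepP => k.
    have /set0Pn [i1 i1P] : rows P != set0 by rewrite rows_eq0.
    have /set0Pn [x1 x1P] : cols P != set0 by rewrite cols_eq0.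
    (* One vertex realizes the exponent of x_k: its row, respectively its column, is k whenever k
       occurs there, and arbitrary otherwise. *)
    pose i := if [pick i in rows P | w i == k] is Some i then i else i1.
    pose x := if k \in cols P then k else x1.
    have vP : (i, x) \in P.
      rewrite PE inE /i /x /=; case: pickP => [j /andP[-> _]|_]; rewrite ?i1P;
        by case: ifP.
    have : (label (i, x) <= flabel P)%MM.
      by have := lepm_refl (flabel P); rewrite {1}face_label_sub => /forall_inP; apply.
    move=> /mnm_lepP /(_ k); apply: leq_trans; rewrite tP mnmDE !mnm1E leq_add //.
      case: imsetP => // -[j jP kE]; rewrite /i; case: pickP => [j' /andP[_ ->] //|].
      by move=> /(_ j); rewrite jP kE eqxx.
    by rewrite /x; case: ifP => //; rewrite eqxx.
  by apply/mnmP => k; apply/eqP; rewrite eqn_leq (mnm_lepP le1) (mnm_lepP le2).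
rewrite mdegD !mdeg_sum; congr (_ + _)%N; rewrite -sum1_card;
  by apply: eq_bigr => i _; rewrite mdeg1.
Qed.

Lemma mdeg_ferrers_face P k : P \in X -> (0 < k)%N -> dim1 P = k ->
  mdeg (flabel P) = k.+1.
Proof.
rewrite ferrers_complexE => /andP[Pp _] k0 Pk.
have P0 : P != set0 by apply: contraTneq k0 => P0; rewrite -Pk P0 dim1_set0.
by rewrite mdeg_face_label // card_face // Pk.
Qed.

Lemma label_D v : cell v -> D (label v).
Proof. by move=> cv; apply/ferrers_monP; exists v.1, v.2; rewrite lepm_refl. Qed.

Lemma face_label_D P : P \in X -> P != set0 -> D (flabel P).
Proof.
rewrite ferrers_complexE => /andP[_ /forall_inP cP] /set0Pn [v vP].
have vl : (label v <= flabel P)%MM.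
  by have := lepm_refl (flabel P); rewrite {1}face_label_sub => /forall_inP; apply.
rewrite -(submK vl) addmC; apply: ferrers_mon_upclosed.
by apply: label_D; apply: cP.
Qed.

Lemma ferrers_strand_exact eps : incidence_function X dim1 eps ->
  forall b k (c : {set V} -> K), (0 < k)%N || D b ->
  strand_chain X dim1 label b k c ->
  (forall Q, Q \in X -> (dim1 Q).+1 = k -> boundary X dim1 eps c Q = 0) ->
  exists2 c', strand_chain X dim1 label b k.+1 c' &
    forall Q, Q \in X -> dim1 Q = k -> boundary X dim1 eps c' Q = c Q.
Proof.
move=> Xinc b k c kb cs cz.
pose good v := cell v && (label v <= b)%MM.
have gfaceE P : (P \in simplex_prod n m) && [forall v in P, good v] =
    (P \in X) && (flabel P <= b)%MM.
  rewrite ferrers_complexE face_label_sub -andbA; congr andb.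
  apply/forall_inP/andP => [g|[/forall_inP g1 /forall_inP g2] v vP].
    by split; apply/forall_inP => v /g /andP[].
  by rewrite /good g1 // g2.
(* Without a good cell only the empty face divides x^b and b is outside the ideal; then k > 0 and
   the strand is zero. *)
case: (pickP good) => [v0 gv0|ng]; last first.
  have nP P : (P \in X) && (flabel P <= b)%MM -> P = set0.
    rewrite -gfaceE => /andP[_ /forall_inP gP]; apply/eqP; apply: contraT.
    by case/set0Pn => v /gP; rewrite ng.
  have nD : ~~ D b.
    apply/negP => /ferrers_monP [i [x [ix ixb]]].
    by have := ng (i, x); rewrite /good /ferrers_cell ix ixb.
  rewrite (negPf nD) orbF in kb.
  exists (fun=> 0) => [P|Q QX Qk]; first by rewrite eqxx.
  rewrite /boundary big1 => [|P _]; last by rewrite mulr0.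
  apply/esym/eqP; apply: contraT => /cs [_ _ Qb].
  have Q0 : Q = set0 by apply: nP; rewrite QX.
  by rewrite -Qk Q0 dim1_set0 in kb.
pose rowP i := [exists x, good (i, x)].
have r0 : rowP v0.1 by apply/existsP; exists v0.2; case: (v0) gv0.
have [i0 /existsP [j0 gij] imin] := arg_minnP (fun i : 'I_n => i : nat) r0.
(* Moving a cell up to row [i0] could only fail by requiring the square of the variable of [i0];
   this does not occur, since x >= mu_i >= i > i0. *)
have gi0 i x : good (i, x) -> good (i0, x).
  move=> g; have ii : (i0 <= i)%N by apply: imin; apply/existsP; exists x.
  have := g; rewrite /good /ferrers_cell /= => /andP[/andP[mx xl] /mnm_lepP lb].
  have m0 := mu_mono ii; have l0 := lam_anti ii.
  rewrite (leq_trans m0 mx) (leq_trans xl l0) /=.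
  case: (eqVneq i i0) => [<-|ni]; first exact/mnm_lepP.
  have i0b : (0 < b (w i0))%N.
    have := gij; rewrite /good => /andP[_ /mnm_lepP /(_ (w i0))].
    by apply: leq_trans; rewrite mnmDE mnm1E eqxx.
  apply/mnm_lepP => y; rewrite mnmDE !mnm1E.
  have := lb y; rewrite mnmDE !mnm1E /=; case: (w i0 =P y) => [<-|_].
    rewrite (_ : (x == w i0) = false) ?addn0 //; apply/negbTE.
    rewrite -(inj_eq val_inj) /= neq_ltn.
    have i0i : (i0 < i)%N by rewrite ltn_neqAle ii andbT (inj_eq val_inj) eq_sym.
    by rewrite (leq_trans i0i) ?orbT // (leq_trans (mu_ge i)).
  by rewrite add0n; apply: leq_trans; rewrite leq_addl.
have := @simplex_prod_strand_exact n m K X eps good i0 j0.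
have Xp : {subset X <= simplex_prod n m}.
  by move=> P; rewrite ferrers_complexE => /andP[].
have Xg P : P \in simplex_prod n m -> (forall v, v \in P -> good v) -> P \in X.
  move=> Pp gP; have : (P \in X) && (flabel P <= b)%MM.
    by rewrite -gfaceE Pp; apply/forall_inP.
  by case/andP.
move=> /(_ Xp Xinc Xg gi0 gij k c); case=> //.
  by move=> P /cs [PX Pk Pb]; rewrite gfaceE PX.
move=> c' c's c'b; exists c' => // P /c's []; rewrite gfaceE => /andP[PX Pb] Pk.
by split.
Qed.

Lemma ferrers_resolution eps (A : zmodType) (wt : 'X_{1..m} -> A) :
  (forall t u, wt (t + u)%MM = wt t + wt u) ->
  incidence_function X dim1 eps ->
  @minimal_free_resolution K m A wt (fun _ => True) spec
    (graded_cellular_complex K X dim1 eps label wt) (const_mx 1).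
Proof.
move=> wtD Xinc; rewrite spec_ferrers_idealE.
have X0 : set0 \in X.
  rewrite ferrers_complexE; apply/andP; split; last by apply/forall_inP => v; rewrite inE.
  by apply/simplex_prodP/esym/eqP; rewrite setX_eq0 rows_set0 eqxx.
have neq0 P k : dim1 P = k.+1 -> P != set0.
  by move=> Pk; apply: contra_eqN Pk => /eqP ->; rewrite dim1_set0.
apply: graded_cellular_resolution => //.
- exact: ferrers_mon_upclosed.
- exact: dim1_set0.
- by move=> Q; rewrite ferrers_complexE => /andP[Qp _]; apply: dim1_eq0.
- by move=> P PX /neq0; apply: face_label_D.
- move=> P Q PX QX /andP[_ /eqP PQ]; apply/eqP => /(congr1 (@mdeg m)).
  rewrite (mdeg_ferrers_face PX _ PQ) //; case Qk: (dim1 Q) PQ => [|k] PQ.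
    have -> : Q = set0.
      by apply: dim1_eq0 => //; move: QX; rewrite ferrers_complexE => /andP[].
    by rewrite /face_label big_set0 mdeg0.
  rewrite (mdeg_ferrers_face QX _ Qk) // => -[]; lia.
- exact: ferrers_strand_exact.
Qed.

Lemma std_gradingD (t u : 'X_{1..m}) :
  std_grading (t + u)%MM = std_grading t + std_grading u.
Proof. by rewrite /std_grading mdegD PoszD. Qed.

Lemma fine_gradingD (t u : 'X_{1..m}) :
  fine_grading (t + u)%MM = fine_grading t + fine_grading u.
Proof. by apply/ffunP => i; rewrite !ffunE mnmDE PoszD. Qed.

Let sign := @join_sign n m.
Let sign_inc : incidence_function X dim1 sign :=
  join_sign_incidence ferrers_complexE.
Let F := graded_cellular_complex K X dim1 sign label (@std_grading m).

Let resF : @minimal_free_resolution K m _ (@std_grading m) (fun _ => True) spec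
  F (const_mx 1).
Proof. by apply: ferrers_resolution => //; apply: std_gradingD. Qed.

Lemma monomial_ideal_homog (E : pred 'X_{1..m}) :
  homog_closed (@std_grading m) (@monomial_ideal K m E).
Proof. by move=> a p Ep t; rewrite msupp_mfilter => /andP[_ /Ep]. Qed.

Lemma spec_ferrers_betti i : (0 < i)%N ->
  betti_number (fun _ => True) spec i
    ((\sum_(j < n) 'C(lam j - mu j + j, i))%:Z - 'C(n, i.+1)%:Z).
Proof.
move=> i0; split; first by exists F, (const_mx 1).
move=> G augG [rG minG]; have [rF minF] := resF.
have idI : is_ideal spec by apply: ideal_gen_ideal.
have hI : homog_closed (@std_grading m) spec.
  by rewrite spec_ferrers_idealE; apply: monomial_ideal_homog.
have [GF _] := minimal_resolution_rank_shift std_gradingD idI hI rG minG rF i.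
have [FG _] := minimal_resolution_rank_shift std_gradingD idI hI rF minF rG i.
have -> : grank G i = grank F i by apply/eqP; rewrite eqn_leq GF FG.
exact: (card_ferrers_faces lam_le lam_anti mu_mono ferrers_complexE i0).
Qed.

Lemma faces0 : faces_of_dim1 X dim1 0 = [set set0].
Proof.
apply/setP => Q; rewrite inE in_set1 ferrers_complexE.
apply/andP/eqP => [[/andP[Qp _] /eqP Q0]|->]; first exact: dim1_eq0.
rewrite dim1_set0; split=> //; apply/andP; split.
  by apply/simplex_prodP/esym/eqP; rewrite setX_eq0 rows_set0 eqxx.
by apply/forall_inP => v; rewrite inE.
Qed.

Lemma spec_ferrers_regularity : regularity spec (fun p => p = 0) 2.
Proof.
have r1 : grank F 0 = 1%N by rewrite /= faces0 cards1.
have s0 (i : 'I_(grank F 0)) : gshift i = 0.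
  have := enum_valP i; rewrite {2}faces0 inE => /eqP iE.
  by rewrite /= iE /face_label big_set0 /std_grading mdeg0.
have resG := shift_resolution r1 s0 resF.
set G := shift_complex F in resG.
have sG k (j : 'I_(grank G k)) : gshift j = (k.+2)%:Z :> int.
  have := enum_valP j; rewrite inE => /andP[jX /eqP jk].
  by rewrite /= /std_grading (mdeg_ferrers_face jX _ jk).
split; first by exists G; eexists; exact: resG.
move=> H augH [rH minH]; have [rG minG] := resG.
have id0 : is_ideal (fun p : S => p = 0).
  by split=> // [p q -> ->|c p ->]; rewrite ?addr0 ?mulr0.
have h0 : homog_closed (@std_grading m) (fun p : S => p = 0).
  by move=> a p ->; rewrite /homog_comp raddf0.
have sH k (i : 'I_(grank H k)) : gshift i - k%:Z = 2.
  have [_ /(_ i) [j <-]] :=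
    minimal_resolution_rank_shift std_gradingD id0 h0 rH minH rG k.
  by rewrite sG; lia.
split; last by move=> k i; rewrite sH.
(* The value 2 must be attained: the cell (0, mu_0) gives [G], and hence [H], a generator in degree
   0. *)
have [GH _] := minimal_resolution_rank_shift std_gradingD id0 h0 rG minG rH 0.
have : (0 < grank H 0)%N.
  apply: leq_trans GH; rewrite /= card_gt0; apply/set0Pn.
  pose i0 := Ordinal n_gt0; have x0 : (mu i0 < m)%N.
    exact: leq_trans (mu_lam i0 i0) (lam_le i0).
  exists (setX [set i0] [set Ordinal x0]); rewrite inE ferrers_complexE.
  rewrite setX_simplex_prod dim1E rowsX ?colsX -?card_gt0 ?cards1 //= andbT.
  apply/forall_inP => v; rewrite !inE /ferrers_cell => /andP[/eqP -> /eqP ->] /=.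
  by rewrite leqnn mu_lam.
by move=> H0; exists 0%N, (Ordinal H0); apply: sH.
Qed.

End FerrersResolution.

(** * Graphs *)

Section GraphFacts.

Variables (m : nat) (e : rel 'I_m) (loopdeg : nat).
Hypothesis m_gt0 : (0 < m)%N.
Hypothesis e_noisolated : forall i : 'I_m, exists j : 'I_m, e i j.
Hypothesis loopdegP : loopdeg = 1%N \/ loopdeg = 2%N.
Hypothesis e_ordered : forall i v : 'I_m, (i <= v)%N ->
  (induced_degree e loopdeg i v <= induced_degree e loopdeg i i)%N.

Notation n := (graph_n e).
Implicit Types (i : 'I_n) (x y : 'I_m).

Lemma lt_graph_n x y : (x <= y)%N -> e x y -> (x < n)%N.
Proof.
move=> xy exy; rewrite /graph_n (bigD1 x) /= ?leq_max ?leqnn //.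
by apply/existsP; exists y; rewrite xy.
Qed.

Lemma graph_n_gt0 : (0 < n)%N.
Proof.
have [y ey] := e_noisolated (Ordinal m_gt0).
exact: (lt_graph_n _ ey).
Qed.

Lemma graph_n_attained : exists x y, [/\ x.+1 = n, (x <= y)%N & e x y].
Proof.
have : n = 0%N \/ exists x y, [/\ x.+1 = n, (x <= y)%N & e x y].
  rewrite /graph_n; elim/big_ind: _ => [|a b [->|Ha] [->|Hb]|x /existsP [y /andP[xy exy]]].
  - by left.
  - by left.
  - by right; rewrite max0n.
  - by right; rewrite maxn0.
  - by right; case: (leqP a b) => _.
  - by right; exists x, y.
by case=> // n0; have := graph_n_gt0; rewrite n0.
Qed.

(* A row without edge to the right would have induced degree 0, while the     *)
(* last row, still available, has positive induced degree.                    *)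
Lemma row_nonempty i : exists2 y : 'I_m, (i <= y)%N & e (graph_vertex i) y.
Proof.
have [x [y [xn xy exy]]] := graph_n_attained.
have ix : (graph_vertex i <= x)%N by rewrite -ltnS xn /=.
have := e_ordered ix; set d := induced_degree _ _ _ x => dle.
have d0 : (0 < d)%N.
  rewrite /d /induced_degree; case: (eqVneq y x) => [yx|yx].
    have exx : e x x by rewrite -{2}yx.
    rewrite exx muln1 addn_gt0.
    by case: loopdegP => ->; rewrite orbT.
  rewrite addn_gt0 card_gt0; apply/orP; left; apply/set0Pn; exists y.
  by rewrite inE yx exy (leq_trans ix xy).
have : (0 < induced_degree e loopdeg (graph_vertex i) (graph_vertex i))%N.
  exact: leq_trans dle.
rewrite /induced_degree addn_gt0 => /orP[|].
  rewrite card_gt0 => /set0Pn [z]; rewrite inE => /and3P[iz _ ez].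
  by exists z.
rewrite muln_gt0 lt0b => /andP[_ ei].
by exists (graph_vertex i).
Qed.

Lemma graph_mu_le i y : (i <= y)%N -> e (graph_vertex i) y -> (graph_mu i <= y)%N.
Proof.
move=> iy ey; rewrite /graph_mu -[(y : nat)]/(y.+1.-1) -!subn1 leq_sub2r //.
rewrite -big_filter; apply: bigminn_le.
by rewrite mem_filter mem_index_enum /= iy ey.
Qed.

Lemma graph_mu_edge i : exists2 y : 'I_m, graph_mu i = y & (i <= y)%N && e (graph_vertex i) y.
Proof.
have [y iy ey] := row_nonempty i; have := graph_mu_le iy ey.
rewrite /graph_mu -big_filter; set r := filter _ _.
have [->|[z zr ->]] := bigminn_attained r (fun z : 'I_m => z.+1) m; last first.
  by exists z => //; move: zr; rewrite mem_filter => /andP[].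
(* The minimum can equal the default [m] only when [y] is the last vertex, and then [y] attains
   it. *)
move=> my; exists y; last by rewrite iy.
by apply/eqP; rewrite eqn_leq my -ltnS prednK // ltn_ord.
Qed.

Lemma lt_graph_lam i y : e (graph_vertex i) y -> (y < graph_lam i)%N.
Proof.
by move=> ey; rewrite /graph_lam (bigD1 y) //= leq_max leqnn.
Qed.

Lemma graph_lam_le i : (graph_lam i <= m)%N.
Proof. by apply/bigmax_leqP => y _; apply: ltn_ord. Qed.

Lemma graph_mu_ge i : (i <= graph_mu i)%N.
Proof. by have [y -> /andP[]] := graph_mu_edge i. Qed.

Lemma graph_mu_lt_lam i : (graph_mu i < graph_lam i)%N.
Proof. by have [y -> /andP[_ /lt_graph_lam]] := graph_mu_edge i. Qed.

Lemma graph_rowP x y : (x <= y)%N -> e x y ->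
  exists2 i : 'I_n, x = graph_vertex i & (graph_mu i <= y < graph_lam i)%N.
Proof.
move=> xy exy; pose i := Ordinal (lt_graph_n xy exy).
have xi : x = graph_vertex i by apply: val_inj.
by exists i; rewrite // graph_mu_le ?lt_graph_lam -?xi.
Qed.

End GraphFacts.

(* Indices are 0-based, so lambda_j - mu_j + j - 1 is lam j - mu j + j.       *)
Theorem proposition4p2 (K : fieldType) (m : nat) (e : rel 'I_m)
    (loopdeg : nat)
    (m_gt0 : (0 < m)%N)
    (e_sym : forall i j : 'I_m, e i j = e j i)
    (e_noisolated : forall i : 'I_m, exists j : 'I_m, e i j)
    (loopdegP : loopdeg = 1%N \/ loopdeg = 2%N)
    (e_ordered : forall i v : 'I_m, (i <= v)%N ->
       (induced_degree e loopdeg i v <= induced_degree e loopdeg i i)%N)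
    (lam_first : forall i : 'I_(graph_n e),
       i = 0%N :> nat -> graph_lam i = m)
    (lam_noninc : forall i j : 'I_(graph_n e),
       (i <= j)%N -> (graph_lam j <= graph_lam i)%N)
    (mu_nondec : forall i j : 'I_(graph_n e),
       (i <= j)%N -> (graph_mu i <= graph_mu j)%N)
    (e_fill : forall (i : 'I_(graph_n e)) (j : 'I_m),
       (graph_mu i <= j < graph_lam i)%N -> e (graph_vertex i) j) :
  let n := graph_n e in
  let lam := @graph_lam m e in
  let mu := @graph_mu m e in
  let I := edge_ideal e (K := K) in
  let whole := (fun _ : {mpoly K[m]} => True) in
  let zero := (fun p : {mpoly K[m]} => p = 0) in
  (forall p, I p <-> spec_ferrers_ideal (graph_n_le e) lam mu p) /\
  (forall eps,
     incidence_function (ferrers_complex K m lam mu)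
       (@simplex_prod_dim1 n m) eps ->
     minimal_cellular_resolution (ferrers_complex K m lam mu)
       (@simplex_prod_dim1 n m) eps
       (spec_ferrers_label (graph_n_le e)) I) /\
  regularity I zero 2 /\
  ideal_height I (\big[minn/n]_(j < n) (lam j - mu j + j)%N) /\
  quot_depth I (m - \max_(j < n) (lam j - mu j + j))%N /\
  (forall i : nat, (0 < i)%N ->
     betti_number whole I i
       ((\sum_(j < n) 'C(lam j - mu j + j, i))%:Z - 'C(n, i.+1)%:Z)).
Proof.
move=> n lam mu I whole zero.
have n_gt0 : (0 < n)%N by apply: graph_n_gt0.
have mu_ge (i : 'I_n) : (i <= mu i)%N.
  exact: (graph_mu_ge m_gt0 e_noisolated loopdegP e_ordered).
have mu_lt_lam (i : 'I_n) : (mu i < lam i)%N.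
  exact: (graph_mu_lt_lam m_gt0 e_noisolated loopdegP e_ordered).
have lam_le (i : 'I_n) : (lam i <= m)%N by apply: graph_lam_le.
have mu_lam (i j : 'I_n) : (mu i < lam j)%N.
  case: (leqP i j) => ij.
    exact: leq_ltn_trans (mu_nondec _ _ ij) (mu_lt_lam j).
  exact: leq_trans (mu_lt_lam i) (lam_noninc _ _ (ltnW ij)).
(* An edge, oriented so that x <= y, lies in row x between mu and lam; conversely [e_fill] makes
   every such cell an edge. *)
have IE : I = spec_ferrers_ideal (graph_n_le e) lam mu.
  rewrite spec_ferrers_idealE; apply: ideal_gen_monomial.
  - exact: ferrers_mon_upclosed.
  - move=> _ [x [y [exy ->]]]; rewrite -mpolyXD; apply/monomial_idealX.
    wlog xy : x y exy / (x <= y)%N.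
      move=> wl; case/orP: (leq_total x y) => [|yx]; first exact: wl.
      by rewrite addmC; apply: wl; rewrite // e_sym.
    have [i -> iy] := graph_rowP xy exy.
    by apply/ferrers_monP; exists i, y; rewrite lepm_refl.
  - move=> t /ferrers_monP [i [y [iy tl]]]; exists (U_(graph_vertex i) + U_(y))%MM => //.
    exists (graph_vertex i), y; rewrite mpolyXD.
    by split=> //; apply: e_fill.
split; first by rewrite IE.
rewrite IE; split.
  move=> eps inc.
  exact: (ferrers_resolution (graph_n_le e) n_gt0 mu_ge lam_noninc mu_nondec
    (@fine_gradingD m) inc).
split; first exact: spec_ferrers_regularity.
split; first exact: spec_ferrers_height.
split; first exact: spec_ferrers_depth.
by move=> i i0; apply: spec_ferrers_betti.
Qed.
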